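(* Fix a spline degree $p$. There exists a positive constant $c_{\infty,p}$, depending on $p$ only, such that: (1) for any $K_n$ (and $n$) and any index set $\alpha\subseteq\{1,\dots,K_n+p-2\}$, $$\big\|F_\alpha^T(F_\alpha\Lambda F_\alpha^T)^{-1}F_\alpha\big\|_\infty\le c_{\infty,p};$$ (2) for any $K_n$ (and $n$), $$\|\hat b(u)-\hat b(v)\|_\infty\le c_{\infty,p}\,\|u-v\|_\infty\qquad\text{for all } u,v\in\mathbb R^{K_n+p}.$$
   Context: Splines. Let $n$ be the sample size, $x_i=i/n$ ($i=1,\dots,n$), $p$ the spline degree, and $K_n$ a positive integer such that $M_n=n/K_n$ is an integer. The knots are $\kappa_j=j/K_n$ (equally spaced, also extended outside $[0,1]$: $j=-p,\dots,K_n+p$), and $B^{[p]}_1,\dots,B^{[p]}_{K_n+p}$ is the degree-$p$ B-spline basis on $[0,1]$ (partition of unity), with $B_k^{[p]}$ supported on $[\kappa_{k-p-1},\kappa_k]$. $X=[B_k^{[p]}(x_j)]_{j,k}\in\mathbb R^{n\times(K_n+p)}$; $\beta_n=\sum_{i=1}^n (B_k^{[p]}(x_i))^2$, which is the same for all $k=p+1,\dots,K_n$; $\Lambda=X^TX/\beta_n$, which is taken to be positive definite. $\Omega=\{b\in\mathbb R^{K_n+p}: b_k-2b_{k+1}+b_{k+2}\ge 0,\ k=1,\dots,K_n+p-2\}$. For $u\in\mathbb R^{K_n+p}$, $\hat b(u)=\arg\min_{b\in\Omega}\frac12 b^T\Lambda b-b^Tu$. The matrix $F_\alpha$. Put $N=K_n+p$.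 For $\alpha\subseteq\{1,\dots,N-2\}$ let $\ell=N-|\alpha|$ and let $j_1<\dots<j_\ell$ be the elements of $\{1,\dots,N\}\setminus\{i+1:i\in\alpha\}$ (so $j_1=1$, $j_\ell=N$). $F_\alpha\in\mathbb R^{\ell\times N}$ is the matrix of discrete hat functions: $(F_\alpha)_{s,i}$ equals $1$ if $i=j_s$, $(j_{s+1}-i)/(j_{s+1}-j_s)$ if $j_s<i<j_{s+1}$, $(i-j_{s-1})/(j_s-j_{s-1})$ if $j_{s-1}<i<j_s$, and $0$ otherwise. Its rows span $\{b\in\mathbb R^N: b_i-2b_{i+1}+b_{i+2}=0\ \forall i\in\alpha\}$. $\|\cdot\|_\infty$ is the maximum norm on vectors and the induced operator norm (maximum absolute row sum) on matrices. *)

(* Defs.v *)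
From mathcomp Require Import all_boot all_order all_algebra.
From mathcomp Require Import all_classical all_reals.
From mathcomp Require Import topology normedtype.

Set Implicit Arguments.
Unset Strict Implicit.
Unset Printing Implicit Defensive.

Import Order.TTheory GRing.Theory Num.Theory.
Import numFieldNormedType.Exports.

Local Open Scope classical_set_scope.
Local Open Scope ring_scope.

(* Rows, columns and elements of alpha are counted from 0: the column k of the
   design matrix is the B-spline of index k + 1, and its row i is the design
   point (i + 1) / n. *)

Section Splines.
Variable R : realType.

Definition knot (K : nat) (j : int) : R := j%:~R / K%:R.

(* Cox-de Boor recursion, with the indexing for which the B-spline of degree q
   and index k is supported on [knot (k - q - 1), knot k]. The intervals of
   degree 0 are open on the left and closed on the right, so that each of them
   contains n / K of the points 1 / n, ..., n / n; in positive degree the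
   B-splines are continuous and do not depend on this choice. *)
Fixpoint bspline (K q : nat) (k : int) (x : R) : R :=
  if q is q'.+1 then
    (x - knot K (k - q%:Z - 1)) / (knot K (k - 1) - knot K (k - q%:Z - 1))
      * bspline K q' (k - 1) x
    + (knot K k - x) / (knot K k - knot K (k - q%:Z)) * bspline K q' k x
  else if knot K (k - 1) < x <= knot K k then 1 else 0.

Definition design (n K p : nat) : 'M[R]_(n, K + p) :=
  \matrix_(i < n, k < K + p) bspline K p (k.+1)%:Z (i.+1%:R / n%:R).

(* The sums of squares over the design points agree for the indices p + 1, ...,
   K; the first of these indices is used, and it is available for every
   positive K. *)
Definition beta (n K p : nat) : R :=
  \sum_(i < n) bspline K p (p.+1)%:Z (i.+1%:R / n%:R) ^+ 2.

Definition Lambda (n K p : nat) : 'M[R]_(K + p) :=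
  (beta n K p)^-1 *: ((design n K p)^T *m design n K p).

Definition posdef (N : nat) (A : 'M[R]_N) : Prop :=
  A^T = A /\ forall b : 'cV[R]_N, b != 0 -> 0 < (b^T *m A *m b) 0 0.

Definition Omega (N : nat) : set 'cV[R]_N :=
  [set b | forall i j k : 'I_N, j = i.+1 :> nat -> k = i.+2 :> nat ->
     0 <= b i 0 - 2 * b j 0 + b k 0].

Definition objective (N : nat) (A : 'M[R]_N) (u b : 'cV[R]_N) : R :=
  2^-1 * (b^T *m A *m b) 0 0 - (b^T *m u) 0 0.

Definition is_argmin (N : nat) (A : 'M[R]_N) (u b : 'cV[R]_N) : Prop :=
  Omega b /\ forall b', Omega b' -> objective A u b <= objective A u b'.

(* The default value 0 is irrelevant when A is positive definite: the minimizer
   then exists and is unique. *)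
Definition bhat (N : nat) (A : 'M[R]_N) (u : 'cV[R]_N) : 'cV[R]_N :=
  xget 0 [set b | is_argmin A u b].

(* The increasing list j_1 < ... < j_l of the indices that are not the middle
   index i + 1 of a second difference with i in alpha; it has N - #|alpha|
   elements. *)
Definition breaks (N : nat) (alpha : {set 'I_(N - 2)}) : seq nat :=
  [seq k <- iota 0 N | ~~ [exists i in alpha, k == i.+1]].

(* In the last row, b is the default value 0 of nth and the second case does not
   occur; in the first row, a = j and the third case does not occur. *)
Definition hat_matrix (N : nat) (alpha : {set 'I_(N - 2)}) :
    'M[R]_(N - #|alpha|, N) :=
  \matrix_(s < N - #|alpha|, i < N)
    let a := nth 0%N (breaks alpha) s.-1 in
    let j := nth 0%N (breaks alpha) s in
    let b := nth 0%N (breaks alpha) s.+1 in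
    if i == j :> nat then 1
    else if (j < i < b)%N then (b - i)%:R / (b - j)%:R
    else if (a < i < j)%N then (i - a)%:R / (j - a)%:R
    else 0.

(* The operator norm induced by the maximum norm; the norm `|u| of a vector is
   the maximum norm. *)
Definition norm_infty (m n : nat) (A : 'M[R]_(m, n)) : R :=
  \big[Num.max/0]_(i < m) \sum_(j < n) `|A i j|.

End Splines.

(* Main.v *)
(* The rows of F_alpha span the discrete functions that are affine between
   consecutive breaks, so b = F^T (F Lambda F^T)^-1 F u is the Galerkin solution
   in this space: v^T Lambda b = v^T u for all v in it.

   Lambda is banded, uniformly coercive, and an interior row maps an affine
   function to a fixed multiple of itself. Let u live on a single gap between
   breaks, and follow the maximum of |b| on a window of p + 1 indices ending at
   successive breaks away from it. A long gap contracts it by 2/3: there the form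
   is nearly the one of the identity, for which continuous piecewise linear
   functions contract by 1/2. After a gap of bounded length the energy of the
   tail is bounded by the square of this maximum, and the energy decays
   geometrically in the number of breaks, whatever the lengths of the following
   gaps; so a fixed number of breaks also gives a factor 2/3. Summing the
   geometric decay over the gaps that carry u gives (1).

   For (2), bhat u is always one of the finitely many F^T (F Lambda F^T)^-1 F u
   and depends continuously on u; along a fine subdivision of a segment from u to
   v it jumps between the branches only boundedly often, so it inherits their
   common Lipschitz constant. *)
Require Import Defs.
From mathcomp Require Import all_boot all_order all_algebra.
From mathcomp Require Import all_classical all_reals.
From mathcomp Require Import topology normedtype.
From mathcomp Require Import zify ring lra.

Set Implicit Arguments.
Unset Strict Implicit.
Unset Printing Implicit Defensive.

Import Order.TTheory GRing.Theory Num.Theory.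
Import numFieldNormedType.Exports.

Local Open Scope ring_scope.

(** * Banded forms and piecewise affine functions *)

(** Neither energy nor sup norm estimates suffice alone. The energy decays by a fixed factor per
    break for all gap lengths, but comparing it with values costs the square root of a gap length.
    Lengths are therefore let in only where they cancel or are bounded: data on a single gap of
    length h have energy of order h, and h times the square of an end value is at most 4 times the
    energy on the gap; a short gap has bounded length; a long gap is treated by an explicit test
    function. The windows have p + 1 indices because p is the bandwidth: they are all that the
    equations to the right of a break see of the left side. Decay to the left is decay to the right
    of the reversed problem.

    Uniform coercivity is a second obstacle, as n / K is arbitrary. If n / K exceeds p, the design
    points of one knot interval already determine the coefficients that act on it, stably. Otherwise
    n / K takes finitely many values, and for each of them positive definiteness for a single K
    yields a constant for all larger K. *)

Ltac nat_lia := repeat match goal with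
  | H : is_true (Order.le _ _) |- _ => clear H
  | H : is_true (Order.lt _ _) |- _ => clear H
  end; lia.

Section BandedForm.
Variable R : realType.
Implicit Types (f g u v b : nat -> R) (brk : pred nat).

Lemma sum_ord_itv (N x y : nat) f : (y <= N)%N ->
  \sum_(i < N | (x <= i < y)%N) f i = \sum_(x <= i < y) f i.
Proof.
move=> yN.
rewrite -(big_mkord (fun i => (x <= i < y)%N) f) (big_nat_widenl x 0) //.
rewrite (big_nat_widen _ _ _ _ _ yN) /=.
by apply: eq_bigl => i; rewrite andbC.
Qed.

Lemma sum_itv_le (N x y : nat) f (c : R) : 0 <= c ->
  (forall i, (x <= i < y)%N -> f i <= c) ->
  \sum_(i < N | (x <= i < y)%N) f i <= (y - x)%:R * c.
Proof.
move=> c0 fc.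
apply: (@le_trans _ _ (\sum_(i < N | (x <= i < y)%N) c)).
  by apply: ler_sum => i; apply: fc.
apply: (@le_trans _ _ (\sum_(i < maxn N y | (x <= i < y)%N) c)).
  rewrite (big_ord_widen_cond _ (fun i => (x <= i < y)%N) (fun=> c) (leq_maxl N y)).
  by rewrite big_mkcond [leRHS]big_mkcond; apply: ler_sum => i _; do 2 case: ifP => //; lia.
rewrite (@sum_ord_itv (maxn N y) x y (fun=> c)) ?leq_maxr //.
by rewrite sumr_const_nat mulr_natl.
Qed.

Definition form (N : nat) (a : nat -> nat -> R) f g : R :=
  \sum_(i < N) \sum_(j < N) a i j * f i * g j.

(** All that the decay argument uses of [Lambda]. In the application [lam] and [C] depend on [p]
    only, whereas [sig] varies with the design but stays above [lam]. [bf_affine] concerns interior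
    rows only, since a B-spline that is cut off at 0 or 1 violates the identity. *)
Record banded_form (p N : nat) (lam C sig : R) (a : nat -> nat -> R) : Prop :=
  BandedForm {
    bf_lam : 0 < lam;
    bf_sig : lam <= sig;
    bf_C : lam <= C;
    bf_band : forall i j, (i < N)%N -> (j < N)%N ->
      ((i + p < j) || (j + p < i))%N -> a i j = 0;
    bf_bound : forall i j, (i < N)%N -> (j < N)%N -> `|a i j| <= C;
    bf_coercive : forall f, lam * \sum_(i < N) f i ^+ 2 <= form N a f f;
    bf_affine : forall (i : nat) (c d : R), (p <= i)%N -> (i + p < N)%N ->
      \sum_(j < N) a i j * (c + d * j%:R) = sig * (c + d * i%:R) }.

Lemma formDr N a f g1 g2 :
  form N a f (fun i => g1 i + g2 i) = form N a f g1 + form N a f g2.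
Proof.
rewrite /form -big_split; apply: eq_bigr => i _ /=.
by rewrite -big_split; apply: eq_bigr => j _ /=; ring.
Qed.

Lemma formNr N a f g : form N a f (fun i => - g i) = - form N a f g.
Proof.
rewrite /form -sumrN; apply: eq_bigr => i _ /=.
by rewrite -sumrN; apply: eq_bigr => j _ /=; ring.
Qed.

Lemma formBr N a f g1 g2 :
  form N a f (fun i => g1 i - g2 i) = form N a f g1 - form N a f g2.
Proof. by rewrite (formDr N a f g1 (fun i => - g2 i)) formNr. Qed.

Lemma formE N a f g : form N a f g = \sum_(i < N) f i * \sum_(j < N) a i j * g j.
Proof.
apply: eq_bigr => i _; rewrite mulr_sumr; apply: eq_bigr => j _; ring.
Qed.

Lemma eq_form N a f1 f2 g1 g2 :
  (forall i, (i < N)%N -> f1 i = f2 i) -> (forall i, (i < N)%N -> g1 i = g2 i) ->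
  form N a f1 g1 = form N a f2 g2.
Proof.
move=> ef eg; apply: eq_bigr => i _; apply: eq_bigr => j _.
by rewrite ef // eg.
Qed.

Lemma mul_le_young (x y t : R) : 0 < t -> `|x * y| <= t * x ^+ 2 + t^-1 * y ^+ 2.
Proof.
move=> t0; have ti : t * t^-1 = 1 by rewrite divff ?gt_eqF.
have ti0 : 0 < t^-1 by rewrite invr_gt0.
move: (t^-1) ti ti0 => s ti s0.
suff : 0 <= t * x ^+ 2 + s * y ^+ 2 - x * y /\ 0 <= t * x ^+ 2 + s * y ^+ 2 + x * y.
  by move=> [h1 h2]; rewrite ler_norml; apply/andP; split; lra.
have -> : t * x ^+ 2 + s * y ^+ 2 - x * y =
  t * (x - s * y / 2) ^+ 2 + s * y ^+ 2 * (1 - t * s / 4) - (1 - t * s) * x * y.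
  by field.
have -> : t * x ^+ 2 + s * y ^+ 2 + x * y =
  t * (x + s * y / 2) ^+ 2 + s * y ^+ 2 * (1 - t * s / 4) + (1 - t * s) * x * y.
  by field.
rewrite ti subrr !mul0r subr0 addr0.
have h : 0 <= s * y ^+ 2 * (1 - 1 / 4).
  apply: mulr_ge0; last by lra.
  by rewrite mulr_ge0 ?sqr_ge0 // ltW.
by split; apply: addr_ge0 => //; rewrite mulr_ge0 ?sqr_ge0 // ltW.
Qed.

Lemma band_count (N p i : nat) (c : R) : 0 <= c ->
  \sum_(j < N | ~~ ((i + p < j) || (j + p < i))%N) c <= (2 * p + 1)%N%:R * c.
Proof.
move=> c0.
rewrite (eq_bigl (fun j : 'I_N => (i - p <= j < i + p + 1)%N)); last by move=> j /=; lia.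
apply: (le_trans (@sum_itv_le N (i - p) (i + p + 1) (fun=> c) c c0 _)) => //.
by apply: ler_wpM2r => //; rewrite ler_nat; lia.
Qed.

Section Estimates.
Variables (p N : nat) (lam C sig : R) (a : nat -> nat -> R).
Hypothesis aP : banded_form p N lam C sig a.

Let D := C * (2 * p + 1)%N%:R.

(** Young's inequality on each entry of the band, in which an index meets at most [2 * p + 1]
    others. The parameter [t] stays free so that the [f] term can be absorbed by coercivity. *)
Lemma form_le f g t : 0 < t ->
  `|form N a f g| <= D * (t * \sum_(i < N) f i ^+ 2 + t^-1 * \sum_(j < N) g j ^+ 2).
Proof.
move=> t0.
have [->|N0] := posnP N.
  by rewrite /form !big_ord0 normr0 !mulr0 addr0 mulr0.
have C0 : 0 <= C by apply: le_trans (bf_bound aP N0 N0).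
pose nr i j := ~~ ((i + p < j) || (j + p < i))%N.
have step (i j : 'I_N) : `|a i j * f i * g j| <=
    if nr i j then C * (t * f i ^+ 2) + C * (t^-1 * g j ^+ 2) else 0.
  case: ifPn => [_|/negbNE h]; last by rewrite (bf_band aP) // !mul0r normr0.
  rewrite -mulrDr -mulrA normrM.
  apply: ler_pM => //; first exact: (bf_bound aP).
  exact: mul_le_young.
apply: (@le_trans _ _ (\sum_(i < N) \sum_(j < N)
   if nr i j then C * (t * f i ^+ 2) + C * (t^-1 * g j ^+ 2) else 0)).
  apply: le_trans (ler_norm_sum _ _ _) _; apply: ler_sum => i _.
  by apply: le_trans (ler_norm_sum _ _ _) _; apply: ler_sum => j _; apply: step.
under eq_bigr do rewrite -big_mkcond big_split /=.
rewrite big_split /= mulrDr; apply: lerD.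
  rewrite !mulr_sumr; apply: ler_sum => i _.
  apply: le_trans (band_count _ _ _ _) _.
    by rewrite mulr_ge0 // mulr_ge0 ?sqr_ge0 // ltW.
  by rewrite le_eqVlt; apply/orP; left; apply/eqP; rewrite /D; ring.
under eq_bigr do rewrite big_mkcond /=.
rewrite exchange_big /= !mulr_sumr; apply: ler_sum => j _.
rewrite -big_mkcond /=.
rewrite (eq_bigl (fun i : 'I_N => ~~ ((j + p < i) || (i + p < j))%N)); last first.
  by move=> i; rewrite /nr orbC.
apply: le_trans (band_count _ _ _ _) _.
  by rewrite mulr_ge0 // mulr_ge0 ?sqr_ge0 // invr_ge0 ltW.
by rewrite le_eqVlt; apply/orP; left; apply/eqP; rewrite /D; ring.
Qed.

Lemma row_le f (i : nat) c : (i < N)%N ->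
  (forall j, (j < N)%N -> (i <= j + p)%N -> (j <= i + p)%N -> `|f j| <= c) ->
  0 <= c -> `|\sum_(j < N) a i j * f j| <= D * c.
Proof.
move=> iN fc c0.
have C0 : 0 <= C by apply: le_trans (bf_bound aP iN iN).
apply: (@le_trans _ _ (\sum_(j < N | ~~ ((i + p < j) || (j + p < i))%N) C * c)).
  apply: le_trans (ler_norm_sum _ _ _) _; rewrite [leRHS]big_mkcond.
  apply: ler_sum => j _; case: ifPn => [h|/negbNE h]; last first.
    by rewrite (bf_band aP) // mul0r normr0.
  by rewrite normrM; apply: ler_pM => //; [exact: (bf_bound aP)|apply: fc => //; lia].
apply: le_trans (band_count _ _ _ _) _; first exact: mulr_ge0.
by rewrite le_eqVlt; apply/orP; left; apply/eqP; rewrite /D; ring.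
Qed.

End Estimates.

Definition pwlin N brk f := forall i, (i.+2 < N)%N -> ~~ brk i.+1 ->
  f i + f i.+2 = 2 * f i.+1.

Definition consecutive brk (x y : nat) :=
  [/\ (x < y)%N, brk x, brk y & forall i, (x < i < y)%N -> ~~ brk i].

Lemma pwlin_affine N brk f x y : pwlin N brk f -> consecutive brk x y -> (y < N)%N ->
  exists d, forall i, (x <= i <= y)%N -> f i = f x + (i - x)%:R * d.
Proof.
move=> fV [xy _ _ nb] yN; exists (f x.+1 - f x) => i /andP[xi iy].
rewrite -(subnKC xi) addKn; move: (i - x)%N (leq_sub2r x iy) => k {i xi iy}.
elim/ltn_ind: k => -[|[|k]] IH kh.
- by rewrite addn0 mul0r addr0.
- by rewrite addn1 mul1r; ring.
have := fV (x + k)%N; rewrite -!addnS => H.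
have : f (x + k)%N + f (x + k.+2)%N = 2 * f (x + k.+1)%N.
  by apply: H; [lia|apply: nb; lia].
rewrite (IH k) //; last by lia.
rewrite (IH k.+1) //; last by lia.
rewrite -(natr1 k.+1) -(natr1 k) => E.
by apply: (addrI (f x + k%:R * (f x.+1 - f x))); rewrite E; ring.
Qed.

Lemma pwlin_interp N brk f x y i : pwlin N brk f -> consecutive brk x y -> (y < N)%N ->
  (x <= i <= y)%N ->
  f i = ((y - i)%:R * f x + (i - x)%:R * f y) / (y - x)%:R.
Proof.
move=> fV xy yN iI; have [d fd] := pwlin_affine fV xy yN.
have [xlty _ _ _] := xy.
have h0 : (y - x)%:R != 0 :> R by rewrite pnatr_eq0; lia.
apply: (mulIf h0); rewrite mulfVK // (fd i) // (fd y); last by lia.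
rewrite (_ : (y - i)%:R = (y - x)%:R - (i - x)%:R); last by rewrite -natrB; [congr _%:R|]; lia.
ring.
Qed.

End BandedForm.

(** * Energy beyond a gap *)

Section TailDecay.
Variable R : realType.
Implicit Types (f g u v b : nat -> R) (brk : pred nat).

Lemma sum_affine (h : nat) (c d : R) :
  \sum_(k < h) (c + k%:R * d) ^+ 2 =
  h%:R * c ^+ 2 + h%:R * (h%:R - 1) * (c * d) +
  h%:R * (h%:R - 1) * (2 * h%:R - 1) / 6 * d ^+ 2.
Proof.
elim: h => [|h IH]; first by rewrite big_ord0 !mul0r !addr0.
by rewrite big_ord_recr /= IH -natr1; field.
Qed.

(** Complete the square in [c]. The constant 4 is that of the continuous case: the integral of (c +
    t d)^2 over [0, 1] is at least c^2 / 4, with equality for d = - 3 c / 2. *)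
Lemma sum_affine_ge (h : nat) (c d : R) :
  h%:R * c ^+ 2 <= 4 * \sum_(k < h) (c + k%:R * d) ^+ 2.
Proof.
rewrite sum_affine -subr_ge0.
case: h => [|h]; first by rewrite !mul0r !addr0 mulr0 subr0.
set e : R := h%:R; have e0 : 0 <= e by exact: ler0n.
have -> : (h.+1)%:R = e + 1 by rewrite natr1.
rewrite [leRHS](_ : _ = (e + 1) *
  (3 * (c + 2 / 3 * (d * e)) ^+ 2 + 2 / 3 * (e * d ^+ 2))); last by field.
apply: mulr_ge0; first by lra.
have : 0 <= e * d ^+ 2 by rewrite mulr_ge0 // sqr_ge0.
by have := sqr_ge0 (c + 2 / 3 * (d * e)); lra.
Qed.

Lemma pwlin_left_le N brk f x y : pwlin N brk f -> consecutive brk x y -> (y < N)%N ->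
  (y - x)%:R * f x ^+ 2 <= 4 * \sum_(i < N | (x <= i < y)%N) f i ^+ 2.
Proof.
move=> fV xy yN; have [xlty _ _ _] := xy; have [d fd] := pwlin_affine fV xy yN.
rewrite (@sum_ord_itv _ N x y (fun i => f i ^+ 2)) ?(ltnW yN) //.
rewrite -[x in \sum_(x <= _ < _) _]add0n big_addn big_mkord.
apply: le_trans (sum_affine_ge (y - x) (f x) d) _.
apply: ler_wpM2l => //; apply: ler_sum => i _.
by rewrite (fd (i + x)%N) ?addnK // leq_addl /=; have := ltn_ord i; nat_lia.
Qed.

Lemma pwlin_right_le N brk f x y : pwlin N brk f -> consecutive brk x y -> (y < N)%N ->
  (y - x)%:R * f y ^+ 2 <= 4 * \sum_(i < N | (x <= i <= y)%N) f i ^+ 2.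
Proof.
move=> fV xy yN; have [xlty _ _ _] := xy; have [d fd] := pwlin_affine fV xy yN.
rewrite (@sum_ord_itv _ N x y.+1 (fun i => f i ^+ 2)) //.
rewrite big_nat_recl ?(ltnW xlty) //.
rewrite -[x in \sum_(x <= _ < _) _]add0n big_addn big_mkord.
rewrite mulrDr; apply: ler_wpDl; first by rewrite mulr_ge0 ?sqr_ge0.
apply: le_trans (sum_affine_ge (y - x) (f y) (- d)) _.
rewrite (reindex_inj rev_ord_inj) /=.
apply: ler_wpM2l => //; apply: ler_sum => i _.
have ih := ltn_ord i.
rewrite (fd (i + x).+1); last by nat_lia.
rewrite (fd y); last by nat_lia.
rewrite (_ : (i + x).+1 - x = i.+1)%N; last by nat_lia.
rewrite [(y - x - i.+1)%:R]natrB; last by nat_lia.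
by rewrite le_eqVlt; apply/orP; left; apply/eqP; ring.
Qed.

Lemma interp_norm_le N brk f x y i c : pwlin N brk f -> consecutive brk x y ->
  (y < N)%N -> `|f x| <= c -> `|f y| <= c -> (x <= i <= y)%N -> `|f i| <= c.
Proof.
move=> fV xy yN fx fy iI; rewrite (pwlin_interp fV xy yN iI).
have [xlty _ _ _] := xy.
have h0 : 0 < (y - x)%:R :> R by rewrite ltr0n; nat_lia.
rewrite normrM normfV (gtr0_norm h0) ler_pdivrMr //.
apply: le_trans (ler_normD _ _) _; rewrite !normrM !normr_nat.
rewrite (_ : (y - x)%N = (y - i) + (i - x))%N; last by nat_lia.
by rewrite natrD mulrDr ![c * _]mulrC; apply: lerD; apply: ler_wpM2l.
Qed.

(** To the right of [x], this is [b] minus the hat at [x] that falls to 0 at [y]. It stays affine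
    between breaks, is an admissible test function for [orth_right] at [x], and agrees with [b] from
    [y] on. *)
Definition cut b (x y i : nat) : R :=
  if (i <= x)%N then 0
  else if (i < y)%N then b i - b x * ((y - i)%:R / (y - x)%:R) else b i.

Lemma pwlin_cut N brk b x y : pwlin N brk b -> consecutive brk x y -> (y < N)%N ->
  pwlin N brk (cut b x y).
Proof.
move=> bV xy yN i iN nbi; have [xlty bx bY nb] := xy.
have nix : i.+1 != x by apply: contraNneq nbi => ->.
have niy : i.+1 != y by apply: contraNneq nbi => ->.
have bi := bV i iN nbi.
have h0 : (y - x)%:R != 0 :> R by rewrite pnatr_eq0; nat_lia.
have ex j : (x <= j <= y)%N -> cut b x y j = b j - b x * ((y - j)%:R / (y - x)%:R).
  move=> jI; rewrite /cut; case: ifPn => jx.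
    have -> : j = x by nat_lia.
    by rewrite divff // mulr1 subrr.
  case: ifPn => // jy; rewrite (_ : (y - j)%N = 0%N); last by nat_lia.
  by rewrite mul0r mulr0 subr0.
case: (ltngtP i.+1 x) nix => // [ix|ix] _.
  rewrite /cut (_ : i <= x)%N; last by nat_lia.
  rewrite (_ : i.+2 <= x)%N; last by nat_lia.
  by rewrite (ltnW ix) addr0 mulr0.
case: (ltngtP i.+1 y) niy => // [iy|iy] _.
  rewrite !ex; try nat_lia.
  rewrite (_ : y - i = (y - i.+2) + 2)%N; last by nat_lia.
  rewrite (_ : y - i.+1 = (y - i.+2) + 1)%N; last by nat_lia.
  rewrite !natrD; transitivity (b i + b i.+2 - b x * ((2 * (y - i.+2)%:R + 2)/(y - x)%:R)).
    by field.
  by rewrite bi; field.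
have e2 j : (y <= j)%N -> cut b x y j = b j.
  by move=> yj; rewrite /cut !ifN //; nat_lia.
by rewrite !e2 //; nat_lia.
Qed.

Lemma cut_left b x y i : (i <= x)%N -> cut b x y i = 0.
Proof. by rewrite /cut => ->. Qed.

Definition tail N b (z : nat) := \sum_(i < N | (z <= i)%N) b i ^+ 2.

Lemma le_tail N b z w : (z <= w)%N -> tail N b w <= tail N b z.
Proof.
move=> zw; rewrite /tail big_mkcond [leRHS]big_mkcond; apply: ler_sum => i _.
by case: ifPn => h; case: ifPn => h'; rewrite ?sqr_ge0 //; nat_lia.
Qed.

Lemma tail_split N b z w : (z <= w)%N ->
  tail N b z = \sum_(i < N | (z <= i < w)%N) b i ^+ 2 + tail N b w.
Proof.
move=> zw; rewrite /tail (bigID (fun i : 'I_N => (i < w)%N)) /=; congr (_ + _).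
by apply: eq_bigl => i; nat_lia.
Qed.

Lemma sqr_le_tail N b z : (z < N)%N -> b z ^+ 2 <= tail N b z.
Proof.
move=> zN; rewrite /tail (bigD1 (Ordinal zN)) //= lerDl.
by apply: sumr_ge0 => i _; exact: sqr_ge0.
Qed.

Lemma tail_ge0 N b z : 0 <= tail N b z.
Proof. by apply: sumr_ge0 => i _; exact: sqr_ge0. Qed.

Definition orth_right N (a : nat -> nat -> R) brk b x := forall v, pwlin N brk v ->
  (forall i, (i <= x)%N -> v i = 0) -> form N a v b = 0.

Section Tail.
Variables (p N : nat) (lam C sig : R) (a : nat -> nat -> R).
Hypothesis aP : banded_form p N lam C sig a.
Variables (brk : pred nat) (b : nat -> R) (x0 : nat).
Hypothesis bV : pwlin N brk b.
Hypothesis b_orth : forall v, pwlin N brk v ->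
  (forall i, (i <= x0)%N -> v i = 0) -> form N a v b = 0.

Let D := C * (2 * p + 1)%N%:R.
Let C1 := 4 * (D / lam) ^+ 2.

Let lam0 : 0 < lam. Proof. exact: bf_lam aP. Qed.
Let D0 : 0 < D.
Proof. by rewrite mulr_gt0 ?ltr0n ?addn1 //; apply: lt_le_trans (bf_C aP). Qed.

(** Test with [v = cut b x y]. The difference [b - v] vanishes from [y] on, and by the band [v]
    meets only its part [g] from [x - p] on; so coercivity bounds [v], and with it [b] beyond [y],
    by [g]. *)
Lemma tail_cut x y : (x0 <= x)%N -> consecutive brk x y -> (y < N)%N ->
  tail N b y <= C1 * (\sum_(i < N | (x - p <= i < x)%N) b i ^+ 2 + (y - x)%:R * b x ^+ 2).
Proof.
move=> x0x xy yN; have [xlty _ _ _] := xy.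
pose v := cut b x y; pose g i := if (x - p <= i)%N then b i - v i else 0.
have vb : form N a v b = 0.
  by apply: b_orth; [exact: pwlin_cut|move=> i ix; apply: cut_left; nat_lia].
have vg : form N a v (fun i => b i - v i) = form N a v g.
  apply: eq_bigr => i _; apply: eq_bigr => j _; rewrite /g; case: ifPn => // jx.
  have [ix|ix] := leqP i x; first by rewrite /v cut_left // !(mulr0, mul0r).
  by rewrite (bf_band aP) ?mul0r //; nat_lia.
have vv : form N a v v = - form N a v g by rewrite -vg formBr vb; ring.
(* Half of the coercivity absorbs the [v] term. The coefficient [D / t = 2 * D ^+ 2 / lam] of the
   other term, divided by the remaining [lam / 2], is [C1]. *)
pose t := lam / (2 * D).
have t0 : 0 < t by rewrite divr_gt0 // mulr_gt0.
have := form_le aP v g t0; rewrite -/D => h1.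
have h2 := bf_coercive aP v.
set V := \sum_(i < N) v i ^+ 2 in h1 h2; set G := \sum_(j < N) g j ^+ 2 in h1.
have hV : V <= C1 * G.
  have h3 : lam * V <= D * (t * V + t^-1 * G).
    apply: le_trans h2 _; rewrite vv; apply: le_trans h1.
    by rewrite -normrN; exact: ler_norm.
  have e : D * (t * V + t^-1 * G) = lam / 2 * V + lam / 2 * (C1 * G).
    by rewrite /t /C1; field; rewrite !gt_eqF.
  rewrite e in h3.
  have : lam / 2 * V <= lam / 2 * (C1 * G) by lra.
  by rewrite ler_pM2l // divr_gt0.
apply: (@le_trans _ _ V).
  rewrite /tail /V [leRHS](bigID (fun i : 'I_N => (y <= i)%N)) /=.
  apply: ler_wpDr; first by apply: sumr_ge0 => i _; exact: sqr_ge0.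
  apply: ler_sum => i yi; rewrite /v /cut !ifN //; nat_lia.
apply: le_trans hV _.
rewrite ler_wpM2l //; first by rewrite mulr_ge0 // sqr_ge0.
rewrite /G (bigID (fun i : 'I_N => (x - p <= i < x)%N)) /=.
apply: lerD.
  apply: ler_sum => i h; rewrite /g /v cut_left ?subr0; last by nat_lia.
  by rewrite ifT //; nat_lia.
rewrite (bigID (fun i : 'I_N => (x <= i < y)%N)) /= addrC big1 ?add0r; last first.
  move=> i h; rewrite /g; case: ifPn => hi; last by rewrite expr0n.
  by rewrite /v /cut !ifN ?subrr ?expr0n //; nat_lia.
rewrite (eq_bigl (fun i : 'I_N => (x <= i < y)%N)); last by move=> i /=; nat_lia.
apply: (@sum_itv_le R N x y (fun i => g i ^+ 2) _ (sqr_ge0 _)) => i h.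
rewrite /g ifT; last by nat_lia.
have h0 : 0 < (y - x)%:R :> R by rewrite ltr0n; nat_lia.
have h0' : (y - x)%:R != 0 :> R by rewrite gt_eqF.
have -> : b i - v i = b x * ((y - i)%:R / (y - x)%:R).
  rewrite /v /cut; case: ifPn => ix; last by rewrite ifT; [ring|nat_lia].
  have -> : i = x by nat_lia.
  by rewrite divff // mulr1 subr0.
rewrite exprMn ler_piMr ?sqr_ge0 // exprn_ile1 ?divr_ge0 //.
by rewrite ler_pdivrMr // mul1r ler_nat; nat_lia.
Qed.

Lemma tail_cut_bound x y m : (x0 <= x)%N -> consecutive brk x y -> (y < N)%N ->
  (forall i, (x - p <= i <= x)%N -> `|b i| <= m) ->
  tail N b y <= C1 * (p + (y - x))%N%:R * m ^+ 2.
Proof.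
move=> x0x xy yN bm; have [xlty _ _ _] := xy.
have m2 i : (x - p <= i <= x)%N -> b i ^+ 2 <= m ^+ 2.
  move=> h; rewrite -[b i ^+ 2]real_normK ?num_real // lerXn2r ?nnegrE ?bm //.
  by apply: le_trans (bm i h).
apply: le_trans (tail_cut x0x xy yN) _; rewrite -mulrA.
apply: ler_wpM2l; first by rewrite mulr_ge0 // sqr_ge0.
rewrite natrD mulrDl; apply: lerD; last first.
  by rewrite ler_wpM2l // m2 // leq_subr leqnn.
have h : forall i, (x - p <= i < x)%N -> b i ^+ 2 <= m ^+ 2 by move=> i hi; apply: m2; nat_lia.
apply: le_trans (@sum_itv_le R N (x - p) x (fun i => b i ^+ 2) _ (sqr_ge0 m) h) _.
by rewrite ler_wpM2r ?sqr_ge0 // ler_nat; nat_lia.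
Qed.

(** Hole filling: [(y - x)%:R * b x ^+ 2] is at most 4 times the energy on the gap, so the tail at
    [y] is at most [4 * C1] times the energy lost between [x - p] and [y]. Adding [4 * C1] times the
    tail at [y] to both sides gives the contraction, in which the gap length no longer occurs. *)
Lemma tail_step x y : (x0 <= x)%N -> consecutive brk x y -> (y < N)%N ->
  (1 + 4 * C1) * tail N b y <= 4 * C1 * tail N b (x - p).
Proof.
move=> x0x xy yN; have [xlty _ _ _] := xy.
have C10 : 0 <= C1 by rewrite mulr_ge0 // sqr_ge0.
have h := tail_cut x0x xy yN.
have h4 := pwlin_left_le bV xy yN.
rewrite (@tail_split N b (x - p) x) ?leq_subr // (@tail_split N b x y) ?(ltnW xlty) //.
set A := \sum_(i < N | (x - p <= i < x)%N) _ in h *.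
set B := \sum_(i < N | (x <= i < y)%N) _ in h4 *.
have A0 : 0 <= A by apply: sumr_ge0 => i _; exact: sqr_ge0.
have : tail N b y <= C1 * (4 * A + 4 * B).
  by apply: le_trans h _; rewrite ler_wpM2l //; lra.
lra.
Qed.

End Tail.
End TailDecay.

(** * Decay across the breaks *)

Section Decay.
Variable R : realType.
Implicit Types (f g u v b : nat -> R) (brk : pred nat).

(** The breaks in the interval open at [x] and closed at [z]: counts are additive, and moving from a
    break to the next one counts 1. *)
Definition nbreaks brk (x z : nat) : nat := (\sum_(x <= k < z) brk k.+1)%N.

Lemma nbreaks_cat brk x y z : (x <= y <= z)%N ->
  (nbreaks brk x y + nbreaks brk y z)%N = nbreaks brk x z.
Proof. by move=> /andP[xy yz]; rewrite /nbreaks [in RHS](@big_cat_nat _ _ _ y). Qed.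

Lemma nbreaks_le brk x z : (nbreaks brk x z <= z - x)%N.
Proof.
rewrite /nbreaks -[leqRHS]mul1n -[leqRHS]mulnC -sum_nat_const_nat.
by apply: leq_sum => i _; case: (brk _).
Qed.

Lemma nbreaks_gap brk x z : (forall k, (x < k <= z)%N -> ~~ brk k) ->
  nbreaks brk x z = 0%N.
Proof.
move=> nb; apply: big1_seq => k; rewrite mem_index_iota => /andP[_ h].
by rewrite (negbTE (nb _ _)).
Qed.

Lemma nbreaks_next brk x y : consecutive brk x y -> nbreaks brk x y = 1%N.
Proof.
case: y => [[]//|y] [xy _ by_ nb].
rewrite -(@nbreaks_cat _ _ y) ?leqnSn ?andbT // nbreaks_gap.
  by rewrite /nbreaks big_nat1 by_.
by move=> k h; apply: nb; nat_lia.
Qed.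

Lemma last_break brk x z : brk x -> (x <= z)%N ->
  exists w, [/\ (x <= w <= z)%N, brk w & forall k, (w < k <= z)%N -> ~~ brk k].
Proof.
move=> bx; elim: z => [|z IH].
  by rewrite leqn0 => /eqP x0; exists 0%N; split => [||k]; rewrite -?x0 //; nat_lia.
rewrite leq_eqVlt => /orP[/eqP e|xz].
  by exists x; split => // [|k]; nat_lia.
case bz : (brk z.+1); first by exists z.+1; split => // [|k]; nat_lia.
have [//|w [wI bw nw]] := IH; exists w; split => // [|k kI]; first by nat_lia.
by have [->|kz] := eqVneq k z.+1; [rewrite bz|apply: nw; nat_lia].
Qed.

Lemma prev_break brk x z : brk x -> brk z -> (x < z)%N ->
  exists2 w, (x <= w)%N & consecutive brk w z.
Proof.
move=> bx bz xz; have [|w [wI bw nw]] := @last_break brk x z.-1 bx; first by nat_lia.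
by exists w; [nat_lia|split => // [|k kI]; [nat_lia|apply: nw; nat_lia]].
Qed.

Lemma next_break brk x w : brk x -> brk w -> (x < w)%N ->
  exists2 y, (y <= w)%N & consecutive brk x y.
Proof.
move=> bx bw xw; have ex : exists y, (x < y)%N && brk y by exists w; rewrite xw.
have [y /andP[xy by_] ymin] := ex_minnP ex.
exists y; first by apply: ymin; rewrite xw.
split=> // k /andP[xk ky]; apply/negP => bk.
by have := ymin k; rewrite xk bk leqNgt ky => /(_ isT).
Qed.

Lemma bernoulli (t : R) n : 0 <= t <= 1 -> 1 - n%:R * t <= (1 - t) ^+ n.
Proof.
move=> /andP[t0 t1]; elim: n => [|n IH]; first by rewrite mul0r subr0 expr0.
rewrite exprS -natr1; apply: (@le_trans _ _ ((1 - t) * (1 - n%:R * t))).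
  have : 0 <= n%:R * t * t by rewrite !mulr_ge0.
  by lra.
by apply: ler_wpM2l => //; lra.
Qed.

Lemma geometric_small (t e : R) : 0 < t <= 1 -> 0 < e -> exists n, (1 - t) ^+ n <= e.
Proof.
move=> /andP[t0 t1] e0.
have key n : (1 - t) ^+ n * (1 + n%:R * t) <= 1.
  elim: n => [|n IH]; first by rewrite mul0r addr0 mulr1 expr0.
  apply: le_trans IH; rewrite exprSr -mulrA; apply: ler_wpM2l.
    by rewrite exprn_ge0 //; lra.
  rewrite -natr1.
  have : 0 <= n%:R * t * t by rewrite !mulr_ge0 // ltW.
  have : 0 <= t * t by rewrite mulr_ge0 // ltW.
  by lra.
pose n := Num.bound (e^-1 / t); exists n.
have hn : e^-1 <= 1 + n%:R * t.
  have : e^-1 / t < n%:R.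
    by apply: archi_boundP; rewrite divr_ge0 ?invr_ge0 // ltW.
  by rewrite ltr_pdivrMr // => h; lra.
have P0 : 0 <= (1 - t) ^+ n by rewrite exprn_ge0 //; lra.
have := le_trans (ler_wpM2l P0 hn) (key n).
by rewrite ler_pdivrMr // mul1r.
Qed.

Section Tail.
Variables (p N : nat) (lam C sig : R) (a : nat -> nat -> R).
Hypothesis aP : banded_form p N lam C sig a.
Variables (brk : pred nat) (b : nat -> R) (x0 : nat).
Hypothesis bV : pwlin N brk b.
Hypothesis b_orth : forall v, pwlin N brk v ->
  (forall i, (i <= x0)%N -> v i = 0) -> form N a v b = 0.

Let D := C * (2 * p + 1)%N%:R.
Let C1 := 4 * (D / lam) ^+ 2.

(** Go back from [z] to the last break [w], then to the break [x] before it, and apply [tail_step]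
    to end at [x - p]. This passes at most [p + 1] breaks, namely [w] and those among [p] indices,
    and gains [r ^+ p.+1], that is, [r] per break. The factor on the left pays for the start, where
    at most [p] breaks remain and only monotonicity of the tail is available. *)
Lemma tail_decay (r : R) y z : 0 < r <= 1 -> 4 * C1 <= (1 + 4 * C1) * r ^+ p.+1 ->
  brk y -> (x0 <= y <= z)%N -> (z < N)%N ->
  r ^+ p.+1 * tail N b z <= r ^+ nbreaks brk y z * tail N b y.
Proof.
move=> /andP[r0 r1] hr by_ /andP[x0y].
have C10 : 0 <= C1 by rewrite mulr_ge0 // sqr_ge0.
have rle n m : (n <= m)%N -> r ^+ m <= r ^+ n.
  by move=> nm; apply: ler_wiXn2l => //; exact: ltW.
elim/ltn_ind: z => z IH yz zN.
have [cz|cz] := leqP (nbreaks brk y z) p.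
  apply: ler_pM; rewrite ?exprn_ge0 ?tail_ge0 //; [exact: ltW|by apply: rle; nat_lia|].
  exact: le_tail.
have [w [wI bw nw]] := last_break by_ yz.
have yw : (y < w)%N.
  rewrite ltn_neqAle (proj1 (andP wI)) andbT; apply/eqP => yw.
  by move: cz; rewrite nbreaks_gap // => k; rewrite yw; apply: nw.
have [x xy xw] := prev_break by_ bw yw.
have wN : (w < N)%N by nat_lia.
have e1 : nbreaks brk y z = (nbreaks brk y x + 1)%N.
  rewrite -(@nbreaks_cat brk y w z) // (nbreaks_gap nw) addn0.
  rewrite -(@nbreaks_cat brk y x w) ?(nbreaks_next xw) //.
  by have [] := xw; nat_lia.
have ypx : (y <= x - p)%N by have := nbreaks_le brk y x; nat_lia.
have e2 : (nbreaks brk y z <= nbreaks brk y (x - p) + p.+1)%N.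
  rewrite e1 -(@nbreaks_cat brk y (x - p) x); last by nat_lia.
  by have := nbreaks_le brk (x - p) x; nat_lia.
have xpz : (x - p < z)%N by have [] := xw; nat_lia.
have {}IH := IH _ xpz ypx (ltn_trans xpz zN).
have x0x : (x0 <= x)%N by nat_lia.
have st := tail_step aP bV b_orth x0x xw wN; rewrite -/D -/C1 in st.
have {}st : tail N b w <= r ^+ p.+1 * tail N b (x - p).
  have c1 : 0 < 1 + 4 * C1 by lra.
  rewrite -(ler_pM2l c1); apply: le_trans st _; rewrite [leRHS]mulrA.
  exact: (ler_wpM2r (tail_ge0 N b (x - p)) hr).
have wz : (w <= z)%N by nat_lia.
apply: (@le_trans _ _ (r ^+ p.+1 * (r ^+ p.+1 * tail N b (x - p)))).
  apply: ler_wpM2l; first by rewrite exprn_ge0 // ltW.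
  exact: le_trans (le_tail _ _ wz) st.
apply: (@le_trans _ _ (r ^+ p.+1 * (r ^+ nbreaks brk y (x - p) * tail N b y))).
  by apply: ler_wpM2l => //; rewrite exprn_ge0 // ltW.
rewrite mulrA -exprD; apply: ler_wpM2r; first exact: tail_ge0.
by apply: rle; nat_lia.
Qed.

End Tail.

Lemma sqr_le_norm (x c : R) : 0 <= c -> x ^+ 2 <= c ^+ 2 -> `|x| <= c.
Proof.
by move=> c0; rewrite -[x ^+ 2]real_normK ?num_real // ler_pXn2r // nnegrE.
Qed.

Lemma orth_right_trans N a brk b x y : (x <= y)%N ->
  orth_right N a brk b x -> orth_right N a brk b y.
Proof. by move=> xy h v vV v0; apply: h => // i ix; apply: v0; apply: leq_trans xy. Qed.

(* The energy of the tail is at most a multiple of m ^ 2 because the first gap is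
   short; after that only the number of breaks matters, not the later gaps. *)
Lemma short_gap p (lam C : R) (H : nat) : 0 < lam -> lam <= C ->
  exists (K : R) (L : nat), 1 <= K /\
  forall N sig a, banded_form p N lam C sig a ->
  forall brk b x y (m : R), pwlin N brk b -> orth_right N a brk b x ->
  consecutive brk x y -> (y < N)%N -> (y - x <= H)%N ->
  (forall i, (x - p <= i <= x)%N -> `|b i| <= m) ->
  (forall i, (x <= i < N)%N -> `|b i| <= K * m) /\
  (forall z, (x <= z < N)%N -> (L <= nbreaks brk x z)%N ->
     forall i, (z - p <= i <= z)%N -> `|b i| <= 2 / 3 * m).
Proof.
move=> lam0 lamC.
pose C1 := 4 * (C * (2 * p + 1)%N%:R / lam) ^+ 2.
have C10 : 0 <= C1 by rewrite mulr_ge0 // sqr_ge0.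
have c1 : 0 < 1 + 4 * C1 by lra.
pose A := C1 * (p + H)%N%:R.
have A0 : 0 <= A by rewrite mulr_ge0.
(* Chosen such that Bernoulli's inequality bounds [(1 - t) ^+ p.+1] below by
   [4 * C1 / (1 + 4 * C1)], the contraction factor of [tail_step]. *)
pose t := (1 + 4 * C1)^-1 / p.+1%:R.
have t0 : 0 < t by rewrite divr_gt0 // invr_gt0.
have t1 : t <= 1.
  rewrite /t ler_pdivrMr // mul1r; apply: (@le_trans _ _ 1).
    by rewrite invf_le1 //; lra.
  by rewrite -natr1 lerDr.
have hr : 4 * C1 <= (1 + 4 * C1) * (1 - t) ^+ p.+1.
  apply: (@le_trans _ _ ((1 + 4 * C1) * (1 - p.+1%:R * t))).
    have -> : p.+1%:R * t = (1 + 4 * C1)^-1.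
      by rewrite /t mulrC divfK // pnatr_eq0.
    by rewrite mulrBr mulr1 divff ?gt_eqF //; lra.
  by apply: ler_wpM2l; [exact: ltW|apply: bernoulli; rewrite ltW].
have [r1|r1] := ltP (1 - t) 0; first by move: t1; lra.
(* If [1 - t] were 0, [hr] would give [C1 = 0], hence [C = 0], against [0 < lam <= C]. *)
have r0 : 0 < 1 - t.
  rewrite lt_neqAle r1 andbT eq_sym; apply/eqP => e.
  move: hr; rewrite e expr0n /= mulr0 => hC.
  have C1e : C1 = 0 by lra.
  move: C1e; rewrite /C1 => /eqP; rewrite mulf_eq0 pnatr_eq0 /= sqrf_eq0.
  rewrite !mulf_eq0 invr_eq0 (gt_eqF lam0) orbF pnatr_eq0 addn1 /= orbF.
  by move/eqP => C0; move: lamC; rewrite C0; lra.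
(* The factor [(1 - t) ^+ p.+1] compensates the loss in [tail_decay]; 2 / 3 is squared because
   energies are compared. *)
have [n hn] : exists n, (1 - t) ^+ n <= (1 - t) ^+ p.+1 * ((2 / 3) ^+ 2 / (1 + A)).
  apply: geometric_small; first by rewrite t0.
  by rewrite mulr_gt0 ?exprn_gt0 // divr_gt0 ?exprn_gt0; lra.
(* The break [y] that ends the short gap counts 1, and the [p] indices before [z] contain at most
   [p] breaks; at least [n] breaks remain for the energy decay from [y] to [z - p]. *)
exists (1 + A), (n + p + 2)%N; split; first by lra.
move=> N sig a aP brk b x y m bV orth xy yN yxH bm.
have [xlty bx by_ nb] := xy.
have m0 : 0 <= m by apply: le_trans (bm x _) => //; rewrite leq_subr leqnn.
have bxm : `|b x| <= m by apply: bm; rewrite leq_subr leqnn.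
have ty : tail N b y <= A * m ^+ 2.
  apply: le_trans (tail_cut_bound aP bV orth (leqnn x) xy yN bm) _.
  rewrite -/C1; apply: ler_wpM2r; first exact: sqr_ge0.
  by rewrite /A; apply: ler_wpM2l => //; rewrite ler_nat; nat_lia.
have hi i : (y <= i < N)%N -> `|b i| <= (1 + A) * m.
  move=> /andP[yi iN]; apply: sqr_le_norm; first by rewrite mulr_ge0 //; lra.
  apply: le_trans (sqr_le_tail b iN) _; apply: le_trans (le_tail _ _ yi) _.
  apply: le_trans ty _; rewrite exprMn; apply: ler_wpM2r; first exact: sqr_ge0.
  by have := sqr_ge0 A; rewrite sqrrD; lra.
split.
  move=> i /andP[xi iN]; have [yi|iy] := leqP y i; first by apply: hi; rewrite yi.
  apply: (interp_norm_le bV xy yN); last by nat_lia.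
    by apply: le_trans bxm _; rewrite ler_peMl //; lra.
  by apply: hi; rewrite leqnn.
move=> z /andP[xz zN] Lz i iI.
have nxy := nbreaks_next xy.
have yz : (y <= z)%N.
  rewrite leqNgt; apply/negP => zy; move: Lz; rewrite nbreaks_gap; first by nat_lia.
  by move=> k kI; apply: nb; nat_lia.
have nyz : nbreaks brk x z = (1 + nbreaks brk y z)%N.
  by rewrite -(@nbreaks_cat brk x y z) ?nxy //; nat_lia.
have yzp : (y <= z - p)%N by have := nbreaks_le brk y z; nat_lia.
have nyzp : (n <= nbreaks brk y (z - p))%N.
  have := @nbreaks_cat brk y (z - p) z; have := nbreaks_le brk (z - p) z; nat_lia.
have iN : (i < N)%N by nat_lia.
apply: sqr_le_norm; first by rewrite mulr_ge0 //; lra.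
apply: le_trans (sqr_le_tail b iN) _.
have zpi : (z - p <= i)%N by nat_lia.
apply: le_trans (le_tail _ _ zpi) _.
have q0 : 0 < (1 - t) ^+ p.+1 by rewrite exprn_gt0.
rewrite -(ler_pM2l q0).
have td : (1 - t) ^+ p.+1 * tail N b (z - p) <=
    (1 - t) ^+ nbreaks brk y (z - p) * tail N b y.
  apply: (tail_decay aP bV orth) => //; [|by nat_lia|by nat_lia].
  by rewrite r0 gerBl ltW.
apply: le_trans td _.
apply: (@le_trans _ _ ((1 - t) ^+ n * ((1 + A) * m ^+ 2))).
  apply: ler_pM; rewrite ?tail_ge0 ?exprn_ge0 //; try exact: ltW.
    by apply: ler_wiXn2l => //; lra.
  apply: le_trans ty _; apply: ler_wpM2r; first exact: sqr_ge0.
  by lra.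
apply: (@le_trans _ _ ((1 - t) ^+ p.+1 * ((2 / 3) ^+ 2 / (1 + A)) * ((1 + A) * m ^+ 2))).
  by apply: ler_wpM2r => //; rewrite mulr_ge0 ?sqr_ge0 //; lra.
rewrite -mulrA le_eqVlt; apply/orP; left; apply/eqP; congr (_ * _).
by field; lra.
Qed.

End Decay.

(** * Contraction across a long gap *)

Section LongGap.
Variable R : realType.
Implicit Types (f g u v b : nat -> R) (brk : pred nat).

Lemma sum_hat_product (n : nat) (h A B : R) :
  \sum_(k < n) (A * k%:R ^+ 2 - B * (k%:R * (h - k%:R))) =
  A * (n%:R * (n%:R - 1) * (2 * n%:R - 1) / 6)
  - B * (h * n%:R * (n%:R - 1) / 2 - n%:R * (n%:R - 1) * (2 * n%:R - 1) / 6).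
Proof.
elim: n => [|n IH]; first by rewrite big_ord0; ring.
by rewrite big_ord_recr /= IH -natr1; field.
Qed.

(* Test with v = cut b x y. The rows at distance at least p from x and y give
   sig * \sum v_i b_i, essentially sig * h * (Y ^ 2 / 3 - Y * m / 6) with h = y - x
   and Y = |b y|; the coercivity of the form bounds the rows beyond y from below,
   and the remaining ones contribute O(Y ^ 2) if Y > 3 / 5 * m. As 1 / 3 exceeds
   5 / 3 * 1 / 6, this is impossible for large h. *)
Lemma long_gap p (lam C : R) : 0 < lam -> lam <= C ->
  exists H : nat,
  forall N sig a, banded_form p N lam C sig a ->
  forall brk b x y (m : R), pwlin N brk b -> orth_right N a brk b x ->
  consecutive brk x y -> (y < N)%N -> (H <= y - x)%N ->
  (forall i, (x - p <= i <= x)%N -> `|b i| <= m) ->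
  (forall i, (x <= i <= y)%N -> `|b i| <= m) /\
  (forall i, (y - p <= i <= y)%N -> `|b i| <= 2 / 3 * m).
Proof.
move=> lam0 lamC.
pose D := C * (2 * p + 1)%N%:R.
have D0 : 0 < D by rewrite mulr_gt0 ?ltr0n ?addn1 //; apply: lt_le_trans lamC.
(* In units of [Y ^+ 2], the two terms bound the negative contributions of the [p] rows from [x] on
   and of the rows from [y - p] on. *)
pose C6 := 2 * p%:R * D + 8 * p%:R * (D ^+ 2 / lam).
have C60 : 0 <= C6.
  have D2 : 0 <= D ^+ 2 / lam by rewrite divr_ge0 ?sqr_ge0 // ltW.
  have D0' := ltW D0.
  by apply: addr_ge0; apply: mulr_ge0 => //; apply: mulr_ge0.
(* The part [15 * p] makes the window before [y] a small fraction of the gap. The number 18 is the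
   inverse of 1 / 3 - 5 / 3 * 1 / 6, and [2 * p%:R] accounts for the rows at both ends that are left
   out of the main sum. *)
pose H := (15 * p + 1 + Num.bound (18 * (C6 / lam + 1 / 2 + 2 * p%:R)))%N.
have HP : 18 * (C6 / lam + 1 / 2 + 2 * p%:R) < H%:R.
  apply: (@lt_le_trans _ _ (Num.bound (18 * (C6 / lam + 1 / 2 + 2 * p%:R)))%:R).
    apply: archi_boundP.
    have : 0 <= C6 / lam by rewrite divr_ge0 // ltW.
    have : 0 <= p%:R :> R by exact: ler0n.
    lra.
  by rewrite ler_nat /H leq_addl.
have keyH (h : R) : H%:R <= h -> C6 < lam * (h / 18 - 1 / 2 - 2 * p%:R).
  move=> Hh; have : C6 / lam < h / 18 - 1 / 2 - 2 * p%:R by lra.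
  by rewrite ltr_pdivrMr // mulrC.
have H15 : (15 * p + 1 <= H)%N by rewrite /H leq_addr.
move: H keyH H15 {HP} => H keyH H15; exists H => N sig a aP brk b x y m bV orth xy yN hH bm.
have [xlty bx by_ nb] := xy.
have sig_lam := bf_sig aP.
have bxm : `|b x| <= m by apply: bm; rewrite leq_subr leqnn.
have m0 : 0 <= m by apply: le_trans bxm.
set h : R := (y - x)%:R.
have h0 : 0 < h by rewrite ltr0n; nat_lia.
have hn0 : h != 0 by rewrite gt_eqF.
set Y : R := `|b y|.
have Y0 : 0 <= Y by exact: normr_ge0.
have interp := pwlin_interp bV xy yN.
(* Going back from [y] by at most [p <= h / 15] adds at most [m / 15] to the interpolated value, and
   3 / 5 + 1 / 15 = 2 / 3. *)
suff Ym : Y <= 3 / 5 * m.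
  have inner : forall i, (x <= i <= y)%N -> `|b i| <= m.
    move=> i iI; apply: (interp_norm_le bV xy yN) => //.
    by apply: le_trans Ym _; lra.
  split=> // i iI.
  rewrite interp; last by nat_lia.
  rewrite -/h normrM normfV (gtr0_norm h0) ler_pdivrMr //.
  apply: le_trans (ler_normD _ _) _; rewrite !normrM !normr_nat -/Y.
  have e1 : (y - i)%:R * 15 <= h :> R by rewrite /h -natrM ler_nat; nat_lia.
  have e2 : (i - x)%:R <= h :> R by rewrite /h ler_nat; nat_lia.
  have e3 : (i - x)%:R * Y <= h * (3 / 5 * m) by apply: ler_pM.
  have e4 : (y - i)%:R * `|b x| <= h / 15 * m by apply: ler_pM => //; lra.
  by lra.
rewrite leNgt; apply/negP => Ym.
have m2Y : m <= 5 / 3 * Y by lra.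
have Ypos : 0 < Y by lra.
pose v := cut b x y.
have vV : pwlin N brk v by apply: pwlin_cut.
have vb : form N a v b = 0 by apply: orth => // i ix; apply: cut_left.
have vE i : (x <= i <= y)%N -> v i = (i - x)%:R / h * b y.
  move=> iI; have := interp i iI; rewrite -/h /v /cut -/h => bi.
  case: ifPn => ix.
    by rewrite (_ : i - x = 0)%N ?mul0r //; nat_lia.
  case: ifPn => iy; rewrite bi.
    by field.
  by rewrite (_ : y - i = 0)%N ?mul0r ?add0r ?(mulrAC _ (b y)) //; nat_lia.
have bin j : (x - p <= j <= y)%N -> `|b j| <= 2 * Y.
  move=> jI; have [jx|xj] := leqP j x.
    by apply: (@le_trans _ _ m); [apply: bm; nat_lia|lra].
  apply: (interp_norm_le bV xy yN); last by nat_lia.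
    by apply: le_trans bxm _; lra.
  by rewrite -/Y; lra.
(* Rows below [w] see [b] only up to [y]. From [w] on the band can reach past [y], where [b] is not
   under control, and coercivity replaces the explicit computation. *)
pose w := (y - p)%N.
pose Lb i := \sum_(j < N) a i j * b j.
have near i : (x <= i < x + p)%N -> - (2 * D * Y ^+ 2) <= v i * Lb i.
  move=> iI; have iN : (i < N)%N by nat_lia.
  suff : `|v i * Lb i| <= 2 * D * Y ^+ 2 by rewrite ler_norml => /andP[].
  rewrite normrM (_ : 2 * D * Y ^+ 2 = Y * (D * (2 * Y))); last by ring.
  apply: ler_pM => //.
    rewrite vE; last by nat_lia.
    rewrite normrM -/Y ger0_norm ?divr_ge0 // ?(ltW h0) // ler_piMl //.
    by rewrite ler_pdivrMr // mul1r ler_nat; nat_lia.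
  apply: (row_le aP iN); last by rewrite mulr_ge0.
  by move=> j jN ij ji; apply: bin; nat_lia.
have mid i : (x + p <= i < w)%N -> Lb i = sig * b i.
  move=> iI; have [d bd] := pwlin_affine bV xy yN.
  have xi : (x <= i)%N by nat_lia.
  rewrite bd; last by nat_lia.
  rewrite (_ : b x + (i - x)%:R * d = (b x - x%:R * d) + d * i%:R); last first.
    by rewrite natrB //; ring.
  rewrite -(bf_affine aP); [|by nat_lia|by nat_lia].
  apply: eq_bigr => j _.
  have [jI|jI] := boolP ((i + p < j) || (j + p < i))%N.
    by rewrite (bf_band aP) ?mul0r //; nat_lia.
  have xj : (x <= j)%N by nat_lia.
  rewrite (bd j); last by nat_lia.
  by congr (_ * _); rewrite natrB //; ring.
pose v2 i := if (w <= i)%N then v i else 0.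
have right : - (8 * p%:R * (D ^+ 2 / lam) * Y ^+ 2) <= form N a v2 b.
  pose g j := if (w - p <= j)%N then b j - v2 j else 0.
  have -> : form N a v2 b = form N a v2 v2 + form N a v2 g.
    rewrite -formDr; apply: eq_bigr => i _; apply: eq_bigr => j _.
    rewrite /g; case: ifPn => jw; first by congr (_ * _); ring.
    rewrite /v2; case: ifPn => iw; last by rewrite !mulr0 !mul0r.
    by rewrite (bf_band aP) ?mul0r //; nat_lia.
  (* With this parameter the first Young term equals the coercive lower bound of [form N a v2 v2].
     What remains is the term in [g], which has at most [2 * p] nonzero entries, each at most
     [2 * Y] in absolute value. *)
  have t0 : 0 < lam / D by rewrite divr_gt0.
  have := form_le aP v2 g t0; rewrite -/D => h1.
  have h2 := bf_coercive aP v2.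
  set V := \sum_(i < N) v2 i ^+ 2 in h1 h2.
  set G := \sum_(j < N) g j ^+ 2 in h1.
  have GP : G <= (2 * p)%N%:R * (2 * Y) ^+ 2.
    rewrite /G (bigID (fun i : 'I_N => (w - p <= i < y)%N)) /= [X in _ + X]big1.
      rewrite addr0.
      have hg i : (w - p <= i < y)%N -> g i ^+ 2 <= (2 * Y) ^+ 2.
        move=> iI; rewrite -[leLHS]real_normK ?num_real // lerXn2r ?nnegrE ?mulr_ge0 //.
        rewrite /g ifT; last by nat_lia.
        rewrite /v2; case: ifPn => iw; last by rewrite subr0; apply: bin; nat_lia.
        rewrite vE; last by nat_lia.
        rewrite interp; last by nat_lia.
        rewrite -/h (_ : _ - _ = (y - i)%:R / h * b x); last by field.
        rewrite normrM ger0_norm ?divr_ge0 // ?(ltW h0) //.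
        apply: (@le_trans _ _ (1 * m)); last by lra.
        apply: ler_pM => //; first by rewrite divr_ge0 // ltW.
        by rewrite ler_pdivrMr // mul1r ler_nat; nat_lia.
      apply: le_trans (@sum_itv_le R N (w - p) y (fun i => g i ^+ 2) _ (sqr_ge0 _) hg) _.
      by apply: ler_wpM2r; [exact: sqr_ge0|rewrite ler_nat; nat_lia].
    move=> i iI; rewrite /g; case: ifPn => hi; last by rewrite expr0n.
    rewrite /v2 ifT; last by nat_lia.
    by rewrite /v /cut !ifN ?subrr ?expr0n //; nat_lia.
  have e : D * (lam / D * V + (lam / D)^-1 * G) = lam * V + D ^+ 2 / lam * G.
    by field; rewrite !gt_eqF.
  rewrite e in h1.
  have D2 : 0 <= D ^+ 2 / lam by rewrite divr_ge0 ?sqr_ge0 // ltW.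
  have h3 := ler_wpM2l D2 GP.
  have e5 : D ^+ 2 / lam * ((2 * p)%N%:R * (2 * Y) ^+ 2) =
    8 * p%:R * (D ^+ 2 / lam) * Y ^+ 2 by rewrite natrM; ring.
  rewrite e5 in h3.
  by move: h1; rewrite ler_norml => /andP[h1 _]; lra.
have splitform : form N a v b =
    \sum_(i < N | (x <= i < w)%N) v i * Lb i + form N a v2 b.
  rewrite !formE [X in _ = X + _]big_mkcond -big_split; apply: eq_bigr => i _ /=.
  rewrite -/(Lb i) /v2.
  have xw : (x < w)%N by nat_lia.
  case: (leqP x i) => xi; last first.
    have vi : v i = 0 by apply: cut_left; exact: ltnW.
    by rewrite vi if_same mul0r add0r.
  by case: (ltnP i w) => iw; rewrite ?mul0r ?addr0 ?add0r.
have wN : (w <= N)%N by nat_lia.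
rewrite vb (@sum_ord_itv _ N x w (fun i => v i * Lb i) wN) in splitform.
have xpw : (x <= x + p <= w)%N by nat_lia.
have [xxp xpw'] := andP xpw.
rewrite (@big_cat_nat _ _ _ (x + p) x w xpredT _ xxp xpw') /= in splitform.
have nearsum : - (p%:R * (2 * D * Y ^+ 2)) <= \sum_(x <= i < x + p) v i * Lb i.
  apply: (@le_trans _ _ (\sum_(x <= i < x + p) - (2 * D * Y ^+ 2))).
    rewrite sumr_const_nat addKn -mulr_natl; lra.
  by apply: ler_sum_nat => i iI; apply: near.
(* A lower bound of [v i * b i] at [i = x + k]: the product [b x * b y], of unknown sign, is
   replaced by [- (m * Y)]. *)
pose psi (k : nat) := Y ^+ 2 / h ^+ 2 * k%:R ^+ 2 - m * Y / h ^+ 2 * (k%:R * (h - k%:R)).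
have midsum : sig * \sum_(x + p <= i < w) psi (i - x)%N <=
    \sum_(x + p <= i < w) v i * Lb i.
  rewrite mulr_sumr; apply: ler_sum_nat => i iI.
  rewrite mid // mulrCA; apply: ler_wpM2l; first lra.
  rewrite vE; last by nat_lia.
  rewrite (interp i); last by nat_lia.
  rewrite -/h (_ : (y - i)%:R = h - (i - x)%:R); last first.
    by rewrite /h -natrB; [congr _%:R|]; nat_lia.
  set k : R := (i - x)%:R.
  have k0 : 0 <= k by exact: ler0n.
  have kh : 0 <= h - k by rewrite subr_ge0 /k /h ler_nat; nat_lia.
  have YY : Y ^+ 2 = b y ^+ 2 by rewrite real_normK // num_real.
  rewrite (_ : k / h * b y * (((h - k) * b x + k * b y) / h) =
     b y ^+ 2 / h ^+ 2 * k ^+ 2 + b x * b y / h ^+ 2 * (k * (h - k))); last by field.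
  rewrite -YY lerD2l -subr_ge0.
  rewrite (_ : _ - _ = (b x * b y + m * Y) / h ^+ 2 * (k * (h - k))); last by ring.
  apply: mulr_ge0; last exact: mulr_ge0.
  apply: divr_ge0; last exact: sqr_ge0.
  have : `|b x * b y| <= m * Y by rewrite normrM; apply: ler_wpM2r.
  by rewrite ler_norml => /andP[]; lra.
have psi_full : \sum_(x <= i < y) psi (i - x)%N =
    Y ^+ 2 * ((h - 1) * (2 * h - 1) / (6 * h)) - m * Y * ((h ^+ 2 - 1) / (6 * h)).
  rewrite -[x in \sum_(x <= _ < _) _]add0n big_addn big_mkord.
  under eq_bigr do rewrite addnK.
  by rewrite sum_hat_product -/h; field.
have psi_le i : (x <= i <= y)%N -> psi (i - x)%N <= Y ^+ 2.
  move=> iI; rewrite /psi; set k : R := (i - x)%:R.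
  have k0 : 0 <= k by exact: ler0n.
  have kh : k <= h by rewrite /k /h ler_nat; nat_lia.
  have : 0 <= m * Y / h ^+ 2 * (k * (h - k)).
    by rewrite mulr_ge0 ?divr_ge0 ?mulr_ge0 ?sqr_ge0 // subr_ge0.
  have : Y ^+ 2 / h ^+ 2 * k ^+ 2 <= Y ^+ 2.
    rewrite -mulrA ler_piMr ?sqr_ge0 // mulrC ler_pdivrMr ?exprn_gt0 // mul1r.
    by rewrite lerXn2r // nnegrE ltW.
  by lra.
have psi_mid : \sum_(x <= i < y) psi (i - x)%N <=
    2 * p%:R * Y ^+ 2 + \sum_(x + p <= i < w) psi (i - x)%N.
  rewrite (@big_cat_nat _ _ _ (x + p) x y) /=; [|by nat_lia|by nat_lia].
  rewrite (@big_cat_nat _ _ _ w (x + p) y) /=; [|by nat_lia|by nat_lia].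
  have s1 : \sum_(x <= i < x + p) psi (i - x)%N <= p%:R * Y ^+ 2.
    apply: (@le_trans _ _ (\sum_(x <= i < x + p) Y ^+ 2)).
      by apply: ler_sum_nat => i iI; apply: psi_le; nat_lia.
    by rewrite sumr_const_nat addKn mulr_natl.
  have s2 : \sum_(w <= i < y) psi (i - x)%N <= p%:R * Y ^+ 2.
    apply: (@le_trans _ _ (\sum_(w <= i < y) Y ^+ 2)).
      by apply: ler_sum_nat => i iI; apply: psi_le; nat_lia.
    rewrite sumr_const_nat mulr_natl (_ : y - w = p)%N //; nat_lia.
  lra.
have psi_low : Y ^+ 2 * (h / 18 - 1 / 2) <= \sum_(x <= i < y) psi (i - x)%N.
  rewrite psi_full.
  have hi0 : 0 < h^-1 by rewrite invr_gt0.
  have h1 : 1 <= h by rewrite /h ler1n; nat_lia.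
  have e1 : (h - 1) * (2 * h - 1) / (6 * h) = h / 3 - 1 / 2 + h^-1 / 6 by field.
  have e2 : (h ^+ 2 - 1) / (6 * h) = h / 6 - h^-1 / 6 by field.
  have mY : m * Y <= 5 / 3 * Y ^+ 2 by rewrite expr2 mulrA; apply: ler_wpM2r.
  have hh : 0 <= h / 6 - h^-1 / 6.
    have : h^-1 <= 1 by rewrite invf_le1.
    lra.
  have := ler_wpM2r hh mY; rewrite e1 e2.
  have Yh : 0 <= Y ^+ 2 * h^-1 by rewrite mulr_ge0 ?sqr_ge0 // ltW.
  have : Y ^+ 2 * h^-1 <= Y ^+ 2.
    by rewrite ler_piMr ?sqr_ge0 // invf_le1.
  lra.
have Hh : H%:R <= h by rewrite /h ler_nat.
have Y2 : 0 < Y ^+ 2 by rewrite exprn_gt0.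
have key := keyH h Hh.
have pos : 0 <= h / 18 - 1 / 2 - 2 * p%:R.
  rewrite -(pmulr_rge0 _ lam0); apply: le_trans (ltW key); exact: C60.
have final : lam * (h / 18 - 1 / 2 - 2 * p%:R) * Y ^+ 2 <= C6 * Y ^+ 2.
  have s3 : Y ^+ 2 * (h / 18 - 1 / 2 - 2 * p%:R) <= \sum_(x + p <= i < w) psi (i - x)%N.
    by lra.
  have s4 : lam * (Y ^+ 2 * (h / 18 - 1 / 2 - 2 * p%:R)) <=
      sig * \sum_(x + p <= i < w) psi (i - x)%N.
    apply: ler_pM => //; first exact: ltW.
    by rewrite mulr_ge0 // ltW.
  by rewrite /C6; lra.
by rewrite ler_pM2r // leNgt key in final.
Qed.

End LongGap.

(** * Pointwise decay, reversal, and data on one gap *)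

Section SupBound.
Variable R : realType.
Implicit Types (f g u v b : nat -> R) (brk : pred nat).

(** Jump from break to break, replacing [m] by [2 / 3 * m] each time: across one long gap, or across
    [L.+1] breaks when the next gap is short. A jump passes at most [L.+1] breaks, so
    [2 / 3 <= rho ^+ L.+1] pays for it; the factor [3 / 2] in the constant covers the last,
    incomplete jump. *)
Lemma decay_right p (lam C : R) : 0 < lam -> lam <= C ->
  exists K rho : R, [/\ 1 <= K, 0 < rho, rho < 1 &
  forall N sig a, banded_form p N lam C sig a ->
  forall brk b x (m : R), brk N.-1 -> brk x -> (x < N)%N ->
  pwlin N brk b -> orth_right N a brk b x ->
  (forall i, (x - p <= i <= x)%N -> `|b i| <= m) ->
  forall i, (x <= i < N)%N -> `|b i| <= K * rho ^+ nbreaks brk x i * m].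
Proof.
move=> lam0 lamC; have [H long] := long_gap p lam0 lamC.
have [K [L [K1 short]]] := short_gap p H lam0 lamC.
pose t : R := (3 * L.+1%:R)^-1; pose rho := 1 - t.
have L0 : 1 <= L.+1%:R :> R by rewrite ler1n.
have t0 : 0 < t by rewrite invr_gt0; lra.
have t3 : t <= 1 / 3 by rewrite /t div1r lef_pV2 ?posrE; lra.
have rho0 : 0 < rho by rewrite /rho; lra.
have rho1 : rho < 1 by rewrite /rho; lra.
have rhoL k : (k <= L.+1)%N -> 2 / 3 <= rho ^+ k.
  move=> kL; apply: (@le_trans _ _ (rho ^+ L.+1)); last first.
    by apply: ler_wiXn2l => //; exact: ltW.
  apply: (@le_trans _ _ (1 - L.+1%:R * t)).
    have -> : L.+1%:R * t = 1 / 3 by rewrite /t; field; lra.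
    by lra.
  by apply: bernoulli; rewrite (ltW t0) /=; lra.
clearbody rho; clear t t0 t3 L0.
exists (3 / 2 * K), rho; split => //; first by lra.
move=> N sig a aP brk b x m bN; move: {-1}(N - x)%N (leqnn (N - x)) => n.
elim: n x m => [|n IH] x m nx bx xN bV orth bm i /andP[xi iN]; first by move: nx; nat_lia.
have bxm : `|b x| <= m by apply: bm; rewrite leq_subr leqnn.
have m0 : 0 <= m by apply: le_trans bxm.
have step y : (x < y <= i)%N -> brk y -> (nbreaks brk x y <= L.+1)%N ->
    (forall j, (y - p <= j <= y)%N -> `|b j| <= 2 / 3 * m) ->
    `|b i| <= 3 / 2 * K * rho ^+ nbreaks brk x i * m.
  move=> /andP[xy yi] by_ nL bym.
  have xyi : (x <= y <= i)%N by rewrite (ltnW xy) yi.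
  have yN : (y < N)%N by exact: leq_ltn_trans iN.
  have nyn : (N - y <= n)%N by move: nx xy xN; clear; nat_lia.
  have yiN : (y <= i < N)%N by rewrite yi.
  have := IH y (2 / 3 * m) nyn by_ yN bV (orth_right_trans (ltnW xy) orth) bym i yiN.
  move=> h; apply: le_trans h _.
  rewrite -(nbreaks_cat brk xyi) exprD.
  have e0 : 0 <= 3 / 2 * K * rho ^+ nbreaks brk y i * m.
    apply: mulr_ge0 => //; apply: mulr_ge0; first by lra.
    by rewrite exprn_ge0 // ltW.
  have := ler_wpM2l e0 (rhoL _ nL); lra.
have near : (nbreaks brk x i <= L.+1)%N -> `|b i| <= K * m ->
    `|b i| <= 3 / 2 * K * rho ^+ nbreaks brk x i * m.
  move=> nL h; apply: le_trans h _.
  have e0 : 0 <= 3 / 2 * K * m by apply: mulr_ge0 => //; lra.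
  have := ler_wpM2l e0 (rhoL _ nL); lra.
have Km : m <= K * m by rewrite ler_peMl.
have [xE|xE] := eqVneq x i.
  apply: near; last by rewrite -xE; lra.
  by rewrite xE nbreaks_gap // => k; nat_lia.
have xN1 : (x < N.-1)%N by nat_lia.
have [y yN1 xy] := next_break bx bN xN1.
have [xlty _ by_ nb] := xy.
have yN : (y < N)%N by nat_lia.
have [Hyx|yxH] := leqP H (y - x).
  have [inn bym] := long N sig a aP brk b x y m bV orth xy yN Hyx bm.
  have [yi|iy] := leqP y i.
    by apply: (step y) => //; rewrite ?xlty // (nbreaks_next xy).
  apply: near; first by rewrite nbreaks_gap // => k kI; apply: nb; nat_lia.
  by apply: le_trans Km; apply: inn; nat_lia.
have [all2 far] := short N sig a aP brk b x y m bV orth xy yN (ltnW yxH) bm.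
have [nL|nL] := leqP (nbreaks brk x i) L.+1.
  by apply: near => //; apply: all2; rewrite xi.
(* The least index that is more than [L] breaks away from [x] is itself a break, and exactly [L.+1]
   breaks away. *)
have exz : exists z, (L < nbreaks brk x z)%N by exists i; nat_lia.
have [z zL zmin] := ex_minnP exz.
have zi : (z <= i)%N by apply: zmin; nat_lia.
have xz : (x < z)%N.
  by rewrite ltnNge; apply/negP => zx; move: zL; rewrite /nbreaks big_geq.
case: z => [//|z] in zL zmin zi xz *.
have nz : (nbreaks brk x z <= L)%N.
  by rewrite leqNgt; apply/negP => /zmin; rewrite ltnn.
have nzS : nbreaks brk x z.+1 = (nbreaks brk x z + brk z.+1)%N.
  by rewrite -(@nbreaks_cat brk x z z.+1) ?leqnSn ?andbT // [nbreaks _ z _]/nbreaks big_nat1.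
have bz : brk z.+1 by move: zL; rewrite nzS; case: (brk z.+1) => //; nat_lia.
apply: (step z.+1) => //; first by rewrite xz.
  by rewrite nzS bz; nat_lia.
have xzN : (x <= z.+1 < N)%N by nat_lia.
exact: (far _ xzN (ltnW zL)).
Qed.

(** When [i] grows by 1, the sum is unchanged unless a break is reached; then it is multiplied by
    [rho] and increased by 1. The bound 1 / (1 - rho) is stable under both, whatever the gaps. *)
Lemma sum_geometric (rho : R) brk i : 0 < rho -> rho < 1 ->
  (1 - rho) * \sum_(x < i.+1 | brk x) rho ^+ nbreaks brk x i <= 1.
Proof.
move=> r0 r1; elim: i => [|i IH].
  rewrite big_mkcond big_ord1 /=; case: ifP => _; last by rewrite mulr0.
  by rewrite /nbreaks big_geq // expr0; lra.
rewrite big_mkcond big_ord_recr /= -big_mkcond /=.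
rewrite [nbreaks brk i.+1 i.+1]/nbreaks big_geq // expr0.
have E (x : 'I_i.+1) : nbreaks brk x i.+1 = (nbreaks brk x i + brk i.+1)%N.
  have xi : (x <= i <= i.+1)%N by rewrite leqnSn andbT -ltnS.
  rewrite -(nbreaks_cat brk xi).
  by rewrite [nbreaks _ i _]/nbreaks big_nat1.
under eq_bigr do rewrite E exprD.
rewrite -mulr_suml; case: (brk i.+1) => /=; last by rewrite expr0 mulr1 addr0.
by rewrite expr1; have := ler_wpM2l (ltW r0) IH; lra.
Qed.

(** The hypotheses on the form, the function space and the Galerkin equations are all invariant
    under this reflection, which turns decay to the right into decay to the left. *)
Definition reversal (T : Type) (N : nat) (f : nat -> T) (i : nat) := f (N - i.+1)%N.

Lemma reversalK (T : Type) N (f : nat -> T) i : (i < N)%N ->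
  reversal N (reversal N f) i = f i.
Proof. by move=> iN; rewrite /reversal; congr f; nat_lia. Qed.

Lemma sum_reversal N (f : nat -> R) : \sum_(i < N) reversal N f i = \sum_(i < N) f i.
Proof. by rewrite [RHS](reindex_inj rev_ord_inj). Qed.

Lemma form_reversal N a f g :
  form N (reversal N (fun i => reversal N (a i))) f g =
  form N a (reversal N f) (reversal N g).
Proof.
rewrite /form (reindex_inj rev_ord_inj) /=; apply: eq_bigr => i _.
rewrite (reindex_inj rev_ord_inj) /=; apply: eq_bigr => j _.
rewrite /reversal.
have -> : (N - (N - i.+1).+1)%N = i by have := ltn_ord i; nat_lia.
by have -> : (N - (N - j.+1).+1)%N = j by have := ltn_ord j; nat_lia.
Qed.

Lemma banded_form_reversal p N (lam C sig : R) a : banded_form p N lam C sig a ->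
  banded_form p N lam C sig (reversal N (fun i => reversal N (a i))).
Proof.
move=> aP; have [lam0 sig_lam lamC band bound coer aff] := aP.
split=> //.
- by move=> i j iN jN h; rewrite /reversal band //; nat_lia.
- by move=> i j iN jN; rewrite /reversal bound //; nat_lia.
- move=> f; rewrite form_reversal; apply: le_trans (coer _).
  by rewrite -(sum_reversal N (fun i => f i ^+ 2)).
move=> i c d pi iN; rewrite (reindex_inj rev_ord_inj) /=.
have := aff (N - i.+1)%N (c + d * N.-1%:R) (- d).
rewrite (_ : (N - i.+1)%:R = N.-1%:R - i%:R :> R); last first.
  by rewrite -natrB; [congr _%:R|]; nat_lia.
move=> h; transitivity (sig * (c + d * N.-1%:R + - d * (N.-1%:R - i%:R))).
  rewrite -h; [|by nat_lia|by nat_lia].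
  apply: eq_bigr => j _; rewrite /reversal.
  have jN := ltn_ord j.
  have -> : (N - (N - j.+1).+1)%N = j by nat_lia.
  have -> : (N - j.+1)%:R = N.-1%:R - j%:R :> R.
    by rewrite -natrB; [congr _%:R|]; nat_lia.
  by congr (_ * _); ring.
by congr (_ * _); ring.
Qed.

Lemma pwlin_reversal N brk f : pwlin N brk f -> pwlin N (reversal N brk) (reversal N f).
Proof.
move=> fV i iN; rewrite /reversal => nb.
have := fV (N - i.+3)%N.
rewrite (_ : (N - i.+3).+2 = N - i.+1)%N; last by nat_lia.
rewrite (_ : (N - i.+3).+1 = N - i.+2)%N; last by nat_lia.
by move=> <- //; [exact: addrC|nat_lia].
Qed.

Definition solves N (a : nat -> nat -> R) brk u b := pwlin N brk b /\
  forall v, pwlin N brk v -> form N a v b = \sum_(i < N) u i * v i.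

Lemma solves_reversal N a brk u b : solves N a brk u b ->
  solves N (reversal N (fun i => reversal N (a i))) (reversal N brk)
    (reversal N u) (reversal N b).
Proof.
move=> [bV bs]; split; first exact: pwlin_reversal.
move=> v vV; rewrite form_reversal.
rewrite (@eq_form _ _ _ _ (reversal N v) _ b) //; last first.
  by move=> i iN; rewrite reversalK.
rewrite bs; last first.
  move=> i iN nb; have := pwlin_reversal vV iN.
  by rewrite /reversal; apply; rewrite (_ : N - (N - i.+2).+1 = i.+1)%N //; nat_lia.
rewrite -(sum_reversal N (fun i => u i * reversal N v i)); apply: eq_bigr => i _.
by congr (_ * _); exact: (reversalK v (ltn_ord i)).
Qed.

Lemma energy p N (lam C sig : R) a brk u b : banded_form p N lam C sig a ->
  solves N a brk u b -> \sum_(i < N) b i ^+ 2 <= 4 / lam ^+ 2 * \sum_(i < N) u i ^+ 2.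
Proof.
move=> aP [bV bs]; have lam0 := bf_lam aP.
have l2 : 0 < lam / 2 by lra.
have h1 := bf_coercive aP b; rewrite bs // in h1.
have h2 : \sum_(i < N) u i * b i <=
    (lam / 2)^-1 * \sum_(i < N) u i ^+ 2 + lam / 2 * \sum_(i < N) b i ^+ 2.
  rewrite !mulr_sumr -big_split; apply: ler_sum => i _ /=.
  rewrite [u i * b i]mulrC addrC.
  exact: le_trans (ler_norm _) (mul_le_young (b i) (u i) l2).
rewrite -(ler_pM2l l2).
rewrite (_ : lam / 2 * (4 / lam ^+ 2 * _) = (lam / 2)^-1 * \sum_(i < N) u i ^+ 2).
  by lra.
by field; lra.
Qed.

Lemma energy_bound p N (lam C sig M : R) a brk u b x y : banded_form p N lam C sig a ->
  solves N a brk u b -> 0 <= M ->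
  (forall i, (x <= i < y)%N -> `|u i| <= M) ->
  (forall i, ~~ (x <= i < y)%N -> u i = 0) ->
  \sum_(i < N) b i ^+ 2 <= (y - x)%:R * (2 / lam * M) ^+ 2.
Proof.
move=> aP bs M0 uM u0; apply: le_trans (energy aP bs) _.
have lam0 := bf_lam aP.
rewrite (_ : _ * (2 / lam * M) ^+ 2 = 4 / lam ^+ 2 * ((y - x)%:R * M ^+ 2)); last by field; lra.
apply: ler_wpM2l; first by rewrite divr_ge0 // sqr_ge0.
rewrite (bigID (fun i : 'I_N => (x <= i < y)%N)) /= [X in _ + X]big1 ?addr0.
  apply: (@sum_itv_le R N x y (fun i => u i ^+ 2) _ (sqr_ge0 M)) => i iI.
  rewrite -[leLHS]real_normK ?num_real // ler_pXn2r ?nnegrE //; exact: uM.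
by move=> i iI; rewrite u0 // expr0n.
Qed.

Lemma sqr_le_sum N b i : (i < N)%N -> b i ^+ 2 <= \sum_(i < N) b i ^+ 2.
Proof.
move=> iN; rewrite (bigD1 (Ordinal iN)) //= lerDl.
by apply: sumr_ge0 => j _; exact: sqr_ge0.
Qed.

(* If the data live on a single gap, the energy bounds the solution on that gap;
   this extends to a neighbourhood of size p because only a gap shorter than p
   lets it reach further. *)
Lemma local_bound p N (lam C sig M : R) a brk u b x y : banded_form p N lam C sig a ->
  solves N a brk u b -> consecutive brk x y -> (y < N)%N -> 0 <= M ->
  (forall i, (x <= i < y)%N -> `|u i| <= M) ->
  (forall i, ~~ (x <= i < y)%N -> u i = 0) ->
  forall i, (i < N)%N -> (y - p <= i <= x + p)%N || (x <= i <= y)%N ->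
  `|b i| <= (2 * p + 4)%N%:R / lam * M.
Proof.
move=> aP bs xy yN M0 uM u0 i iN iI; have [xlty bx by_ nb] := xy.
have lam0 := bf_lam aP; have [bV _] := bs.
have EB := energy_bound aP bs M0 uM u0.
have c0 : 0 <= 2 / lam * M by rewrite mulr_ge0 // divr_ge0 // ltW.
have h0 : 0 < (y - x)%:R :> R by rewrite ltr0n; nat_lia.
have S0 : 0 <= \sum_(j < N) b j ^+ 2 by apply: sumr_ge0 => j _; exact: sqr_ge0.
have sub (P : pred nat) : \sum_(j < N | P j) b j ^+ 2 <= \sum_(j < N) b j ^+ 2.
  by rewrite big_mkcond; apply: ler_sum => j _; case: ifP => // _; exact: sqr_ge0.
(* The energy carries a factor [y - x] by [EB], and so does the square of an end value; cancelling
   it makes the bound independent of the gap length. *)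
have ends z : (y - x)%:R * b z ^+ 2 <= 4 * \sum_(j < N) b j ^+ 2 ->
    `|b z| <= 2 * (2 / lam * M).
  move=> h; apply: sqr_le_norm; first by rewrite mulr_ge0.
  rewrite -(ler_pM2l h0); apply: le_trans h _; rewrite [leRHS]mulrC exprMn; lra.
have wk : 2 * (2 / lam * M) <= (2 * p + 4)%N%:R / lam * M.
  rewrite !mulrA; apply: ler_wpM2r => //; apply: ler_wpM2r.
    by rewrite invr_ge0 ltW.
  by rewrite -natrM ler_nat leq_addl.
have [iin|iout] := boolP (x <= i <= y)%N.
  apply: le_trans wk; apply: (interp_norm_le bV xy yN) => //; apply: ends.
    by apply: le_trans (pwlin_left_le bV xy yN) _; have := sub (fun i => x <= i < y)%N; lra.
  by apply: le_trans (pwlin_right_le bV xy yN) _; have := sub (fun i => x <= i <= y)%N; lra.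
have yxp : (y - x <= p)%N by move: iI iout xlty; clear; lia.
apply: (@le_trans _ _ (p.+1%:R * (2 / lam * M))).
  apply: sqr_le_norm; first by rewrite mulr_ge0.
  apply: le_trans (sqr_le_sum b iN) _; apply: le_trans EB _.
  rewrite [leRHS]exprMn; apply: ler_wpM2r; first exact: sqr_ge0.
  by rewrite -natrX ler_nat; move: yxp; clear; nia.
rewrite (_ : _ * (2 / lam * M) = (2 * p.+1)%N%:R / lam * M); last first.
  by rewrite natrM; ring.
apply: ler_wpM2r => //; apply: ler_wpM2r; first by rewrite invr_ge0 ltW.
by rewrite ler_nat; clear; lia.
Qed.

End SupBound.

(** * The bound for general data *)

Section Localization.
Variable R : realType.
Implicit Types (f g u v b : nat -> R) (brk : pred nat).

Lemma solves_sub N a brk u1 u2 b1 b2 : solves N a brk u1 b1 -> solves N a brk u2 b2 ->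
  solves N a brk (fun i => u1 i - u2 i) (fun i => b1 i - b2 i).
Proof.
move=> [V1 s1] [V2 s2]; split.
  by move=> i iN nb; have := V1 i iN nb; have := V2 i iN nb; lra.
move=> v vV; rewrite formBr s1 // s2 // -sumrB; apply: eq_bigr => i _; ring.
Qed.

Lemma solves_sum N a brk (P : pred nat) (U B : nat -> nat -> R) n :
  (forall x, (x < n)%N -> P x -> solves N a brk (U x) (B x)) ->
  solves N a brk (fun i => \sum_(x < n | P x) U x i) (fun i => \sum_(x < n | P x) B x i).
Proof.
move=> s; split.
  move=> i iN nb; rewrite -big_split mulr_sumr; apply: eq_bigr => x Px /=.
  exact: (proj1 (s x (ltn_ord x) Px)).
move=> v vV; transitivity (\sum_(x < n | P x) form N a v (B x)).
  rewrite /form [RHS]exchange_big; apply: eq_bigr => i _ /=.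
  rewrite [RHS]exchange_big; apply: eq_bigr => j _ /=.
  by rewrite mulr_sumr.
rewrite (eq_bigr (fun x : 'I_n => \sum_(i < N) U x i * v i)); last first.
  by move=> x Px; exact: (proj2 (s x (ltn_ord x) Px)).
by rewrite exchange_big; apply: eq_bigr => i _ /=; rewrite mulr_suml.
Qed.

Lemma solves_unique p N (lam C sig : R) a brk u1 u2 b1 b2 :
  banded_form p N lam C sig a -> (forall i, (i < N)%N -> u1 i = u2 i) ->
  solves N a brk u1 b1 -> solves N a brk u2 b2 ->
  forall i, (i < N)%N -> b1 i = b2 i.
Proof.
move=> aP u12 s1 s2 i iN; have := energy aP (solves_sub s1 s2).
rewrite [X in _ <= _ * X]big1 ?mulr0; last first.
  by move=> j _; rewrite u12 // subrr expr0n.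
move=> h; have := le_trans (sqr_le_sum (fun i => b1 i - b2 i) iN) h.
rewrite /= => h2; apply/eqP; rewrite -subr_eq0 -sqrf_eq0.
by rewrite eq_le h2 sqr_ge0.
Qed.

Lemma solves_orth_right N a brk u b x y : solves N a brk u b ->
  (forall i, ~~ (x <= i < y)%N -> u i = 0) -> orth_right N a brk b y.
Proof.
move=> [_ bs] u0 v vV v0; rewrite bs // big1 // => i _.
have [iy|yi] := leqP i y; first by rewrite v0 // mulr0.
by rewrite u0 ?mul0r //; move: yi; clear; lia.
Qed.

Lemma sum_geometric_all (rho : R) brk N i : 0 < rho -> rho < 1 -> (i < N)%N ->
  \sum_(x < N | brk x && (x <= i)%N) rho ^+ nbreaks brk x i <= (1 - rho)^-1.
Proof.
move=> r0 r1 iN; rewrite -[leRHS]mul1r ler_pdivlMr; last by rewrite subr_gt0.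
rewrite mulrC; apply: le_trans (sum_geometric brk i r0 r1).
apply: ler_wpM2l; first by rewrite subr_ge0 ltW.
by rewrite (big_ord_widen_cond N brk (fun x => rho ^+ nbreaks brk x i)).
Qed.

(** Solvability for all data is assumed because the proof solves for each piece of [u] separately
    and recovers [b] as the sum by uniqueness. *)
Lemma sup_bound p (lam C : R) : 0 < lam -> lam <= C ->
  exists2 c : R, 0 < c &
  forall N sig a, banded_form p N lam C sig a ->
  forall brk, brk 0%N -> brk N.-1 -> (forall u, exists b, solves N a brk u b) ->
  forall u b (M : R), solves N a brk u b -> (forall i, (i < N)%N -> `|u i| <= M) ->
  forall i, (i < N)%N -> `|b i| <= c * M.
Proof.
move=> lam0 lamC; have [K [rho [K1 rho0 rho1 dec]]] := decay_right p lam0 lamC.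
pose A := (2 * p + 4)%N%:R / lam; have A0 : 0 < A by rewrite divr_gt0 // ltr0n addn4.
have rho10 : 0 < 1 - rho by lra.
(* To the right, the decay of a piece starts only at the break that ends its gap; the division by
   [rho] restores this one break. *)
pose K2 := K * A / rho.
have K20 : 0 < K2 by rewrite divr_gt0 // mulr_gt0 //; lra.
exists (2 * (K2 / (1 - rho))); first by rewrite mulr_gt0 // divr_gt0.
move=> N sig a aP brk b0 bN ex u b M bs uM i0 i0N.
have M0 : 0 <= M by apply: le_trans (uM i0 i0N).
(* For a break [x], the restriction of [u] to the indices from [x] up to the next break, which is
   excluded; for [x = N.-1], to this single index. *)
pose piece x i := if (x <= i)%N && (nbreaks brk x i == 0%N) && (i < N)%N then u i else 0.
have [B Bs] := choice (fun x => ex (piece x)).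
have pieceM x i : `|piece x i| <= M.
  by rewrite /piece; case: ifP => [/andP[_ iN]|_]; rewrite ?normr0 // uM.
have piece0 x y i : consecutive brk x y \/ (x = N.-1 /\ y = N) ->
    ~~ (x <= i < y)%N -> piece x i = 0.
  move=> xy iI; rewrite /piece; case: ifP => // /andP[/andP[xi /eqP nb] iN].
  case: xy => [xy|[_ yN]]; last by move: iI; rewrite yN xi iN.
  have [xlty _ _ _] := xy; have xyi : (x <= y <= i)%N by move: iI xi xlty; clear; lia.
  by move: nb; rewrite -(nbreaks_cat brk xyi) (nbreaks_next xy).
have bsum i : (i < N)%N -> b i = \sum_(x < N | brk x) B x i.
  apply: (solves_unique aP _ bs (@solves_sum N a brk brk piece B N _)) => [|x _ _ //].
  move=> {}i iN; have [w [/andP[_ wi] bw nw]] := last_break b0 (leq0n i).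
  have wN : (w < N)%N by exact: leq_ltn_trans iN.
  rewrite (bigD1 (Ordinal wN)) //= big1 => [|x /andP[bx xw]].
    by rewrite addr0 /piece wi iN nbreaks_gap // eqxx.
  rewrite /piece; case: ifP => // /andP[/andP[xi /eqP nb] _].
  have [xltw|wltx|xwE] := ltngtP x w.
  - have [v xv vw] := prev_break bx bw xltw.
    have [vltw _ _ _] := vw.
    have e1 : (x <= w <= i)%N by rewrite (ltnW xltw).
    have e2 : (x <= v <= w)%N by rewrite xv ltnW.
    by move: nb; rewrite -(nbreaks_cat brk e1) -(nbreaks_cat brk e2) (nbreaks_next vw); clear; lia.
  - by have := nw x; rewrite bx wltx xi => /(_ isT).
  - by move: xw; rewrite -(inj_eq val_inj) /= xwE eqxx.
have KA0 : 0 <= K * A by rewrite mulr_ge0 ?(ltW A0) //; lra.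
have KA : K * A <= K2 by rewrite /K2 ler_pdivlMr // ler_piMr // ltW.
have AK : A <= K2 by apply: le_trans KA; rewrite ler_peMl // ltW.
have AM0 : 0 <= A * M by rewrite mulr_ge0 // ltW.
have pw1 k : rho ^+ k <= 1 by rewrite exprn_ile1 // ltW.
have local_ x y : (x < N)%N -> consecutive brk x y -> (y < N)%N -> forall i, (i < N)%N ->
    (y - p <= i <= x + p)%N || (x <= i <= y)%N -> `|B x i| <= A * M.
  move=> xN xy yN i iN iI; apply: (local_bound aP (Bs x) xy yN M0 _ _ iN iI).
    by move=> j _; exact: pieceM.
  by move=> j; apply: piece0; left.
have lastp i : (i < N)%N -> `|B N.-1 i| <= A * M.
  move=> iN.
  have u0 j : ~~ (N.-1 <= j < N)%N -> piece N.-1 j = 0 by apply: piece0; right.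
  have pM j : (N.-1 <= j < N)%N -> `|piece N.-1 j| <= M by move=> _; exact: pieceM.
  have := energy_bound aP (Bs N.-1) M0 pM u0.
  rewrite (_ : N - N.-1 = 1)%N; last by move: iN; clear; lia.
  rewrite mul1r => h; apply: (@le_trans _ _ (2 / lam * M)).
    apply: sqr_le_norm; first by rewrite mulr_ge0 // divr_ge0 // ltW.
    exact: le_trans (sqr_le_sum (B N.-1) iN) h.
  apply: ler_wpM2r => //; apply: ler_wpM2r; first by rewrite invr_ge0 ltW.
  by rewrite ler_nat; clear; lia.
have nxt x : (x < N)%N -> brk x -> x = N.-1 \/
    exists2 y, (y < N)%N & consecutive brk x y.
  move=> xN bx; have [xE|xE] := eqVneq x N.-1; [by left|right].
  have xN1 : (x < N.-1)%N by move: xE xN; clear; lia.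
  have [y yN1 xy] := next_break bx bN xN1; exists y => //.
  by move: yN1 xN; clear; lia.
have rightp x i : (x < N)%N -> brk x -> (x <= i < N)%N ->
    `|B x i| <= K2 * rho ^+ nbreaks brk x i * M.
  move=> xN bx /andP[xi iN].
  have near : nbreaks brk x i = 0%N -> `|B x i| <= A * M ->
      `|B x i| <= K2 * rho ^+ nbreaks brk x i * M.
    by move=> -> h; rewrite expr0 mulr1; apply: le_trans h _; apply: ler_wpM2r.
  have [xE|[y yN xy]] := nxt x xN bx.
    have iE : i = x by move: xi iN xE; clear; lia.
    apply: near; last by rewrite xE; exact: lastp.
    by rewrite iE nbreaks_gap //; move=> k; clear; lia.
  have [xlty _ by_ nb] := xy.
  have [yi|iy] := leqP y i; last first.
    apply: near.
      by rewrite nbreaks_gap // => k kI; apply: nb; move: kI iy; clear; lia.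
    by apply: (local_ x y) => //; rewrite xi (ltnW iy) orbT.
  have ortho := solves_orth_right (Bs x) (fun j => piece0 x y j (or_introl xy)).
  have bm j : (y - p <= j <= y)%N -> `|B x j| <= A * M.
    move=> jI; apply: (local_ x y) => //.
      by move: jI yN; clear; lia.
    have := jI; move: xlty; clear; lia.
  have yiN : (y <= i < N)%N by rewrite yi.
  have := dec N sig a aP brk (B x) y (A * M) bN by_ yN (proj1 (Bs x)) ortho bm i yiN.
  move=> h; apply: le_trans h _.
  have xyi : (x <= y <= i)%N by rewrite (ltnW xlty).
  rewrite -(nbreaks_cat brk xyi) (nbreaks_next xy) exprS /K2.
  rewrite le_eqVlt; apply/orP; left; apply/eqP; field; exact: lt0r_neq0.
pose brk' := reversal N brk.
(* In the reversed problem the data of [piece x] end at the image of [x], itself a break, so the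
   decay starts there and no break is lost. *)
have leftp x i : (x < N)%N -> brk x -> (i <= x)%N ->
    `|B x i| <= K2 * rho ^+ nbreaks brk' (N - x.+1) (N - i.+1) * M.
  move=> xN bx ix.
  have aP' := banded_form_reversal aP.
  have iN : (i < N)%N by exact: leq_ltn_trans xN.
  have [xE|xE] := eqVneq x i.
    have [xE'|[y yN xy]] := nxt x xN bx.
      rewrite -xE /nbreaks big_geq // expr0 mulr1; apply: le_trans (ler_wpM2r M0 AK).
      by rewrite xE'; apply: lastp; rewrite -xE'.
    have [xlty _ _ _] := xy.
    rewrite -xE /nbreaks big_geq // expr0 mulr1; apply: le_trans (ler_wpM2r M0 AK).
    by apply: (local_ x y) => //; rewrite leqnn (ltnW xlty) orbT.
  have [Vs' ss'] := solves_reversal (Bs x).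
  have ortho : orth_right N (reversal N (fun i => reversal N (a i))) brk'
      (reversal N (B x)) (N - x.+1).
    move=> v vV v0; rewrite ss' // big1 // => j _.
    have [jx|xj] := leqP j (N - x.+1); first by rewrite v0 // mulr0.
    rewrite /reversal /piece ifN ?mul0r //.
    by rewrite -!andbA negb_and -ltnNge; apply/orP; left; move: xj (ltn_ord j) xN; clear; lia.
  have bm j : (N - x.+1 - p <= j <= N - x.+1)%N -> `|reversal N (B x) j| <= A * M.
    move=> jI; rewrite /reversal.
    have jN : (N - j.+1 < N)%N by move: jI xN; clear; lia.
    have [xE'|[y yN xy]] := nxt x xN bx; first by rewrite xE'; exact: lastp.
    have [xlty _ _ _] := xy.
    apply: (local_ x y) => //.
    by move: jI xlty yN; clear; lia.
  have bx' : brk' (N - x.+1)%N.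
    by rewrite /brk' /reversal (_ : N - (N - x.+1).+1 = x)%N //; move: xN; clear; lia.
  have bN' : brk' N.-1.
    by rewrite /brk' /reversal (_ : N - N.-1.+1 = 0)%N //; move: xN; clear; lia.
  have xN' : (N - x.+1 < N)%N by move: xN; clear; lia.
  have iI' : (N - x.+1 <= N - i.+1 < N)%N by move: ix xN; clear; lia.
  have := dec N sig _ aP' brk' _ _ (A * M) bN' bx' xN' Vs' ortho bm _ iI'.
  rewrite (reversalK (B x) iN : reversal N (B x) (N - i.+1) = _).
  move=> h; apply: le_trans h _.
  rewrite mulrA; apply: ler_wpM2r => //; rewrite mulrAC; apply: ler_wpM2r => //.
  by rewrite exprn_ge0 // ltW.
rewrite bsum // (bigID (fun x : 'I_N => (x <= i0)%N)) /=.
apply: le_trans (ler_normD _ _) _.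
have -> : 2 * (K2 / (1 - rho)) * M = K2 * M * (1 - rho)^-1 + K2 * M * (1 - rho)^-1.
  by ring.
have K2M : 0 <= K2 * M by rewrite mulr_ge0 // ltW.
apply: lerD.
  apply: le_trans (ler_norm_sum _ _ _) _.
  apply: le_trans (ler_wpM2l K2M (sum_geometric_all brk rho0 rho1 i0N)).
  rewrite mulr_sumr; apply: ler_sum => x /andP[bx xi].
  rewrite mulrAC; apply: rightp => //; rewrite xi //.
apply: le_trans (ler_norm_sum _ _ _) _.
have i0N' : (N - i0.+1 < N)%N by move: i0N; clear; lia.
apply: le_trans (ler_wpM2l K2M (sum_geometric_all brk' rho0 rho1 i0N')).
rewrite [leRHS]mulr_sumr [leRHS](reindex_inj rev_ord_inj) /=.
rewrite big_mkcond [leRHS]big_mkcond; apply: ler_sum => x _.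
case: ifPn => [/andP[bx xi]|_]; last first.
  by case: ifP => // _; rewrite mulr_ge0 // exprn_ge0 // ltW.
have xN := ltn_ord x.
rewrite ifT; last first.
  rewrite /brk' /reversal (_ : N - (N - x.+1).+1 = x)%N; last by move: xN; clear; lia.
  by rewrite bx /=; move: xi xN; clear; lia.
by rewrite mulrAC; apply: leftp => //; move: xi; clear; lia.
Qed.

End Localization.

(** * B-splines on a knot interval *)

Section CardinalSpline.
Variable R : realType.

(* The polynomial that represents a B-spline of degree q on a knot interval, in
   the rescaled variable of this interval; l is the difference of the index of
   the B-spline and the index of the interval. *)
Fixpoint cspl (q : nat) (l : int) : {poly R} :=
  if q is q'.+1 then
    q%:R^-1 *: (('X + (q%:R - l%:~R)%:P) * cspl q' (l - 1)
                + ((l%:~R + 1)%:P - 'X) * cspl q' l)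
  else (l == 0)%:R%:P.

(** Equally spaced knots make both denominators of the recursion equal to the degree divided by [K].
    The range [0 < t <= 1] matches the half-open intervals of degree 0. *)
Lemma bspline_cspl (K q : nat) (k j : int) (t : R) : (0 < K)%N -> 0 < t <= 1 ->
  bspline K q k (((j - 1)%:~R + t) / K%:R) = (cspl q (k - j)).[t].
Proof.
move=> K0 /andP[t0 t1]; have K0' : 0 < K%:R :> R by rewrite ltr0n.
have Kn : K%:R != 0 :> R by rewrite gt_eqF.
elim: q k => [|q IH] k.
  rewrite /= hornerC /knot ltr_pM2r ?invr_gt0 // ler_pM2r ?invr_gt0 //.
  have [->|kj] := eqVneq k j.
    rewrite subrr eqxx ifT //; apply/andP; split; first by lra.
    by rewrite rmorphB /=; lra.
  rewrite subr_eq0 (negbTE kj) ifN //.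
  apply/negP => /andP[h1 h2].
  have h3 : (k - 1)%:~R < j%:~R :> R by apply: lt_le_trans h1 _; rewrite rmorphB /=; lra.
  have h4 : (j - 1)%:~R < k%:~R :> R by apply: lt_le_trans h2; lra.
  by move: h3 h4 kj; rewrite !ltr_int; clear; lia.
rewrite [LHS]/= (IH (k - 1)) (IH k) [RHS]/=.
rewrite hornerZ hornerD !hornerM hornerD hornerX hornerC hornerD hornerN hornerC hornerX.
rewrite (_ : k - 1 - j = k - j - 1); last by ring.
have q0 : q.+1%:R != 0 :> R by rewrite pnatr_eq0.
have QE : (q.+1%:Z)%:~R = q.+1%:R :> R by [].
have e1 : knot R K (k - 1) - knot R K (k - q.+1%:Z - 1) = q.+1%:R / K%:R.
  by rewrite /knot -mulrBl !rmorphB /= QE; congr (_ / _); ring.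
have e2 : knot R K k - knot R K (k - q.+1%:Z) = q.+1%:R / K%:R.
  by rewrite /knot -mulrBl !rmorphB /= QE; congr (_ / _); ring.
have e3 : ((j - 1)%:~R + t) / K%:R - knot R K (k - q.+1%:Z - 1) =
    (t + (q.+1%:R - (k - j)%:~R)) / K%:R.
  by rewrite /knot -mulrBl !rmorphB /= QE; congr (_ / _); ring.
have e4 : knot R K k - ((j - 1)%:~R + t) / K%:R = ((k - j)%:~R + 1 - t) / K%:R.
  by rewrite /knot -mulrBl !rmorphB /=; congr (_ / _); ring.
rewrite e1 e2 e3 e4; move: (q.+1%:R : R) q0 => Q q0.
by field; rewrite q0 Kn.
Qed.

Lemma cspl_eq0 (q : nat) (l : int) : (l < 0) || (q%:Z < l) -> cspl q l = 0.
Proof.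
elim: q l => [|q IH] l h /=.
  by rewrite (_ : l == 0 = false) ?polyC0 //; lia.
rewrite !IH ?mulr0 ?addr0 ?scaler0 //; lia.
Qed.

Lemma cspl_ge0 (q : nat) (l : int) (t : R) : 0 <= t <= 1 -> 0 <= (cspl q l).[t].
Proof.
move=> /andP[t0 t1]; elim: q l => [|q IH] l; first by rewrite /= hornerC ler0n.
have [h|h] := boolP ((l < 0) || (q.+1%:Z < l)); first by rewrite cspl_eq0 ?horner0.
rewrite [cspl _ _]/=.
rewrite hornerZ hornerD !hornerM hornerD hornerX hornerC hornerD hornerN hornerC hornerX.
have [l0 lq] : 0 <= l /\ l <= q.+1%:Z by move: h; clear; lia.
have l0' : 0 <= l%:~R :> R by rewrite ler0z.
have lq' : l%:~R <= q.+1%:R :> R by rewrite -[q.+1%:R]/(q.+1%:Z%:~R) ler_int.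
apply: mulr_ge0; first by rewrite invr_ge0.
by apply: addr_ge0; apply: mulr_ge0; rewrite ?IH //; lra.
Qed.

Lemma sum_cspl (q : nat) : \sum_(l < q.+1) cspl q l%:Z = 1.
Proof.
elim: q => [|q IH]; first by rewrite big_ord1 /= polyC1.
rewrite [LHS]/= -scaler_sumr big_split /=.
rewrite big_ord_recl [X in _ + X]big_ord_recr /=.
rewrite [cspl q (0 - 1)]cspl_eq0 // mulr0 add0r.
rewrite [cspl q q.+1]cspl_eq0 ?mulr0 ?addr0; last by lia.
rewrite -big_split /= (eq_bigr (fun l : 'I_q.+1 => q.+1%:R *: cspl q l)); last first.
  move=> l _; rewrite /bump /= add1n (_ : l.+1%:Z - 1 = l); last by lia.
  rewrite -mulrDl -mul_polyC; congr (_ * _).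
  rewrite addrC subrKA -polyCD; congr _%:P.
  by rewrite -[l.+1]addn1 PoszD rmorphD /=; ring.
by rewrite -scaler_sumr IH scalerA mulVf ?scale1r // pnatr_eq0.
Qed.

Lemma cspl_le1 (q : nat) (l : int) (t : R) : 0 <= t <= 1 -> (cspl q l).[t] <= 1.
Proof.
move=> t01; have [h|h] := boolP ((l < 0) || (q%:Z < l)).
  by rewrite cspl_eq0 ?horner0.
case: l h => // l h; have lq : (l < q.+1)%N by move: h; clear; lia.
have := congr1 (fun P => P.[t]) (sum_cspl q); rewrite /= hornerC horner_sum.
rewrite (bigD1 (Ordinal lq)) //= => <-; rewrite lerDl.
by apply: sumr_ge0 => i _; exact: cspl_ge0.
Qed.

Lemma size_cspl (q : nat) (l : int) : (size (cspl q l) <= q.+1)%N.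
Proof.
elim: q l => [|q IH] l; first by rewrite /= size_polyC leq_b1.
rewrite [cspl _ _]/=; apply: leq_trans (size_scale_leq _ _) _.
apply: leq_trans (size_polyD _ _) _; rewrite geq_max; apply/andP; split.
  apply: leq_trans (size_polyMleq _ _) _.
  by rewrite size_XaddC /=; exact: IH.
apply: leq_trans (size_polyMleq _ _) _.
rewrite -opprB size_polyN size_XsubC /=; exact: IH.
Qed.

(** The classical derivative formula, free of factors at unit knot spacing. In the induction, the
    terms that come from differentiating the splines recombine, by the recursion, to [q.+1] times
    the same difference. *)
Lemma deriv_cspl (q : nat) (l : int) :
  (cspl q.+1 l)^`() = cspl q (l - 1) - cspl q l.
Proof.
elim: q l => [|q IH] l.
  rewrite /= invr1 scale1r derivD !derivM derivD derivX derivC.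
  by rewrite derivB derivX !derivC !(mulr0, addr0, add0r, mul1r, mulN1r, sub0r, mulNr).
have q2 : q.+2%:R != 0 :> R by rewrite pnatr_eq0.
have q1 : q.+1%:R != 0 :> R by rewrite pnatr_eq0.
pose A := cspl q (l - 1 - 1); pose B := cspl q (l - 1); pose D := cspl q l.
pose L : R := l%:~R.
have e1 : q.+1%:R *: cspl q.+1 (l - 1) =
    ('X + (q.+1%:R - (L - 1))%:P) * A + ((L - 1 + 1)%:P - 'X) * B.
  by rewrite [cspl q.+1 _]/= scalerA divff // scale1r !rmorphB.
have e2 : q.+1%:R *: cspl q.+1 l =
    ('X + (q.+1%:R - L)%:P) * B + ((L + 1)%:P - 'X) * D.
  by rewrite [cspl q.+1 l]/= scalerA divff // scale1r.
have step : (cspl q.+2 l)^`() = q.+2%:R^-1 *: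
    ((cspl q.+1 (l - 1) - cspl q.+1 l) +
     (('X + (q.+2%:R - L)%:P) * (A - B) + ((L + 1)%:P - 'X) * (B - D))).
  rewrite [cspl q.+2 l]/= -/(cspl q.+1) derivZ derivD !derivM !IH derivD derivX derivC.
  rewrite derivB derivX derivC -/A -/B -/D -/L; congr (_ *: _).
  by rewrite addr0 mul1r sub0r mulN1r; ring.
apply: (scalerI q2); rewrite step scalerA divff // scale1r.
have -> : ('X + (q.+2%:R - L)%:P) * (A - B) + ((L + 1)%:P - 'X) * (B - D) =
    q.+1%:R *: cspl q.+1 (l - 1) - q.+1%:R *: cspl q.+1 l.
  rewrite e1 e2 -[q.+2]addn1 natrD !(polyCD, polyCB, polyCN) polyC1; ring.
rewrite -[q.+2]addn1 natrD scalerDl scale1r scalerBr; ring.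
Qed.

End CardinalSpline.

(** * Coefficients of a spline are controlled by its values *)

Section Stability.
Variable R : realType.

(* Induction on q: divide f - f.[t 0] by 'X - t 0. *)
Lemma coef_le_values (q : nat) (d : R) : 0 < d -> exists2 C : R, 0 < C &
  forall (f : {poly R}) (t : nat -> R) (e : R), (size f <= q.+1)%N ->
  (forall s, (s <= q)%N -> `|t s| <= 1) ->
  (forall s r, (s < r <= q)%N -> d <= t r - t s) ->
  (forall s, (s <= q)%N -> `|f.[t s]| <= e) -> forall i, `|f`_i| <= C * e.
Proof.
move=> d0; elim: q => [|q [C C0 IH]].
  exists 1 => // f t e sf _ _ fe i; rewrite mul1r.
  have e0 : 0 <= e by apply: le_trans (fe 0%N _).
  case: i => [|i]; last by rewrite nth_default ?normr0 //; exact: leq_trans sf _.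
  by have := fe 0%N (leqnn 0); rewrite (size1_polyC sf) hornerC coefC.
exists (1 + 2 * C * (2 / d)) => [|f t e sf t1 td fe i].
  have : 0 < C * (2 / d) by rewrite mulr_gt0 // divr_gt0.
  by lra.
have e0 : 0 <= e by apply: le_trans (fe 0%N _).
have rt : root (f - f.[t 0%N]%:P) (t 0%N) by rewrite rootE hornerD hornerN hornerC subrr.
have /factor_theorem[g fg] := rt.
have {}fg : f = f.[t 0%N]%:P + g * ('X - (t 0%N)%:P) by rewrite -fg addrC subrK.
have sg : (size g <= q.+1)%N.
  have [->|g0] := eqVneq g 0; first by rewrite size_poly0.
  have := size_Mmonic g0 (monicXsubC (t 0%N)); rewrite size_XsubC addn2 /= => sE.
  rewrite -ltnS -sE (_ : g * _ = f - f.[t 0%N]%:P); last first.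
    by apply/eqP; rewrite eq_sym subr_eq addrC -fg.
  apply: leq_trans (size_polyD _ _) _; rewrite geq_max sf size_polyN size_polyC.
  by case: (_ != 0).
have gv s : (s <= q)%N -> `|g.[t s.+1]| <= 2 / d * e.
  move=> sq; have ds : d <= t s.+1 - t 0%N by apply: td.
  have ts0 : 0 < t s.+1 - t 0%N by apply: lt_le_trans ds.
  have := congr1 (fun P => P.[t s.+1]) fg.
  rewrite /= hornerD hornerM hornerC hornerD hornerN hornerX hornerC => E.
  have {}E : g.[t s.+1] * (t s.+1 - t 0%N) = f.[t s.+1] - f.[t 0%N] by rewrite E; ring.
  have h1 : `|g.[t s.+1]| * (t s.+1 - t 0%N) <= e + e.
    rewrite -[X in _ * X](gtr0_norm ts0) -normrM E.
    by apply: le_trans (ler_normB _ _) _; apply: lerD; apply: fe.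
  have h2 : `|g.[t s.+1]| * d <= e + e by apply: le_trans h1; apply: ler_wpM2l.
  rewrite (_ : 2 / d * e = (e + e) / d); last by field; lra.
  by rewrite ler_pdivlMr.
have gb := IH g (fun s => t s.+1) (2 / d * e) sg (fun s sq => t1 s.+1 sq)
  (fun s r sr => td s.+1 r.+1 sr) gv.
rewrite fg coefD coefC mulrBr coefB coefMX coefMC.
have e2 : 0 <= 2 / d * e by rewrite mulr_ge0 // divr_ge0 // ltW.
apply: le_trans (ler_normD _ _) _.
have -> : (1 + 2 * C * (2 / d)) * e = e + (C * (2 / d * e) + C * (2 / d * e)) by ring.
apply: lerD; first by case: ifP => _; rewrite ?normr0 //; apply: fe.
apply: le_trans (ler_normB _ _) _; apply: lerD.
  by case: ifP => _; rewrite ?normr0 ?gb // mulr_ge0 // ltW.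
rewrite normrM -[leRHS]mulr1; apply: ler_pM => //; exact: t1.
Qed.

(** Induction through the derivative, whose spline coefficients are the differences [b l.+1 - b l]
    in one degree less; the value at 0 then fixes the remaining constant. *)
Lemma spline_coef_bound (q : nat) : exists2 C : R, 0 < C &
  forall (b : nat -> R) (e : R),
  (forall i, `|(\sum_(l < q.+1) b l *: cspl R q l)`_i| <= e) ->
  forall l, (l <= q)%N -> `|b l| <= C * e.
Proof.
elim: q => [|q [C C0 IH]].
  exists 1 => // b e be l; rewrite leqn0 => /eqP->.
  by have := be 0%N; rewrite big_ord1 /= coefZ coefC mulr1 mul1r.
exists (1 + 2 * q.+1%:R * (C * q.+1%:R)) => [|b e].
  by rewrite ltr_pwDl // !mulr_ge0 // ltW.
set f := \sum_(l < q.+2) _ => fe.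
have e0 : 0 <= e by apply: le_trans (fe 0%N).
have f' : f^`() = \sum_(l < q.+1) (b l.+1 - b l) *: cspl R q l.
  rewrite /f raddf_sum /=.
  rewrite (eq_bigr (fun l : 'I_q.+2 => b l *: cspl R q (l%:Z - 1) - b l *: cspl R q l)); last first.
    by move=> l _; rewrite derivZ deriv_cspl scalerBr.
  rewrite sumrB big_ord_recl [X in _ - X]big_ord_recr /=.
  rewrite [cspl _ _ (0 - 1)]cspl_eq0 // [cspl _ _ q.+1]cspl_eq0 ?scaler0 ?add0r ?addr0; last by lia.
  rewrite -sumrB; apply: eq_bigr => l _; rewrite /bump /= add1n scalerBl.
  by rewrite (_ : l.+1%:Z - 1 = l); last by lia.
have sf : (size f <= q.+2)%N.
  apply: leq_trans (size_sum _ _ _) _; apply/bigmax_leqP => l _.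
  by apply: leq_trans (size_scale_leq _ _) _; exact: size_cspl.
have fe' i : `|(\sum_(l < q.+1) (b l.+1 - b l) *: cspl R q l)`_i| <= q.+1%:R * e.
  rewrite -f' coef_deriv normrMn -[leLHS]mulr_natl.
  have [iq|qi] := leqP i q.
    by apply: ler_pM => //; rewrite ler_nat ltnS.
  by rewrite nth_default ?normr0 ?mulr0 ?mulr_ge0 //; exact: leq_trans sf _.
have db := IH (fun l => b l.+1 - b l) (q.+1%:R * e) fe'.
set D := C * (q.+1%:R * e) in db.
have D0 : 0 <= D by rewrite !mulr_ge0 // ltW.
have bl l : (l <= q.+1)%N -> `|b l - b 0%N| <= q.+1%:R * D.
  move=> lq; apply: (@le_trans _ _ (l%:R * D)); last first.
    by apply: ler_wpM2r => //; rewrite ler_nat.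
  elim: l lq => [|l IHl] lq; first by rewrite subrr normr0 mul0r.
  rewrite (_ : b l.+1 - b 0%N = (b l.+1 - b l) + (b l - b 0%N)); last by ring.
  apply: le_trans (ler_normD _ _) _; rewrite -natr1 mulrDl mul1r addrC.
  by apply: lerD; [exact: (IHl (ltnW lq))|exact: db].
have b0 : `|b 0%N| <= e + q.+1%:R * D.
  have E : b 0%N = f`_0 - \sum_(l < q.+2) (b l - b 0%N) * (cspl R q.+1 l).[0].
    transitivity (b 0%N * (\sum_(l < q.+2) cspl R q.+1 l).[0]).
      by rewrite sum_cspl hornerC mulr1.
    rewrite -horner_coef0 /f !horner_sum mulr_sumr -sumrB.
    by apply: eq_bigr => l _; rewrite (hornerZ (b l)); ring.
  rewrite E; apply: le_trans (ler_normB _ _) _; apply: lerD; first exact: fe.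
  apply: le_trans (ler_norm_sum _ _ _) _.
  rewrite (_ : q.+1%:R * D = q.+1%:R * D * (\sum_(l < q.+2) cspl R q.+1 l).[0]); last first.
    by rewrite sum_cspl hornerC mulr1.
  rewrite horner_sum mulr_sumr.
  apply: ler_sum => l _; rewrite normrM.
  have c0 : 0 <= (cspl R q.+1 l).[0] by apply: cspl_ge0; rewrite lexx ler01.
  by rewrite (ger0_norm c0); apply: ler_wpM2r => //; apply: bl; rewrite -ltnS.
move=> l lq; rewrite (_ : b l = (b l - b 0%N) + b 0%N); last by ring.
apply: le_trans (ler_normD _ _) _.
rewrite (_ : _ * e = q.+1%:R * D + (e + q.+1%:R * D)); last by rewrite /D; ring.
by apply: lerD => //; exact: bl.
Qed.

Lemma sum_ord_mul (K M : nat) (F : nat -> R) :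
  \sum_(i < K * M) F i = \sum_(j < K) \sum_(r < M) F (j * M + r)%N.
Proof.
elim: K => [|K IH]; first by rewrite !big_ord0.
rewrite big_ord_recr /= -IH mulSn addnC -!(big_mkord xpredT F).
rewrite (@big_cat_nat _ _ _ (K * M)) ?leq_addr //=; congr (_ + _).
rewrite -[X in \sum_(X <= _ < _) _]add0n big_addn addKn big_mkord.
by apply: eq_bigr => r _; rewrite addnC.
Qed.

Variable p : nat.

(** With n = K M, every knot interval contains [M] design points at the same relative positions. An
    entry of the design matrix thus depends only on the position [r] and on the difference [z] of
    the indices of spline and interval. *)
Definition weight (M r : nat) (z : int) : R := (cspl R p z).[r.+1%:R / M%:R].

Definition local_value (M : nat) (f : nat -> R) (j r : nat) : R :=
  \sum_(l < p.+1) weight M r l * f (j + l)%N.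

Definition sqform (K M : nat) (f : nat -> R) : R :=
  \sum_(j < K) \sum_(r < M) local_value M f j r ^+ 2.

Lemma node01 (M r : nat) : (r < M)%N -> 0 < r.+1%:R / M%:R :> R /\ r.+1%:R / M%:R <= 1 :> R.
Proof.
move=> rM; have M0 : 0 < M%:R :> R by rewrite ltr0n; exact: leq_ltn_trans rM.
by split; [rewrite divr_gt0|rewrite ler_pdivrMr // mul1r ler_nat].
Qed.

Lemma weight_ge0 M r z : (r < M)%N -> 0 <= weight M r z.
Proof. by move=> /node01[h1 h2]; apply: cspl_ge0; rewrite ltW. Qed.

Lemma weight_le1 M r z : (r < M)%N -> weight M r z <= 1.
Proof. by move=> /node01[h1 h2]; apply: cspl_le1; rewrite ltW. Qed.

Lemma weight_eq0 M r (z : int) : (z < 0) || (p%:Z < z) -> weight M r z = 0.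
Proof. by move=> h; rewrite /weight cspl_eq0 // horner0. Qed.

Lemma sum_weight M r : \sum_(l < p.+1) weight M r l = 1.
Proof. by rewrite /weight -horner_sum sum_cspl hornerC. Qed.

(* The nodes contain M %/ (p + 1) disjoint groups of p + 1 nodes that are
   separated by d, and each group determines the coefficients. *)
Lemma local_stability : exists2 c : R, 0 < c &
  forall (M : nat) (f : nat -> R), (p < M)%N ->
  c * M%:R * \sum_(l < p.+1) f l ^+ 2 <= \sum_(r < M) local_value M f 0 r ^+ 2.
Proof.
have [C1 C10 spl] := spline_coef_bound p.
(* A group consists of the nodes [s * m + r] with [s <= p] and [m = M %/ p.+1]. Its spacing [m / M]
   is at least [d], because [M <= 2 * p.+1 * m]. *)
pose d : R := (2 * p.+1%:R)^-1.
have d0 : 0 < d by rewrite invr_gt0 mulr_gt0.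
have [C2 C20 val] := coef_le_values p d0.
pose C := C1 * C2; have C0 : 0 < C by rewrite mulr_gt0.
pose c := (2 * p.+1%:R * (p.+1%:R * C ^+ 2))^-1.
have c0 : 0 < c by rewrite invr_gt0 !mulr_gt0 // exprn_gt0.
exists c => // M f pM; have M0 : 0 < M%:R :> R by rewrite ltr0n; exact: leq_ltn_trans pM.
pose g := \sum_(l < p.+1) f l *: cspl R p l.
pose m := (M %/ p.+1)%N.
have m1 : (0 < m)%N by rewrite divn_gt0.
have mM : (p.+1 * m <= M)%N by rewrite mulnC leq_divM.
have Mm : (M <= 2 * p.+1 * m)%N.
  by have := divn_eq M p.+1; have := ltn_pmod M (ltn0Sn p); rewrite -/m; move: m1; clear; nia.
have gE r : local_value M f 0 r = g.[r.+1%:R / M%:R].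
  rewrite /g horner_sum; apply: eq_bigr => l _.
  by rewrite add0n (hornerZ (f l)) mulrC.
have sg : (size g <= p.+1)%N.
  apply: leq_trans (size_sum _ _ _) _; apply/bigmax_leqP => l _.
  by apply: leq_trans (size_scale_leq _ _) _; exact: size_cspl.
have group r : (r < m)%N -> \sum_(l < p.+1) f l ^+ 2 <=
    p.+1%:R * C ^+ 2 * \sum_(s < p.+1) local_value M f 0 (s * m + r)%N ^+ 2.
  move=> rm; set S := \sum_(s < p.+1) local_value _ _ _ _ ^+ 2.
  have S0 : 0 <= S by apply: sumr_ge0 => s _; exact: sqr_ge0.
  have tM s : (s <= p)%N -> (s * m + r < M)%N.
    by move=> sp; apply: leq_trans mM; move: sp rm; clear; nia.
  have fl l : (l <= p)%N -> f l ^+ 2 <= C ^+ 2 * S.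
    move=> lp; rewrite -(sqr_sqrtr S0) -exprMn -[leLHS]real_normK ?num_real //.
    rewrite ler_pXn2r ?nnegrE ?mulr_ge0 ?sqrtr_ge0 ?(ltW C10) ?(ltW C20) //.
    rewrite /C -mulrA; apply: spl => // i.
    apply: (val g (fun s => (s * m + r).+1%:R / M%:R)) => //.
    - by move=> s sp; have [h1 h2] := node01 (tM s sp); rewrite ger0_norm // ltW.
    - move=> s s' /andP[ss' sp]; rewrite -mulrBl ler_pdivlMr // /d.
      rewrite mulrC ler_pdivrMr ?mulr_gt0 // -natrB; last by move: ss'; clear; nia.
      by rewrite -natrM -natrM ler_nat; move: Mm ss'; clear; nia.
    move=> s sp; rewrite -gE -ler_sqr ?nnegrE ?sqrtr_ge0 // sqr_sqrtr // real_normK ?num_real //.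
    have sp' : (s < p.+1)%N by [].
    rewrite /S (bigD1 (Ordinal sp')) //=; apply: ler_wpDr; last by [].
    by apply: sumr_ge0 => s' _; exact: sqr_ge0.
  apply: (@le_trans _ _ (\sum_(l < p.+1) C ^+ 2 * S)).
    by apply: ler_sum => l _; apply: fl; rewrite -ltnS.
  by rewrite sumr_const card_ord -mulrA mulr_natl.
have total : m%:R * \sum_(l < p.+1) f l ^+ 2 <=
    p.+1%:R * C ^+ 2 * \sum_(r < M) local_value M f 0 r ^+ 2.
  apply: (@le_trans _ _ (p.+1%:R * C ^+ 2 *
      \sum_(s < p.+1) \sum_(r < m) local_value M f 0 (s * m + r)%N ^+ 2)).
    rewrite exchange_big [leRHS]mulr_sumr /=.
    apply: (@le_trans _ _ (\sum_(r < m) \sum_(l < p.+1) f l ^+ 2)).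
      by rewrite sumr_const card_ord mulr_natl.
    by apply: ler_sum => r _; exact: group.
  apply: ler_wpM2l; first by rewrite mulr_ge0 // sqr_ge0.
  rewrite -(sum_ord_mul p.+1 m (fun k => local_value M f 0 k ^+ 2)).
  rewrite (big_ord_widen M (fun k => local_value M f 0 k ^+ 2) mM) [leLHS]big_mkcond.
  by apply: ler_sum => r _; case: ifP => // _; exact: sqr_ge0.
have F0 : 0 <= \sum_(l < p.+1) f l ^+ 2 by apply: sumr_ge0 => l _; exact: sqr_ge0.
have P0 : 0 < p.+1%:R * C ^+ 2 by rewrite mulr_gt0 // exprn_gt0.
rewrite -(ler_pM2l P0); apply: le_trans total.
rewrite mulrA; apply: ler_wpM2r => //.
have Mm' : M%:R <= 2 * p.+1%:R * m%:R :> R by rewrite -!natrM ler_nat.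
have -> : p.+1%:R * C ^+ 2 * (c * M%:R) = (2 * p.+1%:R)^-1 * M%:R.
  rewrite /c (invfM (2 * p.+1%:R)) [X in _ * (X * _)]mulrC -[X in _ * X]mulrA.
  by rewrite (mulrA (p.+1%:R * _)) divff ?mul1r // gt_eqF.
by rewrite mulrC ler_pdivrMr ?mulr_gt0 // mulrC.
Qed.

End Stability.

(** * The Gram matrix of the design *)

Section Gram.
Variable R : realType.

Lemma posdef_unit N (A : 'M[R]_N) : posdef A -> A \in unitmx.
Proof.
move=> [_ A0]; rewrite unitmxE unitfE; apply/negP => /det0P[v v0 vA].
have vT : v^T != 0 by rewrite -trmx0 (inj_eq trmx_inj).
by have := A0 _ vT; rewrite trmxK vA mul0mx mxE ltxx.
Qed.

Variable p : nat.
Local Notation wt := (weight R p).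

Definition gram (K M i k : nat) : R :=
  \sum_(j < K) \sum_(r < M) wt M r (i%:Z - j%:Z) * wt M r (k%:Z - j%:Z).

Lemma sum_weight_local (K M : nat) (f : nat -> R) (j r : nat) : (j < K)%N ->
  \sum_(i < K + p) wt M r (i%:Z - j%:Z) * f i = local_value p M f j r.
Proof.
move=> jK; rewrite (bigID (fun i : 'I_(K + p) => (j <= i < j + p.+1)%N)) /=.
rewrite [X in _ + X]big1 => [|i iI]; last by rewrite weight_eq0 ?mul0r //; lia.
rewrite addr0 (@sum_ord_itv _ (K + p) j (j + p.+1) (fun i => wt M r (i%:Z - j%:Z) * f i)); last by lia.
rewrite -[X in \sum_(X <= _ < _) _]add0n big_addn addKn big_mkord.
by apply: eq_bigr => l _; rewrite PoszD addrK addnC.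
Qed.

Lemma form_gram K M (c : R) f g : form (K + p) (fun i k => c * gram K M i k) f g =
  c * \sum_(j < K) \sum_(r < M) local_value p M f j r * local_value p M g j r.
Proof.
transitivity (c * \sum_(j < K) \sum_(r < M) \sum_(i < K + p) \sum_(k < K + p)
    (wt M r (i%:Z - j%:Z) * f i) * (wt M r (k%:Z - j%:Z) * g k)).
  rewrite (eq_bigr (fun j : 'I_K => \sum_(i < K + p) \sum_(r < M) \sum_(k < K + p)
    (wt M r (i%:Z - j%:Z) * f i) * (wt M r (k%:Z - j%:Z) * g k))); last first.
    by move=> j _; rewrite exchange_big.
  rewrite exchange_big mulr_sumr; apply: eq_bigr => i _ /=.
  rewrite (eq_bigr (fun j : 'I_K => \sum_(k < K + p) \sum_(r < M)
    (wt M r (i%:Z - j%:Z) * f i) * (wt M r (k%:Z - j%:Z) * g k))); last first.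
    by move=> j _; rewrite exchange_big.
  rewrite exchange_big mulr_sumr; apply: eq_bigr => k _ /=.
  rewrite -!mulrA; congr (_ * _); rewrite /gram mulr_suml; apply: eq_bigr => j _.
  by rewrite mulr_suml; apply: eq_bigr => r _; ring.
congr (_ * _); apply: eq_bigr => j _; apply: eq_bigr => r _.
rewrite -(sum_weight_local M f r (ltn_ord j)) -(sum_weight_local M g r (ltn_ord j)).
by rewrite mulr_suml; apply: eq_bigr => i _; rewrite mulr_sumr.
Qed.

Lemma sqform_ge0 K M (f : nat -> R) : 0 <= sqform p K M f.
Proof. by apply: sumr_ge0 => j _; apply: sumr_ge0 => r _; exact: sqr_ge0. Qed.

Lemma form_gram_sqform K M (c : R) f :
  form (K + p) (fun i k => c * gram K M i k) f f = c * sqform p K M f.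
Proof. by rewrite form_gram. Qed.

Lemma design_weight (K M : nat) (i j r : nat) : (0 < K)%N -> (r < M)%N ->
  bspline K p i.+1%:Z ((j * M + r).+1%:R / (K * M)%:R) = wt M r (i%:Z - j%:Z).
Proof.
move=> K0 rM; have M0 : 0 < M%:R :> R by rewrite ltr0n; exact: leq_ltn_trans rM.
have Mn : M%:R != 0 :> R by rewrite gt_eqF.
have Kn : K%:R != 0 :> R by rewrite pnatr_eq0 -lt0n.
have [h1 h2] := node01 R rM.
have := @bspline_cspl R K p i.+1%:Z j.+1%:Z (r.+1%:R / M%:R) K0; rewrite h1 h2 => /(_ isT).
rewrite (_ : i.+1%:Z - j.+1%:Z = i%:Z - j%:Z); last by lia.
rewrite (_ : j.+1%:Z - 1 = j%:Z); last by lia.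
rewrite /weight => <-; congr (bspline _ _ _ _).
rewrite -[(j * M + r).+1]addnS natrD !natrM -[(j%:Z)%:~R]/(j%:R).
by field; rewrite Mn Kn.
Qed.

Lemma LambdaE (K M : nat) (i k : 'I_(K + p)) : (0 < K)%N ->
  Lambda R (K * M) K p i k = (beta R (K * M) K p)^-1 * gram K M i k.
Proof.
move=> K0; rewrite !mxE; congr (_ * _).
rewrite (eq_bigr (fun x : 'I_(K * M) =>
   bspline K p i.+1%:Z (x.+1%:R / (K * M)%:R) * bspline K p k.+1%:Z (x.+1%:R / (K * M)%:R) : R)); last first.
  by move=> x _; rewrite !mxE.
rewrite (sum_ord_mul K M (fun x =>
   bspline K p i.+1%:Z (x.+1%:R / (K * M)%:R) * bspline K p k.+1%:Z (x.+1%:R / (K * M)%:R))).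
by apply: eq_bigr => j _; apply: eq_bigr => r _; rewrite !design_weight.
Qed.

Lemma betaE (K M : nat) : (0 < K)%N -> beta R (K * M) K p = gram K M p p.
Proof.
move=> K0; rewrite /beta (sum_ord_mul K M (fun x =>
   bspline K p p.+1%:Z (x.+1%:R / (K * M)%:R) ^+ 2)).
by apply: eq_bigr => j _; apply: eq_bigr => r _; rewrite !design_weight.
Qed.

Lemma gram_ge0 K M i k : 0 <= gram K M i k.
Proof.
apply: sumr_ge0 => j _; apply: sumr_ge0 => r _.
by apply: mulr_ge0; exact: weight_ge0.
Qed.

Lemma gram_le K M i k : gram K M i k <= p.+1%:R * M%:R.
Proof.
rewrite /gram (bigID (fun j : 'I_K => (i - p <= j < i.+1)%N)) /= [X in _ + X]big1; last first.
  by move=> j jI; rewrite big1 // => r _; rewrite weight_eq0 ?mul0r //; lia.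
rewrite addr0; have h (j : nat) : (i - p <= j < i.+1)%N ->
    \sum_(r < M) wt M r (i%:Z - j%:Z) * wt M r (k%:Z - j%:Z) <= M%:R.
  move=> _; apply: (@le_trans _ _ (\sum_(r < M) 1)); last first.
    by rewrite sumr_const card_ord.
  apply: ler_sum => r _; rewrite -[leRHS]mulr1.
  by apply: ler_pM; rewrite ?weight_ge0 ?weight_le1.
apply: le_trans (@sum_itv_le R K (i - p) i.+1 (fun j => _) _ (ler0n _ M) h) _.
by apply: ler_wpM2r => //; rewrite ler_nat; lia.
Qed.

(** Sum the hypothesis over all shifts of a window of [K0] intervals: every interval lies in at most
    [K0] windows, and every coefficient belongs to at least one. *)
Lemma sqform_window K0 K M (c : R) : (0 < K0)%N -> (K0 <= K)%N ->
  (forall f : nat -> R, c * \sum_(i < K0 + p) f i ^+ 2 <= sqform p K0 M f) -> 0 <= c ->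
  forall f : nat -> R, c * \sum_(i < K + p) f i ^+ 2 <= K0%:R * sqform p K M f.
Proof.
move=> K00 KK hc c0 f; pose d := (K - K0)%N.
pose g j := \sum_(r < M) local_value p M f j r ^+ 2.
have g0 j : 0 <= g j by apply: sumr_ge0 => r _; exact: sqr_ge0.
have win s : sqform p K0 M (fun i => f (s + i)%N) = \sum_(j < K0) g (s + j)%N.
  apply: eq_bigr => j _; apply: eq_bigr => r _; congr (_ ^+ 2).
  by apply: eq_bigr => l _; rewrite addnA.
have up : \sum_(s < d.+1) sqform p K0 M (fun i => f (s + i)%N) <= K0%:R * sqform p K M f.
  under eq_bigr do rewrite win.
  rewrite exchange_big /=.
  apply: (@le_trans _ _ (\sum_(j < K0) sqform p K M f)); last first.
    by rewrite sumr_const card_ord mulr_natl.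
  apply: ler_sum => j _.
  rewrite -(big_mkord xpredT (fun s => g (s + j)%N)).
  have -> : \sum_(0 <= s < d.+1) g (s + j)%N = \sum_(j <= i < d.+1 + j) g i.
    by rewrite -[X in _ = \sum_(X <= _ < _) _]add0n big_addn addnK.
  rewrite -(@sum_ord_itv _ K j (d.+1 + j) g); last first.
    by have := ltn_ord j; rewrite /d; move: KK; clear; lia.
  by rewrite big_mkcond; apply: ler_sum => i _; case: ifP => // _; exact: g0.
apply: le_trans up.
apply: (@le_trans _ _ (\sum_(s < d.+1) c * \sum_(i < K0 + p) f (s + i)%N ^+ 2)); last first.
  by apply: ler_sum => s _; exact: (hc (fun i => f (s + i)%N)).
rewrite -mulr_sumr; apply: ler_wpM2l => //.
(* Each index below [d] is the first of its own window; all others belong to the last window. *)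
have -> : (K + p = d + (K0 + p))%N by rewrite /d; move: KK; clear; lia.
rewrite -(big_mkord xpredT (fun i => f i ^+ 2)) (@big_cat_nat _ _ _ d) ?leq_addr //=.
rewrite big_ord_recr /=; apply: lerD.
  rewrite big_mkord; apply: ler_sum => s _.
  have e : (0 < K0 + p)%N by rewrite addn_gt0 K00.
  rewrite (bigD1 (Ordinal e)) //= addn0 lerDl.
  by apply: sumr_ge0 => i _; exact: sqr_ge0.
rewrite -[X in \sum_(X <= _ < _) _]add0n big_addn addKn big_mkord.
by rewrite le_eqVlt; apply/orP; left; apply/eqP; apply: eq_bigr => i _; rewrite addnC.
Qed.

(** Invertibility of [Lambda] provides a left inverse [W] of the design matrix, so each coefficient
    is a fixed linear combination of the values at the design points. *)
Lemma posdef_coercive K M : (0 < K)%N -> posdef (Lambda R (K * M) K p) ->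
  exists2 c : R, 0 < c &
  forall f : nat -> R, c * \sum_(i < K + p) f i ^+ 2 <= sqform p K M f.
Proof.
move=> K0 pd; set L := Lambda R (K * M) K p in pd.
pose X := design R (K * M) K p.
pose W := invmx L *m ((beta R (K * M) K p)^-1 *: X^T).
have WX : W *m X = 1%:M.
  by rewrite /W -mulmxA -scalemxAl -/(Lambda R (K * M) K p) mulVmx // posdef_unit.
pose w := \sum_(i < K + p) (\sum_(x < K * M) `|W i x|) ^+ 2.
have w0 : 0 <= w by apply: sumr_ge0 => i _; exact: sqr_ge0.
exists (1 + w)^-1; first by rewrite invr_gt0; lra.
move=> f; rewrite mulrC ler_pdivrMr; last by lra.
set S := sqform p K M f; have S0 : 0 <= S by exact: sqform_ge0.
pose b : 'cV[R]_(K + p) := \col_i f i.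
have Xb x : (X *m b) x 0 ^+ 2 <= S.
  have -> : S = \sum_(x < K * M) (X *m b) x 0 ^+ 2.
    rewrite /S /sqform.
    pose G x := (\sum_(i < K + p) bspline K p i.+1%:Z (x.+1%:R / (K * M)%:R) * f i) ^+ 2.
    rewrite (eq_bigr (fun x : 'I_(K * M) => G x)); last first.
      by move=> y _; rewrite /G mxE; congr (_ ^+ 2); apply: eq_bigr => i _; rewrite !mxE.
    rewrite (sum_ord_mul K M G); apply: eq_bigr => j _; apply: eq_bigr => r _.
    rewrite /G -(sum_weight_local M f r (ltn_ord j)); congr (_ ^+ 2).
    by apply: eq_bigr => i _; rewrite design_weight.
  rewrite (bigD1 x) //= lerDl.
  by apply: sumr_ge0 => i _; exact: sqr_ge0.
have fi (i : 'I_(K + p)) : f i ^+ 2 <= (\sum_(x < K * M) `|W i x|) ^+ 2 * S.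
  rewrite -(sqr_sqrtr S0) -exprMn -[leLHS]real_normK ?num_real //.
  have s0 : 0 <= \sum_(x < K * M) `|W i x| by apply: sumr_ge0.
  rewrite ler_pXn2r ?nnegrE ?mulr_ge0 ?sqrtr_ge0 //.
  have -> : f i = (W *m (X *m b)) i 0 by rewrite mulmxA WX mul1mx mxE.
  rewrite mxE mulr_suml; apply: le_trans (ler_norm_sum _ _ _) _.
  apply: ler_sum => x _; rewrite normrM; apply: ler_wpM2l => //.
  by rewrite -ler_sqr ?nnegrE ?sqrtr_ge0 // sqr_sqrtr // real_normK ?num_real.
apply: (@le_trans _ _ (w * S)).
  by rewrite /w mulr_suml; apply: ler_sum => i _; exact: fi.
by rewrite mulrC; apply: ler_wpM2l => //; lra.
Qed.

(* Positive definiteness for K gives a constant that depends on K. Take the least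
   K0 for which it holds and cover the knot intervals by windows of length K0. *)
Lemma coercive_fixed M : (0 < M)%N -> exists2 c : R, 0 < c &
  forall K, (0 < K)%N -> posdef (Lambda R (K * M) K p) ->
  forall f : nat -> R, c * M%:R * \sum_(i < K + p) f i ^+ 2 <= sqform p K M f.
Proof.
move=> M0; have M0' : 0 < M%:R :> R by rewrite ltr0n.
pose P K := (0 < K)%N && `[< posdef (Lambda R (K * M) K p) >].
have [exP|nP] := pselect (exists K, P K); last first.
  exists 1 => // K K0 pd; case: nP; exists K; rewrite /P K0 /=.
  exact/asboolP.
have [K0 /andP[K00 /asboolP pd0] Kmin] := ex_minnP exP.
have [c c0 hc] := posdef_coercive K00 pd0.
have K0R : 0 < K0%:R :> R by rewrite ltr0n.
exists (c / (K0%:R * M%:R)) => [|K K1 pd f]; first by rewrite divr_gt0 // mulr_gt0.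
have KK : (K0 <= K)%N by apply: Kmin; rewrite /P K1; exact/asboolP.
have := sqform_window K00 KK hc (ltW c0) f.
rewrite -ler_pdivrMl // mulrA => h; apply: le_trans h.
rewrite le_eqVlt; apply/orP; left; apply/eqP; congr (_ * _).
by field; rewrite !gt_eqF.
Qed.

Lemma coercive_large : exists2 c : R, 0 < c &
  forall K M, (0 < K)%N -> (p < M)%N ->
  forall f : nat -> R, c * M%:R * \sum_(i < K + p) f i ^+ 2 <= sqform p K M f.
Proof.
have [c c0 hc] := local_stability R p; exists c => // K M K0 pM f.
have cM : 0 <= c * M%:R by rewrite mulr_ge0 // ltW.
have one (g : nat -> R) : c * M%:R * \sum_(i < 1 + p) g i ^+ 2 <= sqform p 1 M g.
  by rewrite /sqform big_ord1; exact: hc.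
by have := sqform_window (ltn0Sn 0) K0 one cM f; rewrite mul1r.
Qed.

(** For [M > p] use [coercive_large], whose constant is independent of [M]; the values [M <= p] are
    finitely many, and the minimum of their constants is taken. *)
Lemma coercive_uniform : exists c : R, [/\ 0 < c, c <= 1 &
  forall K M, (0 < K)%N -> (0 < M)%N -> posdef (Lambda R (K * M) K p) ->
  forall f : nat -> R, c * M%:R * \sum_(i < K + p) f i ^+ 2 <= sqform p K M f].
Proof.
have [c1 c10 large] := coercive_large.
have small n : exists2 c : R, 0 < c & forall K M, (0 < K)%N -> (0 < M <= n)%N ->
    posdef (Lambda R (K * M) K p) ->
    forall f : nat -> R, c * M%:R * \sum_(i < K + p) f i ^+ 2 <= sqform p K M f.
  elim: n => [|n [c c0 IH]]; first by exists 1 => // K M _; lia.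
  have [c' c'0 hc'] := coercive_fixed (ltn0Sn n).
  exists (Num.min c c') => [|K M K0 /andP[M0 Mn] pd f]; first by rewrite lt_min c0.
  have S0 : 0 <= \sum_(i < K + p) f i ^+ 2 by apply: sumr_ge0 => i _; exact: sqr_ge0.
  have [Mle|Mgt] := leqP M n.
    apply: le_trans (IH K M K0 _ pd f); last by rewrite M0.
    by do 2![apply: ler_wpM2r => //]; rewrite ge_min lexx.
  have ME : M = n.+1 by lia.
  rewrite ME in pd *; apply: le_trans (hc' K K0 pd f).
  by do 2![apply: ler_wpM2r => //]; rewrite ge_min lexx orbT.
have [c2 c20 hs] := small p.
exists (Num.min 1 (Num.min c1 c2)); split.
- by rewrite !lt_min ltr01 c10.
- by rewrite ge_min lexx.
move=> K M K0 M0 pd f.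
have S0 : 0 <= \sum_(i < K + p) f i ^+ 2 by apply: sumr_ge0 => i _; exact: sqr_ge0.
have [Mle|Mgt] := leqP M p.
  apply: le_trans (hs K M K0 _ pd f); last by rewrite M0.
  by do 2![apply: ler_wpM2r => //]; rewrite !ge_min lexx !orbT.
apply: le_trans (large K M K0 Mgt f).
by do 2![apply: ler_wpM2r => //]; rewrite !ge_min lexx !orbT.
Qed.

(* On an interior row the B-spline lies inside [0, 1], so that both partial sums
   of its weights run over its whole support and the first moments cancel. *)
Lemma gram_affine (K M i : nat) (c d : R) : (p <= i)%N -> (i + p < K + p)%N ->
  \sum_(k < K + p) gram K M i k * (c + d * k%:R) = M%:R * (c + d * i%:R).
Proof.
move=> pi iK; pose f (k : nat) := c + d * k%:R.
pose mu r := \sum_(l < p.+1) wt M r l * l%:R.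
have loc j r : local_value p M f j r = c + d * j%:R + d * mu r.
  rewrite /local_value (eq_bigr (fun l : 'I_p.+1 =>
    (c + d * j%:R) * wt M r l + d * (wt M r l * l%:R))); last first.
    by move=> l _; rewrite /f natrD; ring.
  by rewrite big_split /= -!mulr_sumr sum_weight mulr1.
have -> : \sum_(k < K + p) gram K M i k * f k =
    \sum_(j < K) \sum_(r < M) wt M r (i%:Z - j%:Z) * local_value p M f j r.
  rewrite (eq_bigr (fun k : 'I_(K + p) => \sum_(j < K) \sum_(r < M)
    wt M r (i%:Z - j%:Z) * (wt M r (k%:Z - j%:Z) * f k))); last first.
    move=> k _; rewrite /gram mulr_suml; apply: eq_bigr => j _.
    by rewrite mulr_suml; apply: eq_bigr => r _; rewrite mulrA.
  rewrite exchange_big; apply: eq_bigr => j _ /=.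
  rewrite exchange_big; apply: eq_bigr => r _ /=.
  by rewrite -mulr_sumr (sum_weight_local M f r (ltn_ord j)).
have supp (G : nat -> R) r : \sum_(j < K) wt M r (i%:Z - j%:Z) * G j =
    \sum_(l < p.+1) wt M r l * G (i - l)%N.
  rewrite (bigID (fun j : 'I_K => (i - p <= j < i.+1)%N)) /= [X in _ + X]big1; last first.
    by move=> j jI; rewrite weight_eq0 ?mul0r //; lia.
  rewrite addr0 (@sum_ord_itv _ K (i - p) i.+1 (fun j => wt M r (i%:Z - j%:Z) * G j)); last by lia.
  rewrite -[X in \sum_(X <= _ < _) _]add0n big_addn big_mkord.
  rewrite (_ : i.+1 - (i - p) = p.+1)%N; last by lia.
  rewrite (reindex_inj rev_ord_inj) /=; apply: eq_bigr => l _.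
  have lp := ltn_ord l.
  rewrite (_ : p.+1 - l.+1 + (i - p) = i - l)%N; last by lia.
  by rewrite (_ : i%:Z - (i - l)%N%:Z = l%:Z) //; lia.
rewrite exchange_big /=.
rewrite (eq_bigr (fun r : 'I_M => c + d * i%:R)).
  by rewrite sumr_const card_ord mulr_natl.
move=> r _; under eq_bigr do rewrite loc.
rewrite (supp (fun j => c + d * j%:R + d * mu r)).
rewrite (eq_bigr (fun l : 'I_p.+1 =>
    (c + d * i%:R + d * mu r) * wt M r l - d * (wt M r l * l%:R))); last first.
  move=> l _; have lp := ltn_ord l.
  by rewrite natrB; [ring|lia].
by rewrite sumrB -!mulr_sumr sum_weight /mu; ring.
Qed.

Lemma Lambda_banded_form : exists lam C : R, [/\ 0 < lam, lam <= C &
  forall K M, (0 < K)%N -> (0 < M)%N -> posdef (Lambda R (K * M) K p) ->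
  exists sig, banded_form p (K + p) lam C sig
    (fun i k => (beta R (K * M) K p)^-1 * gram K M i k)].
Proof.
have [c [c0 c1 coer]] := coercive_uniform.
have p1 : 1 <= p.+1%:R :> R by rewrite ler1n.
have p0 : 0 < p.+1%:R :> R by lra.
have lam0 : 0 < c / p.+1%:R by rewrite divr_gt0.
have lam1 : c / p.+1%:R <= 1 by rewrite ler_pdivrMr //; lra.
have C1 : 1 <= p.+1%:R / c by rewrite ler_pdivlMr //; lra.
(* These come from [c * M <= beta <= p.+1 * M]: the entries and the coercivity constant of the Gram
   matrix are of order [M], which cancels after division by [beta]. *)
exists (c / p.+1%:R), (p.+1%:R / c); split => //; first exact: le_trans lam1 C1.
move=> K M K0 M0 pd; have {}coer := coer K M K0 M0 pd.
have M0' : 0 < M%:R :> R by rewrite ltr0n.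
set B := beta R (K * M) K p.
have Bhi : B <= p.+1%:R * M%:R by rewrite /B betaE // gram_le.
(* [beta] is the value of the quadratic form of the Gram matrix at the unit vector of index [p]. *)
have Blo : c * M%:R <= B.
  pose e (i : nat) : R := (i == p)%:R.
  have pN : (p < K + p)%N by rewrite -[X in (X < _)%N]add0n ltn_add2r.
  have := coer e; rewrite (bigD1 (Ordinal pN)) //= big1 => [|i ip]; last first.
    by rewrite /e -[p]/(val (Ordinal pN)) (inj_eq val_inj) (negbTE ip) expr0n.
  rewrite /e eqxx expr1n addr0 mulr1 => h; apply: le_trans h _.
  rewrite /B betaE // le_eqVlt; apply/orP; left; apply/eqP.
  apply: eq_bigr => j _; apply: eq_bigr => r _.
  rewrite -(sum_weight_local M e r (ltn_ord j)) (bigD1 (Ordinal pN)) //= big1 => [|i ip].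
    by rewrite /e eqxx mulr1 addr0 expr2.
  by rewrite /e -[p in _ == p]/(val (Ordinal pN)) (inj_eq val_inj) (negbTE ip) mulr0.
have B0 : 0 < B by apply: lt_le_trans Blo; rewrite mulr_gt0.
have Bi : 0 < B^-1 by rewrite invr_gt0.
exists (M%:R / B); split => //.
- rewrite ler_pdivlMr //; apply: (@le_trans _ _ (c / p.+1%:R * (p.+1%:R * M%:R))).
    by apply: ler_wpM2l => //; exact: ltW.
  by rewrite mulrA divfK ?gt_eqF // ler_piMl // ltW.
- exact: le_trans lam1 C1.
- move=> i k iN kN h; rewrite /gram big1 ?mulr0 // => j _; rewrite big1 // => r _.
  have [ij|ij] := boolP ((i%:Z - j%:Z < 0) || (p%:Z < i%:Z - j%:Z)).
    by rewrite weight_eq0 ?mul0r.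
  by rewrite [wt M r (k%:Z - _)]weight_eq0 ?mulr0 //; move: h ij; clear; lia.
- move=> i k _ _; rewrite ger0_norm; last by rewrite mulr_ge0 ?gram_ge0 // ltW.
  rewrite ler_pdivrMl // mulrA ler_pdivlMr //.
  apply: le_trans (ler_wpM2r (ltW c0) (gram_le K M i k)) _.
  rewrite (_ : p.+1%:R * M%:R * c = c * M%:R * p.+1%:R); last by ring.
  by apply: ler_wpM2r => //; exact: ltW.
- move=> f; rewrite form_gram_sqform mulrC ler_pdivlMl //.
  apply: le_trans (coer f).
  set S := \sum_(i < K + p) _.
  have S0 : 0 <= S by apply: sumr_ge0 => i _; exact: sqr_ge0.
  rewrite mulrCA mulrC; apply: ler_wpM2r => //.
  apply: le_trans (ler_wpM2r (ltW lam0) Bhi) _.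
  have e (P : R) : 0 < P -> P * M%:R * (c / P) = c * M%:R.
    by move=> P0; field; rewrite gt_eqF.
  by rewrite e.
move=> i a d pi iK; rewrite (eq_bigr (fun k : 'I_(K + p) => B^-1 * (gram K M i k * (a + d * k%:R)))).
  by rewrite -mulr_sumr gram_affine // mulrA [B^-1 * _]mulrC.
by move=> k _; rewrite mulrA.
Qed.

End Gram.

(** * The range of the hat matrix *)

Section HatMatrix.
Variables (R : realType) (N : nat) (alpha : {set 'I_(N - 2)}).
Hypothesis N0 : (0 < N)%N.

Definition is_break (k : nat) : bool := (k < N)%N && ~~ [exists i in alpha, k == i.+1].

Local Notation J := (breaks alpha).
Local Notation L := (N - #|alpha|)%N.

Lemma mem_breaks k : (k \in J) = is_break k.
Proof. by rewrite mem_filter mem_iota add0n andbC. Qed.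

Lemma size_breaks : size J = L.
Proof.
pose P (k : nat) := [exists i in alpha, k == i.+1].
have E : (count P (iota 0%N N) + size J)%N = N.
  by rewrite size_filter (count_predC P) size_iota.
suff cP : count P (iota 0%N N) = #|alpha| by move: E; rewrite cP; lia.
rewrite -size_filter cardE -(size_map (fun i : 'I_(N - 2) => i.+1)).
apply: perm_size; apply: uniq_perm.
- by rewrite filter_uniq // iota_uniq.
- by rewrite map_inj_uniq ?enum_uniq // => i j [/val_inj].
move=> k; rewrite mem_filter mem_iota /= add0n.
apply/andP/mapP => [[/existsP[i /andP[ia /eqP->]] _]|[i ia ->]].
  by exists i => //; rewrite mem_enum.
split; first by apply/existsP; exists i; rewrite eqxx andbT -mem_enum.
by have := ltn_ord i; lia.
Qed.

Lemma breaks_ltn s t : (t < L)%N -> (s < t)%N -> (nth 0%N J s < nth 0%N J t)%N.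
Proof.
move=> tL st; apply: (sorted_ltn_nth ltn_trans) => //; rewrite ?inE ?size_breaks //.
- by apply: sorted_filter; [exact: ltn_trans|exact: iota_ltn_sorted].
- exact: ltn_trans tL.
Qed.

Lemma breaks_leq s t : (t < L)%N -> (s <= t)%N -> (nth 0%N J s <= nth 0%N J t)%N.
Proof.
by move=> tL; rewrite leq_eqVlt => /orP[/eqP->//|st]; rewrite ltnW // breaks_ltn.
Qed.

Lemma breaks_lt_inv s t : (s < L)%N -> (nth 0%N J s < nth 0%N J t)%N -> (s < t)%N.
Proof.
by move=> sL h; rewrite ltnNge; apply/negP => ts; have := breaks_leq sL ts; rewrite leqNgt h.
Qed.

Lemma is_break_nth s : (s < L)%N -> is_break (nth 0%N J s).
Proof. by move=> sL; rewrite -mem_breaks mem_nth // size_breaks. Qed.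

Lemma nth_breaks_lt s : (s < L)%N -> (nth 0%N J s < N)%N.
Proof. by move=> /is_break_nth/andP[]. Qed.

Lemma is_break0 : is_break 0%N.
Proof. by rewrite /is_break N0 /=; apply/existsP => -[i /andP[]]. Qed.

Lemma is_break_last : is_break N.-1.
Proof.
rewrite /is_break ltn_predL N0 /=; apply/existsP => -[i /andP[_ /eqP E]].
by have := ltn_ord i; lia.
Qed.

Lemma breaks_index k : is_break k -> exists2 s, (s < L)%N & nth 0%N J s = k.
Proof.
rewrite -mem_breaks => kJ; exists (index k J); last exact: nth_index.
by rewrite -size_breaks index_mem.
Qed.

Lemma consecutive_breaks s : (s.+1 < L)%N ->
  consecutive is_break (nth 0%N J s) (nth 0%N J s.+1).
Proof.
move=> sL; have sL' := ltnW sL; split; rewrite ?is_break_nth ?breaks_ltn //.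
move=> i /andP[si is1]; apply/negP => /breaks_index[t tL E].
by move: si is1; rewrite -E => /(breaks_lt_inv sL') st /(breaks_lt_inv tL); lia.
Qed.

Lemma locate_gap k : (k < N)%N -> exists2 s, (s < L)%N & nth 0%N J s = k \/
  (s.+1 < L)%N /\ (nth 0%N J s <= k <= nth 0%N J s.+1)%N.
Proof.
move=> kN; have [w [/andP[_ wk] bw nw]] := last_break is_break0 (leq0n k).
have [s sL E] := breaks_index bw; exists s => //.
have [sL1|sL1] := ltnP s.+1 L.
  right; split => //; rewrite E wk /= leqNgt; apply/negP => h.
  have := nw (nth 0%N J s.+1); rewrite is_break_nth // -E breaks_ltn // ltnW //.
  by move=> /(_ isT).
(* No break follows the one of index [s], so it is [N.-1], and [k] cannot lie beyond it. *)
left; have [t tL Et] := breaks_index is_break_last.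
have := breaks_leq sL (_ : (t <= s)%N); rewrite E Et => /(_ ltac:(lia)); lia.
Qed.

Definition hat_entry (s i : nat) : R :=
  let a := nth 0%N J s.-1 in
  let j := nth 0%N J s in
  let b := nth 0%N J s.+1 in
  if i == j :> nat then 1
  else if (j < i < b)%N then (b - i)%:R / (b - j)%:R
  else if (a < i < j)%N then (i - a)%:R / (j - a)%:R
  else 0.

Definition hat_comb (c : nat -> R) (i : nat) : R := \sum_(s < L) c s * hat_entry s i.

Lemma hat_comb_nth c s : (s < L)%N -> hat_comb c (nth 0%N J s) = c s.
Proof.
move=> sL; rewrite /hat_comb (bigD1 (Ordinal sL)) //= big1 => [|t ts].
  by rewrite /hat_entry eqxx mulr1 addr0.
have tL := ltn_ord t; have {}ts : (t : nat) != s by apply: contra_neq ts => E; exact: val_inj.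
rewrite /hat_entry; have [st|ts'|E] := ltngtP s t; last by rewrite E eqxx in ts.
  have h1 := breaks_ltn tL st.
  have h2 : (nth 0%N J s <= nth 0%N J t.-1)%N.
    apply: breaks_leq; first exact: leq_ltn_trans (leq_pred t) tL.
    by move: st; clear; lia.
  by rewrite !ifN ?mulr0 //; lia.
have h1 := breaks_ltn sL ts'.
have h2 : (nth 0%N J t.+1 <= nth 0%N J s)%N by apply: breaks_leq; lia.
by rewrite !ifN ?mulr0 //; lia.
Qed.

Lemma hat_comb_gap c s i : (s.+1 < L)%N -> (nth 0%N J s <= i <= nth 0%N J s.+1)%N ->
  hat_comb c i = ((nth 0%N J s.+1 - i)%:R * c s + (i - nth 0%N J s)%:R * c s.+1)
                 / (nth 0%N J s.+1 - nth 0%N J s)%:R.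
Proof.
move=> sL1 iI; have sL := ltnW sL1; have sS := breaks_ltn sL1 (ltnSn s).
have h0 : (nth 0%N J s.+1 - nth 0%N J s)%:R != 0 :> R by rewrite pnatr_eq0; lia.
have [->|is1] := eqVneq i (nth 0%N J s).
  by rewrite hat_comb_nth // subnn mul0r addr0 mulrAC divff ?mul1r.
have [->|is2] := eqVneq i (nth 0%N J s.+1).
  by rewrite hat_comb_nth // subnn mul0r add0r mulrAC divff ?mul1r.
have nes : Ordinal sL1 != Ordinal sL by rewrite -(inj_eq val_inj) /= eqn_leq ltnn.
rewrite /hat_comb (bigD1 (Ordinal sL)) //= (bigD1 (Ordinal sL1)) //= big1 ?addr0.
  rewrite /hat_entry (negbTE is1) (negbTE is2) ifT; last by lia.
  rewrite ifN; last by lia.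
  by rewrite ifT /=; [ring|lia].
move=> t /andP[t1 t2]; have tL := ltn_ord t.
have {}t1 : (t : nat) != s by apply: contra_neq t1 => E; exact: val_inj.
have {}t2 : (t : nat) != s.+1 by apply: contra_neq t2 => E; exact: val_inj.
rewrite /hat_entry; have [ts|ts] := ltnP t s.
  have h1 := breaks_ltn sL ts.
  have h2 : (nth 0%N J t.+1 <= nth 0%N J s)%N by exact: breaks_leq.
  by rewrite !ifN ?mulr0 //; lia.
have h1 : (nth 0%N J s.+1 < nth 0%N J t)%N by apply: breaks_ltn => //; lia.
have h2 : (nth 0%N J s.+1 <= nth 0%N J t.-1)%N.
  apply: breaks_leq; first exact: leq_ltn_trans (leq_pred t) tL.
  by move: ts t1 t2; clear; lia.
by rewrite !ifN ?mulr0 //; lia.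
Qed.

Lemma pwlin_hat_comb c : pwlin N is_break (hat_comb c).
Proof.
move=> i iN nb; have iN1 := ltnW iN.
have [s sL [E|[sL1 sI]]] := locate_gap iN1.
  by move: nb; rewrite -E is_break_nth.
have n1 : nth 0%N J s != i.+1 by apply: contraNneq nb => <-; exact: is_break_nth.
have n2 : nth 0%N J s.+1 != i.+1 by apply: contraNneq nb => <-; exact: is_break_nth.
have sS := breaks_ltn sL1 (ltnSn s).
have h0 : (nth 0%N J s.+1 - nth 0%N J s)%:R != 0 :> R by rewrite pnatr_eq0; lia.
rewrite !(hat_comb_gap c sL1); try lia.
rewrite (_ : nth 0%N J s.+1 - i = (nth 0%N J s.+1 - i.+2) + 2)%N; last by lia.
rewrite (_ : nth 0%N J s.+1 - i.+1 = (nth 0%N J s.+1 - i.+2) + 1)%N; last by lia.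
rewrite (_ : i.+2 - nth 0%N J s = (i - nth 0%N J s) + 2)%N; last by lia.
rewrite (_ : i.+1 - nth 0%N J s = (i - nth 0%N J s) + 1)%N; last by lia.
by rewrite !natrD; field.
Qed.

Lemma pwlin_hat_combE v i : pwlin N is_break v -> (i < N)%N ->
  v i = hat_comb (fun s => v (nth 0%N J s)) i.
Proof.
move=> vV iN; have [s sL [<-|[sL1 sI]]] := locate_gap iN; first by rewrite hat_comb_nth.
by rewrite (hat_comb_gap _ sL1 sI) (pwlin_interp vV (consecutive_breaks sL1) (nth_breaks_lt sL1) sI).
Qed.

Definition coords n (b : 'cV[R]_n) (i : nat) : R :=
  if insub i is Some o then b o 0 else 0.

Lemma coordsE n (b : 'cV[R]_n) (i : 'I_n) : coords b i = b i 0.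
Proof. by rewrite /coords valK. Qed.

Let F := hat_matrix R alpha.

Lemma hat_matrixE (c : 'cV[R]_L) i : (F^T *m c) i 0 = hat_comb (coords c) i.
Proof.
rewrite mxE; apply: eq_bigr => s _; rewrite coordsE mulrC; congr (_ * _).
by rewrite !mxE.
Qed.

Lemma hat_matrix_inj (c : 'cV[R]_L) : F^T *m c = 0 -> c = 0.
Proof.
move=> Fc; apply/colP => s; rewrite mxE -(coordsE c s).
have sL := ltn_ord s; rewrite -(hat_comb_nth (coords c) sL).
by rewrite -(hat_matrixE c (Ordinal (nth_breaks_lt sL))) Fc mxE.
Qed.

Variable A : 'M[R]_N.
Hypothesis Apd : posdef A.

(** The Galerkin solution operator. Its product with [A] is the projection onto the range of [F^T]
    that is orthogonal for the inner product of [A]. *)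
Definition proj_matrix : 'M[R]_N := F^T *m invmx (F *m A *m F^T) *m F.

Lemma hat_gram_unit : F *m A *m F^T \in unitmx.
Proof.
have [AT A0] := Apd; apply: posdef_unit; split.
  by rewrite !trmx_mul trmxK AT mulmxA.
move=> c c0; have Fc0 : F^T *m c != 0 by apply: contra_neq c0; exact: hat_matrix_inj.
by have := A0 _ Fc0; rewrite trmx_mul trmxK !mulmxA.
Qed.

Lemma proj_matrix_pwlin (u : 'cV[R]_N) : pwlin N is_break (coords (proj_matrix *m u)).
Proof.
move=> i iN nb; pose c := invmx (F *m A *m F^T) *m F *m u.
have E k : (k < N)%N -> coords (proj_matrix *m u) k = hat_comb (coords c) k.
  move=> kN; rewrite -[k]/(val (Ordinal kN)) coordsE -hat_matrixE.
  by rewrite /proj_matrix /c !mulmxA.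
by rewrite !E; try lia; exact: pwlin_hat_comb.
Qed.

Lemma proj_matrix_orth (u v : 'cV[R]_N) : pwlin N is_break (coords v) ->
  v^T *m A *m (proj_matrix *m u) = v^T *m u.
Proof.
move=> vV; pose d : 'cV[R]_L := \col_s coords v (nth 0%N J s).
have -> : v = F^T *m d.
  apply/colP => i; rewrite hat_matrixE -coordsE (pwlin_hat_combE vV (ltn_ord i)).
  apply: eq_bigr => s _; congr (_ * _).
  by rewrite coordsE mxE.
rewrite trmx_mul trmxK /proj_matrix.
transitivity (d^T *m (F *m A *m F^T *m invmx (F *m A *m F^T)) *m (F *m u)).
  by rewrite !mulmxA.
by rewrite mulmxV ?hat_gram_unit // mulmx1 !mulmxA.
Qed.

End HatMatrix.

(** * Minimization over the convex cone *)

Section ConvexMinimizer.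
Variable R : realType.

Lemma coordsD n (b d : 'cV[R]_n) (t : R) i :
  coords (b + t *: d) i = coords b i + t * coords d i.
Proof. by rewrite /coords; case: insub => [o|]; rewrite ?mxE // mulr0 addr0. Qed.

Definition diff2 N (b : 'cV[R]_N) (i : nat) : R :=
  coords b i - 2 * coords b i.+1 + coords b i.+2.

Lemma diff2D N (b d : 'cV[R]_N) (t : R) i :
  diff2 (b + t *: d) i = diff2 b i + t * diff2 d i.
Proof. by rewrite /diff2 !coordsD; ring. Qed.

Lemma OmegaP N (b : 'cV[R]_N) : Omega b <-> forall i : 'I_(N - 2), 0 <= diff2 b i.
Proof.
split=> [h i|h i j k ji ki].
  have iN := ltn_ord i; have i0 : (i < N)%N by lia.
  have i1 : (i.+1 < N)%N by lia.
  have i2 : (i.+2 < N)%N by lia.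
  have := h (Ordinal i0) (Ordinal i1) (Ordinal i2) erefl erefl.
  by rewrite /diff2 -!coordsE.
have iN : (i < N - 2)%N by have := ltn_ord k; lia.
by have := h (Ordinal iN); rewrite /diff2 /= -ki -ji !coordsE.
Qed.

Definition active N (b : 'cV[R]_N) : {set 'I_(N - 2)} := [set i : 'I_(N - 2) | diff2 b i == 0].

Lemma pwlin_diff2 N (alpha : {set 'I_(N - 2)}) (b : 'cV[R]_N) :
  pwlin N (is_break alpha) (coords b) <-> (forall i : 'I_(N - 2), i \in alpha -> diff2 b i = 0).
Proof.
split=> [bV i ia|h i iN nb].
  have iN := ltn_ord i; have := bV i; rewrite /diff2.
  move=> /(_ ltac:(lia)) E; suff : coords b i + coords b i.+2 = 2 * coords b i.+1 by lra.
  by apply: E; rewrite /is_break negb_and negbK; apply/orP; right; apply/existsP; exists i; rewrite ia eqxx.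
move: nb; rewrite /is_break (ltnW iN) /= negbK => /existsP[k /andP[ka /eqP[E]]].
by have := h k ka; rewrite /diff2 E; lra.
Qed.

Section Fixed.
Variables (N : nat) (A : 'M[R]_N) (lam : R).
Hypothesis N0 : (0 < N)%N.
Hypothesis Apd : posdef A.
Hypothesis lam0 : 0 < lam.
Hypothesis Alam : forall d : 'cV[R]_N, lam * \sum_(i < N) d i 0 ^+ 2 <= (d^T *m A *m d) 0 0.

Lemma quad_ge0 (d : 'cV[R]_N) : 0 <= (d^T *m A *m d) 0 0.
Proof.
apply: le_trans (Alam d); apply: mulr_ge0; first exact: ltW.
by apply: sumr_ge0 => i _; exact: sqr_ge0.
Qed.

Lemma bilinC (b d : 'cV[R]_N) : (b^T *m A *m d) 0 0 = (d^T *m A *m b) 0 0.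
Proof.
have [AT _] := Apd; transitivity ((b^T *m A *m d)^T 0 0); first by rewrite [RHS]mxE.
by rewrite !trmx_mul trmxK AT mulmxA.
Qed.

Lemma objectiveD (u b d : 'cV[R]_N) t : objective A u (b + t *: d) =
  objective A u b + t * ((d^T *m A *m b) 0 0 - (d^T *m u) 0 0)
  + t ^+ 2 / 2 * (d^T *m A *m d) 0 0.
Proof.
have Dl (c : 'cV[R]_N) : ((b + t *: d)^T *m A *m c) 0 0 =
    (b^T *m A *m c) 0 0 + t * (d^T *m A *m c) 0 0.
  by rewrite linearD linearZ /= !mulmxDl -!scalemxAl mxE [X in _ + X]mxE.
have Dr (c : 'cV[R]_N) : (c^T *m A *m (b + t *: d)) 0 0 =
    (c^T *m A *m b) 0 0 + t * (c^T *m A *m d) 0 0.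
  by rewrite mulmxDr -scalemxAr mxE [X in _ + X]mxE.
have Du : ((b + t *: d)^T *m u) 0 0 = (b^T *m u) 0 0 + t * (d^T *m u) 0 0.
  by rewrite linearD linearZ /= !mulmxDl -!scalemxAl mxE [X in _ + X]mxE.
by rewrite /objective Dl !Dr Du (bilinC b d); field.
Qed.

Local Notation P alpha := (proj_matrix alpha A).

(* Move b towards the minimizer on the span of its own face; either the minimizer
   is reached inside Omega, or a further constraint becomes active on the way. *)
Lemma descent (u b : 'cV[R]_N) : Omega b -> exists alpha : {set 'I_(N - 2)},
  Omega (P alpha *m u) /\ objective A u (P alpha *m u) <= objective A u b.
Proof.
move En : #|~: active b| => n; elim/ltn_ind: n b En => n IH b En bO.
pose alpha := active b; pose m := P alpha *m u; pose d := m - b.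
have mE : m = b + 1 *: d by rewrite scale1r /d addrC subrK.
have bV i : i \in alpha -> diff2 b i = 0 by rewrite inE => /eqP.
have mV i : i \in alpha -> diff2 m i = 0.
  by move: i; apply/pwlin_diff2; exact: proj_matrix_pwlin.
have dE i : diff2 d i = diff2 m i - diff2 b i.
  by rewrite mE diff2D mul1r addrC addKr.
have dV : pwlin N (is_break alpha) (coords d).
  by apply/pwlin_diff2 => i ia; rewrite dE mV // bV // subrr.
(* As [m] is stationary on the space of the face, the objective along the segment is a parabola with
   its vertex at [t = 1]. *)
have obj t : objective A u (b + t *: d) =
    objective A u b - (t - t ^+ 2 / 2) * (d^T *m A *m d) 0 0.
  have O := proj_matrix_orth N0 Apd u dV.
  have E : (d^T *m u) 0 0 = (d^T *m A *m b) 0 0 + (d^T *m A *m d) 0 0.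
    by rewrite -O -/m mE scale1r mulmxDr mxE.
  by rewrite objectiveD E; field.
have q0 := quad_ge0 d.
have decr t : 0 <= t <= 1 -> objective A u (b + t *: d) <= objective A u b.
  move=> /andP[t0 t1]; rewrite obj lerBlDr lerDl; apply: mulr_ge0 => //.
  have : t ^+ 2 <= t by rewrite expr2 ler_piMr.
  by lra.
have [mO|nmO] := pselect (Omega m).
  by exists alpha; split => //; rewrite -/m mE; apply: decr; rewrite ler01 lexx.
have [i0 i0S] : exists i : 'I_(N - 2), diff2 m i < 0.
  apply: contrapT => h; apply: nmO; apply/OmegaP => i.
  by rewrite leNgt; apply/negP => hi; apply: h; exists i.
have b0 (i : 'I_(N - 2)) : 0 <= diff2 b i by move/OmegaP: bO.
(* The time at which constraint [i] becomes active on the way from [b] to [m]; the minimum over the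
   constraints violated at [m] is the time of leaving [Omega]. *)
pose tau (i : 'I_(N - 2)) := diff2 b i / (diff2 b i - diff2 m i).
case: (@Order.TotalTheory.arg_minP _ R _ i0 (fun i : 'I_(N - 2) => diff2 m i < 0) tau i0S) => k kS kmin.
have kd : 0 < diff2 b k - diff2 m k by have := b0 k; lra.
have t0 : 0 <= tau k by rewrite divr_ge0 // ltW.
have t1 : tau k <= 1 by rewrite ler_pdivrMr // mul1r; lra.
pose b' := b + tau k *: d.
have b'E i : diff2 b' i = diff2 b i - tau k * (diff2 b i - diff2 m i).
  by rewrite diff2D dE; ring.
have b'k : diff2 b' k = 0.
  by rewrite b'E /tau divfK ?subrr // gt_eqF.
have b'O : Omega b'.
  apply/OmegaP => i; rewrite b'E; have [mi|mi] := leP 0 (diff2 m i).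
    have h1 := mulr_ge0 t0 mi.
    have h2 : tau k * diff2 b i <= diff2 b i by rewrite ler_piMl.
    by lra.
  have di : 0 < diff2 b i - diff2 m i by have := b0 i; lra.
  have := kmin i mi; rewrite {2}/tau ler_pdivlMr //; lra.
(* Active constraints stay active, because [d] keeps their second differences at 0, and [k] joins
   them. *)
have lt_active : (#|~: active b'| < n)%N.
  rewrite -En; apply: proper_card; rewrite properE; apply/andP; split.
    rewrite finset.setCS; apply/fintype.subsetP => i ia; rewrite inE b'E mV // bV //.
    by rewrite subrr mulr0 subrr.
  apply/fintype.subsetPn; exists k; last by rewrite !inE b'k eqxx.
  rewrite !inE; apply/negP => bk; have ka : k \in alpha by rewrite inE.
  by move: kS; rewrite mV // ltxx.
have [beta [bO' bobj]] := IH _ lt_active b' erefl b'O.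
exists beta; split => //; apply: le_trans bobj _.
by apply: decr; rewrite t0.
Qed.

Lemma Omega0 : Omega (0 : 'cV[R]_N).
Proof. by move=> i j k _ _; rewrite !mxE mulr0 subrr addr0. Qed.

(** No compactness: by [descent] the best of the finitely many feasible candidates is a minimizer
    over the whole cone. *)
Lemma argmin_exists (u : 'cV[R]_N) : exists b, is_argmin A u b.
Proof.
have [a0 [O0 _]] := descent u Omega0.
pose Q (alpha : {set 'I_(N - 2)}) := `[< Omega (P alpha *m u) >].
have Qa0 : Q a0 by apply/asboolP.
case: (@Order.TotalTheory.arg_minP _ R _ a0 Q (fun alpha => objective A u (P alpha *m u)) Qa0).
move=> alpha /asboolP aO amin; exists (P alpha *m u); split => // b' b'O.
have [beta [bO bobj]] := descent u b'O.
by apply: le_trans bobj; apply: amin; apply/asboolP.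
Qed.

Lemma bhatP (u : 'cV[R]_N) : is_argmin A u (bhat A u).
Proof. by have [b bP] := argmin_exists u; exact: (xgetI 0 bP). Qed.

Lemma Omega_segment (b d : 'cV[R]_N) t : 0 <= t <= 1 -> Omega b -> Omega (b + d) ->
  Omega (b + t *: d).
Proof.
move=> /andP[t0 t1] /OmegaP bO /OmegaP bdO; apply/OmegaP => i.
have := bdO i; rewrite -{1}[d]scale1r !diff2D mul1r => h1.
have h2 : 0 <= (1 - t) * diff2 b i by apply: mulr_ge0 => //; lra.
have h3 := mulr_ge0 t0 h1.
by lra.
Qed.

Lemma variational (u b b' : 'cV[R]_N) : is_argmin A u b -> Omega b' ->
  0 <= ((b' - b)^T *m A *m b) 0 0 - ((b' - b)^T *m u) 0 0.
Proof.
move=> [bO bmin] b'O; set d := b' - b; set g := _ - _.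
rewrite leNgt; apply/negP => g0.
have q0 := quad_ge0 d; set q := (d^T *m A *m d) 0 0 in q0.
(* A step so short that the quadratic term cannot make up for the linear decrease [t * g]. *)
pose t := Num.min 1 (- g / (q + 1)).
have q1 : 0 < q + 1 by lra.
have t0 : 0 < t by rewrite lt_min ltr01 divr_gt0 // oppr_gt0.
have t1 : t <= 1 by rewrite ge_min lexx.
have tq : t * (q + 1) <= - g by rewrite -ler_pdivlMr // ge_min lexx orbT.
have btO : Omega (b + t *: d).
  by apply: Omega_segment => //; [rewrite ltW|rewrite /d addrC subrK].
have := bmin _ btO; rewrite objectiveD -/g -/q.
have -> : t ^+ 2 / 2 * q = t * (t * q) / 2 by ring.
have h : t * (t * q) <= t * (- g).
  by apply: ler_wpM2l; [exact: ltW|apply: le_trans tq; rewrite ler_wpM2l ?(ltW t0) //; lra].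
have tg : t * g < 0 by rewrite pmulr_rlt0.
by lra.
Qed.

(** Adding the two variational inequalities bounds the energy of [d = b' - b] by its pairing with
    [u' - u]. The constant grows with [N]; the lemma serves for uniqueness, with [w = 0], and for
    continuity of the minimizer. *)
Lemma argmin_lipschitz (u u' b b' : 'cV[R]_N) (w : R) :
  is_argmin A u b -> is_argmin A u' b' -> (forall i, `|(u' - u) i 0| <= w) ->
  forall i, `|(b' - b) i 0| <= 2 * N%:R / lam * w.
Proof.
move=> bA b'A uw i; have w0 : 0 <= w by apply: le_trans (uw i).
have h1 := variational bA b'A.1; have h2 := variational b'A bA.1.
rewrite -(opprB b' b) in h2; set d := b' - b in h1 h2 *.
have E1 (X : 'cV[R]_N) : ((- d)^T *m A *m X) 0 0 = - (d^T *m A *m X) 0 0.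
  by rewrite linearN /= !mulNmx mxE.
have E2 (X : 'cV[R]_N) : ((- d)^T *m X) 0 0 = - (d^T *m X) 0 0.
  by rewrite linearN /= !mulNmx mxE.
have E3 : (d^T *m A *m b') 0 0 = (d^T *m A *m b) 0 0 + (d^T *m A *m d) 0 0.
  have -> : b' = b + d by rewrite /d addrC subrK.
  by rewrite mulmxDr mxE.
have E4 : (d^T *m (u' - u)) 0 0 = (d^T *m u') 0 0 - (d^T *m u) 0 0.
  by rewrite mulmxBr mxE [X in _ + X]mxE.
rewrite E1 E2 E3 in h2.
have h3 : (d^T *m A *m d) 0 0 <= (d^T *m (u' - u)) 0 0 by rewrite E4; lra.
set S := \sum_(i < N) d i 0 ^+ 2; have h4 : lam * S <= (d^T *m (u' - u)) 0 0.
  exact: le_trans (Alam d) h3.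
have l2 : 0 < lam / 2 by rewrite divr_gt0.
have h5 : (d^T *m (u' - u)) 0 0 <= lam / 2 * S + (lam / 2)^-1 * (N%:R * w ^+ 2).
  rewrite mxE; apply: (@le_trans _ _ (\sum_(j < N)
    (lam / 2 * d j 0 ^+ 2 + (lam / 2)^-1 * w ^+ 2))); last first.
    rewrite big_split /= -mulr_sumr sumr_const card_ord lerD2l.
    by rewrite -mulrnAr mulr_natl.
  apply: ler_sum => j _; rewrite mxE; apply: le_trans (ler_norm _) _.
  apply: le_trans (mul_le_young (d j 0) ((u' - u) j 0) l2) _.
  rewrite lerD2l; apply: ler_wpM2l; first by rewrite invr_ge0 ltW.
  by rewrite -[leLHS]real_normK ?num_real // ler_pXn2r ?nnegrE.
have h6 : S <= 4 / lam ^+ 2 * (N%:R * w ^+ 2).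
  rewrite -(ler_pM2l l2).
  have -> : lam / 2 * (4 / lam ^+ 2 * (N%:R * w ^+ 2)) = (lam / 2)^-1 * (N%:R * w ^+ 2).
    by field; rewrite gt_eqF.
  by lra.
have N1 : 1 <= N%:R :> R by rewrite ler1n.
apply: sqr_le_norm; first by rewrite mulr_ge0 // divr_ge0 ?mulr_ge0 // ltW.
apply: (@le_trans _ _ S).
  rewrite /S (bigD1 i) //= lerDl; apply: sumr_ge0 => j _; exact: sqr_ge0.
apply: le_trans h6 _.
rewrite (_ : (2 * N%:R / lam * w) ^+ 2 = 4 / lam ^+ 2 * (N%:R ^+ 2 * w ^+ 2)); last first.
  by field; rewrite gt_eqF.
apply: ler_wpM2l; first by rewrite divr_ge0 // sqr_ge0.
by apply: ler_wpM2r; [exact: sqr_ge0|rewrite expr2 ler_peMl].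
Qed.

(** [descent] from the minimizer ends at another minimizer, of the required form; uniqueness
    identifies the two. *)
Lemma bhat_proj (u : 'cV[R]_N) : exists alpha : {set 'I_(N - 2)}, bhat A u = P alpha *m u.
Proof.
have bA := bhatP u; have [alpha [aO aobj]] := descent u bA.1.
have aA : is_argmin A u (P alpha *m u).
  by split => // b' b'O; apply: le_trans aobj _; exact: bA.2.
exists alpha; apply/eqP; rewrite -subr_eq0; apply/eqP/colP => i.
apply/eqP; rewrite [X in _ == X]mxE -normr_eq0 eq_le normr_ge0 andbT.
have u0 j : `|(u - u) j 0| <= 0 by rewrite subrr mxE normr0.
by have := argmin_lipschitz aA bA u0 i; rewrite mulr0.
Qed.

End Fixed.

(* Follow the sequence from k to the last index with the same label, step once,
   and continue without that label. *)
Lemma label_jumps (T : finType) (lab : nat -> T) (x : nat -> R) (m : nat) (a b : R) :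
  0 <= a -> 0 <= b ->
  (forall k l, (k <= l <= m)%N -> lab k = lab l -> `|x l - x k| <= a * (l - k)%:R) ->
  (forall k, (k < m)%N -> `|x k.+1 - x k| <= b) ->
  `|x m - x 0%N| <= a * m%:R + b * #|T|%:R.
Proof.
move=> a0 b0 same stp.
have key n (S : {set T}) k : (#|S| <= n)%N -> (k <= m)%N ->
    (forall l, (k <= l <= m)%N -> lab l \in S) ->
    `|x m - x k| <= a * (m - k)%:R + b * n%:R.
  elim: n S k => [|n IH] S k Sn km labS.
    have := labS k; rewrite leqnn km => /(_ isT).
    by move: Sn; rewrite leqn0 cards_eq0 => /eqP->; rewrite inE.
  have [w [/andP[kw wm] /eqP bw nw]] := @last_break (fun l => lab l == lab k) k m (eqxx _) km.
  have kwm : (k <= w <= m)%N by rewrite kw.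
  have s1 := same k w kwm (esym bw).
  have [wE|wE] := eqVneq w m.
    rewrite -wE; apply: le_trans s1 _; rewrite lerDl; exact: mulr_ge0.
  have w1m : (w < m)%N by rewrite ltn_neqAle wE.
  have s2 := stp w w1m.
  have s3 : `|x m - x w.+1| <= a * (m - w.+1)%:R + b * n%:R.
    apply: (IH (S :\ lab k)) => //.
      have := cardsD1 (lab k) S; rewrite labS ?leqnn // => E.
      by move: Sn; rewrite E add1n ltnS.
    move=> l /andP[wl lm]; rewrite !inE labS ?andbT; last first.
      by rewrite lm andbT (leq_trans kw) // ltnW.
    by apply: nw; rewrite wl.
  rewrite (_ : x m - x k = (x m - x w.+1) + (x w.+1 - x w) + (x w - x k)); last by ring.
  apply: le_trans (ler_normD _ _) _.
  have := ler_normD (x m - x w.+1) (x w.+1 - x w).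
  have h : a * (m - w.+1)%:R + a * (w - k)%:R <= a * (m - k)%:R.
    by rewrite -mulrDr -natrD; apply: ler_wpM2l => //; rewrite ler_nat; move: kw w1m; clear; lia.
  by rewrite -natr1; lra.
have := key #|T| [set: T] 0%N; rewrite cardsT leqnn subn0; exact.
Qed.

End ConvexMinimizer.

(** * The uniform bounds *)

Section UniformBounds.
Variable R : realType.

Lemma norm_infty_le (m n : nat) (A : 'M[R]_(m, n)) (c : R) : 0 <= c ->
  (forall u : 'cV[R]_n, (forall j, `|u j 0| <= 1) -> forall i, `|(A *m u) i 0| <= c) ->
  norm_infty A <= c.
Proof.
move=> c0 hA; apply: bigmax_le => // i _.
pose u : 'cV[R]_n := \col_j Num.sg (A i j).
have -> : \sum_(j < n) `|A i j| = (A *m u) i 0.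
  by rewrite mxE; apply: eq_bigr => j _; rewrite mxE mulrC normrEsg.
have u1 j : `|u j 0| <= 1.
  rewrite mxE.
  rewrite normr_sg.
  by rewrite lern1 leq_b1.
exact: le_trans (ler_norm _) (hA u u1 i).
Qed.

Lemma entry_le_norm (n : nat) (u : 'cV[R]_n) i : `|u i 0| <= `|u|.
Proof.
rewrite -[leRHS]/(mx_norm u) mx_normrE.
exact: (le_bigmax _ (fun ij : 'I_n * 'I_1 => `|u ij.1 ij.2|) (i, 0)).
Qed.

Lemma norm_le_entries (n : nat) (u : 'cV[R]_n) (c : R) : 0 <= c ->
  (forall i, `|u i 0| <= c) -> `|u| <= c.
Proof.
move=> c0 uc; rewrite -[leLHS]/(mx_norm u) mx_normrE.
by apply: bigmax_le => // -[i j] _ /=; rewrite ord1.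
Qed.

Lemma form_coords N (a : nat -> nat -> R) (A : 'M[R]_N) (v : nat -> R) (b : 'cV[R]_N) :
  (forall i k : 'I_N, A i k = a i k) ->
  form N a v (coords b) = ((\col_i v i)^T *m A *m b) 0 0.
Proof.
move=> Aa; rewrite formE -mulmxA mxE; apply: eq_bigr => i _; rewrite !mxE; congr (_ * _).
by apply: eq_bigr => k _; rewrite Aa coordsE.
Qed.

Lemma proj_matrix_bound (p : nat) : exists2 c : R, 0 < c &
  forall K M, (0 < K)%N -> (0 < M)%N -> posdef (Lambda R (K * M) K p) ->
  forall (alpha : {set 'I_(K + p - 2)}) (u : 'cV[R]_(K + p)) (m : R),
  (forall i, `|u i 0| <= m) ->
  forall i, `|(proj_matrix alpha (Lambda R (K * M) K p) *m u) i 0| <= c * m.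
Proof.
have [lam [C [lam0 lamC band]]] := Lambda_banded_form R p.
have [c c0 bound] := sup_bound p lam0 lamC; exists c => //.
move=> K M K0 M0 pd alpha u m um i.
have N0 : (0 < K + p)%N by rewrite addn_gt0 K0.
pose a i k := (beta R (K * M) K p)^-1 * gram R p K M i k.
have [sig aP] : exists sig, banded_form p (K + p) lam C sig a by exact: band.
set L := Lambda R (K * M) K p in pd *.
have La (j k : 'I_(K + p)) : L j k = a j k by exact: LambdaE.
have sol (w : 'cV[R]_(K + p)) : solves (K + p) a (is_break alpha) (coords w)
    (coords (proj_matrix alpha L *m w)).
  split; first exact: proj_matrix_pwlin.
  move=> v vV; rewrite (form_coords _ _ La) proj_matrix_orth //.
    by rewrite mxE; apply: eq_bigr => j _; rewrite !mxE coordsE mulrC.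
  have vE k : (k < K + p)%N -> coords (\col_(i < K + p) v i) k = v k.
    by move=> kN; rewrite -[k]/(val (Ordinal kN)) coordsE mxE.
  by move=> k kN nb; rewrite !vE; [exact: vV|lia..].
have ex (w : nat -> R) : exists b, solves (K + p) a (is_break alpha) w b.
  have [bV bs] := sol (\col_i w i).
  exists (coords (proj_matrix alpha L *m \col_i w i)); split => // v vV.
  by rewrite bs //; apply: eq_bigr => j _; rewrite coordsE mxE.
have um' k : (k < K + p)%N -> `|coords u k| <= m.
  by move=> kN; rewrite -[k]/(val (Ordinal kN)) coordsE; exact: um.
rewrite -coordsE.
exact: (bound _ _ _ aP _ (is_break0 _ N0) (is_break_last _ N0) ex _ _ _ (sol u) um').
Qed.

Lemma bhat_lipschitz (N : nat) (A : 'M[R]_N) (lam c : R) : (0 < N)%N -> posdef A ->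
  0 < lam -> (forall d : 'cV[R]_N, lam * \sum_(i < N) d i 0 ^+ 2 <= (d^T *m A *m d) 0 0) ->
  0 < c ->
  (forall (alpha : {set 'I_(N - 2)}) (u : 'cV[R]_N) (m : R), (forall i, `|u i 0| <= m) ->
     forall i, `|(proj_matrix alpha A *m u) i 0| <= c * m) ->
  forall u v : 'cV[R]_N, `|bhat A u - bhat A v| <= c * `|u - v|.
Proof.
move=> N0 Apd lam0 Alam c0 hc u v; rewrite distrC [`|u - v|]distrC.
set w := `|v - u|; have w0 : 0 <= w by exact: normr_ge0.
apply: norm_le_entries => [|i]; first by rewrite mulr_ge0 // ltW.
pose B := 2 * N%:R / lam; have B0 : 0 <= B by rewrite divr_ge0 ?mulr_ge0 // ltW.
pose T := {set 'I_(N - 2)}.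
(* Divide the segment into [m] steps and label each point by its branch. Only changes of branch cost
   the crude constant, each at most [B * w / m]; their total tends to 0 with growing [m]. *)
have step m : (0 < m)%N ->
    `|(bhat A v - bhat A u) i 0| <= c * w + (B * w * #|T|%:R) / m%:R.
  move=> m0; have m0' : 0 < m%:R :> R by rewrite ltr0n.
  have mn : m%:R != 0 :> R by rewrite gt_eqF.
  pose U k : 'cV[R]_N := u + (k%:R / m%:R) *: (v - u).
  have [lab labE] := choice (fun k => bhat_proj N0 Apd lam0 Alam (U k)).
  have UB k l j : (k <= l)%N -> `|(U l - U k) j 0| <= w / m%:R * (l - k)%:R.
    move=> kl; have -> : U l - U k = ((l - k)%:R / m%:R) *: (v - u).
      by rewrite /U opprD addrACA subrr add0r -scalerBl -mulrBl natrB.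
    rewrite mxE normrM ger0_norm ?divr_ge0 //.
    rewrite (_ : w / m%:R * _ = (l - k)%:R / m%:R * w); last by ring.
    by apply: ler_wpM2l; [rewrite divr_ge0|exact: entry_le_norm].
  pose x k := bhat A (U k) i 0.
  have U0 : U 0%N = u by rewrite /U mul0r scale0r addr0.
  have Um : U m = v by rewrite /U divff // scale1r addrC subrK.
  have := @label_jumps R T lab x m (c * (w / m%:R)) (B * (w / m%:R)).
  rewrite /x U0 Um => J.
  have -> : (bhat A v - bhat A u) i 0 = bhat A v i 0 - bhat A u i 0 by rewrite !mxE.
  have e : c * w + B * w * #|T|%:R / m%:R = c * (w / m%:R) * m%:R + B * (w / m%:R) * #|T|%:R.
    by field.
  rewrite e; apply: J.
  - by rewrite mulr_ge0 ?divr_ge0 // ltW.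
  - by apply: mulr_ge0 => //; rewrite divr_ge0.
  - move=> k l /andP[kl lm] E; rewrite !labE E.
    have := hc (lab l) (U l - U k) _ (fun j => UB k l j kl) i.
    by rewrite mulmxBr mxE [X in _ + X]mxE mulrA.
  move=> k km.
  have := argmin_lipschitz N0 Apd lam0 Alam (bhatP N0 Apd lam0 Alam (U k))
    (bhatP N0 Apd lam0 Alam (U k.+1)) (fun j => UB k k.+1 j (leqnSn k)) i.
  by rewrite subSnn mulr1 mxE [X in _ + X]mxE.
apply/ler_addgt0Pr => e e0.
set D := B * w * #|T|%:R in step; have D0 : 0 <= D by apply: mulr_ge0 => //; apply: mulr_ge0.
pose m := (Num.bound (D / e)).+1.
have hm : D / e < m%:R.
  apply: lt_le_trans (archi_boundP _) _; first by rewrite divr_ge0 // ltW.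
  by rewrite ler_nat /m.
apply: le_trans (step m _) _ => //; rewrite lerD2l ler_pdivrMr ?ltr0n //.
by move: hm; rewrite ltr_pdivrMr // mulrC => /ltW.
Qed.

End UniformBounds.

Theorem theorem3p1 (R : realType) (p : nat) :
  exists c : R,
    [/\ 0 < c,
        (forall n K : nat, (0 < n)%N -> (0 < K)%N -> (K %| n)%N ->
           posdef (Lambda R n K p) ->
           forall alpha : {set 'I_(K + p - 2)},
             let F := hat_matrix R alpha in
             norm_infty (F^T *m invmx (F *m Lambda R n K p *m F^T) *m F) <= c)
      & (forall n K : nat, (0 < n)%N -> (0 < K)%N -> (K %| n)%N ->
           posdef (Lambda R n K p) ->
           forall u v : 'cV[R]_(K + p),
             `|bhat (Lambda R n K p) u - bhat (Lambda R n K p) v|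
               <= c * `|u - v|)].
Proof.
have [c c0 hc] := proj_matrix_bound R p.
have [lam [C [lam0 lamC band]]] := Lambda_banded_form R p.
exists c; split => // n K n0 K0 /dvdnP[M nE] pd.
  move: n0 pd; rewrite nE mulnC => n0 pd alpha.
  have M0 : (0 < M)%N by move: n0; rewrite muln_gt0 => /andP[].
  apply: norm_infty_le; first exact: ltW.
  by move=> u u1 i; have := hc K M K0 M0 pd alpha u 1 u1 i; rewrite mulr1.
move: n0 pd; rewrite nE mulnC => n0 pd.
have M0 : (0 < M)%N by move: n0; rewrite muln_gt0 => /andP[].
have [sig aP] := band K M K0 M0 pd.
(* The coercivity constant [lam] enters only through continuity of the minimizer; the Lipschitz
   constant is the [c] of part (1). *)
apply: (bhat_lipschitz _ pd lam0 _ c0 (hc K M K0 M0 pd)) => [|d].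
  by rewrite addn_gt0 K0.
have := bf_coercive aP (coords d); rewrite (form_coords _ _ (fun i k => LambdaE R M i k K0)).
under eq_bigr do rewrite coordsE.
by have -> : \col_i coords d i = d by apply/colP => i; rewrite mxE coordsE.
Qed.
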